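(* Let $\beta>0$, $L>0$ and $0<\mathfrak{h}<1$ be constants and let $(\sigma_n)_{n\ge 1}$ be a sequence of nonnegative reals. Then, as $n\to\infty$, $$R_2\left(\Sigma_{\mathfrak{h}}(\beta,L),\sigma_n\right)=\Theta_{\beta,L,\mathfrak{h}}\left(\min\left\{1,\left(\frac{\max(1,\sigma_n^4)}{n}\right)^{\frac{2\beta}{2\beta+1}}\right\}\right).$$
   Context: Function class: let $k$ be the largest integer strictly less than $\beta$. $\Sigma(\beta,L)$ is the set of $k$-times differentiable functions $f:[0,1]\to\mathbb{R}$ with $|f^{(k)}(x)-f^{(k)}(y)|\le L|x-y|^{\beta-k}$ for all $x,y\in[0,1]$, and $\Sigma_{\mathfrak{h}}(\beta,L)=\{f\in\Sigma(\beta,L):\mathfrak{h}\le f(x)\le 1 \text{ for all } x\in[0,1]\}$. Observation model (speckle plus additive noise): for an unknown $f$ one observes $Y_i=f(i/n)\xi_i+\tau_i$, $i=1,\dots,n$, where $\xi_1,\dots,\xi_n$ are i.i.d. $\mathcal{N}(0,1)$, $\tau_1,\dots,\tau_n$ are i.i.d. $\mathcal{N}(0,\sigma_n^2)$, and the $\xi_i$ and $\tau_i$ are all mutually independent. $\mathbb{E}_f$ denotes expectation under this model. Minimax risk: $R_2(\Sigma_{\mathfrak{h}}(\beta,L),\sigma_n)=\inf_{\hat\nu}\sup_{f\in\Sigma_{\mathfrak{h}}(\beta,L)}\mathbb{E}_f\|f-\hat\nu\|_2^2$, where the infimum is over all estimators $\hat\nu$ (measurable functions of $Y_1,\dots,Y_n$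 with values in functions on $[0,1]$) and $\|g\|_2^2=\int_0^1 g(x)^2\,dx$. Asymptotic notation: $a_n=O(b_n)$ means there are constants $C,M>0$ with $|a_n|\le C|b_n|$ for all $n>M$; $a_n=\Theta(b_n)$ means $a_n=O(b_n)$ and $b_n=O(a_n)$. Subscripts on $\Theta$ indicate that the multiplicative constants $C$ depend only on the listed parameters (the threshold $M$ may depend on the sequences). *)

(* Defs.v *)
From HB Require Import structures.
From mathcomp Require Import all_boot all_order all_algebra.
From mathcomp Require Import all_classical all_reals all_analysis.

Set Implicit Arguments.
Unset Strict Implicit.
Unset Printing Implicit Defensive.

Import Order.TTheory GRing.Theory Num.Theory.
Import numFieldNormedType.Exports.

Local Open Scope classical_set_scope.
Local Open Scope ring_scope.

(* A function on [0, 1] is represented by a function [R -> R] of which only the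
   values on [0, 1] are used. *)

(* The limit is taken over [y] in [0, 1], [y != x], so that derivatives are
   one-sided at the end points. *)
Definition has_deriv01 (R : realType) (f f' : R -> R) : Prop :=
  forall x : R, 0 <= x <= 1 ->
    (f y - f x) / (y - x) @[y --> within `[0, 1] x^'] --> f' x.

Fixpoint has_nderiv01 (R : realType) (k : nat) (f g : R -> R) : Prop :=
  if k is k'.+1 then exists2 f' : R -> R, has_deriv01 f f' & has_nderiv01 k' f' g
  else forall x : R, 0 <= x <= 1 -> g x = f x.

Definition smoothness_order (R : realType) (beta : R) : nat :=
  `|Num.ceil beta - 1|%N.

Lemma smoothness_orderP (R : realType) (beta : R) : 0 < beta ->
  (smoothness_order beta)%:R < beta /\
  forall m : int, m%:~R < beta -> m <= (smoothness_order beta)%:Z.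
Proof.
move=> b0; have E : (smoothness_order beta)%:Z = Num.ceil beta - 1.
  by rewrite /smoothness_order gez0_abs// subr_ge0 -gtz0_ge1 ceil_gt0.
split=> [|m]; first by rewrite -[_%:R]/(_%:Z%:~R) E ceilB1_lt.
by rewrite E -ltzD1 subrK ceil_gt_int.
Qed.

Definition holder_class (R : realType) (beta L : R) : set (R -> R) :=
  [set f | exists2 g : R -> R, has_nderiv01 (smoothness_order beta) f g &
    forall x y : R, 0 <= x <= 1 -> 0 <= y <= 1 ->
      `|g x - g y| <= L * `|x - y| `^ (beta - (smoothness_order beta)%:R)].

Definition holder_class_bounded (R : realType) (h beta L : R) : set (R -> R) :=
  [set f | holder_class beta L f /\
    forall x : R, 0 <= x <= 1 -> h <= f x <= 1].

(* Normal law with mean [m] and standard deviation [s]. The library's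
   [normal_prob m 0] is the uniform law on [0, 1], whereas N(m, 0) has to be
   the point mass at [m]. *)
Definition normal_law (R : realType) (m s : R) (A : set R) : \bar R :=
  if s == 0 then \d_m A else normal_prob m s A.

Definition mutually_independent d (T : measurableType d) (R : realType)
    (P : probability T R) (I : finType) (X : I -> {RV P >-> R}) : Prop :=
  forall (J : {set I}) (B : I -> set R), (forall i, measurable (B i)) ->
    P (\bigcap_(i in [set` J]) (X i @^-1` B i)) =
    (\prod_(i in J) P (X i @^-1` B i))%E.

(* [s] is the standard deviation of the additive noise. *)
Record noise_model (R : realType) (n : nat) (s : R) := NoiseModel {
  noise_display : measure_display ;
  noise_space : measurableType noise_display ;
  noise_prob : probability noise_space R ;
  speckle_noise : 'I_n -> {RV noise_prob >-> R} ;
  additive_noise : 'I_n -> {RV noise_prob >-> R} ;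
  speckle_normal : forall i (A : set R), measurable A ->
    distribution noise_prob (speckle_noise i) A = normal_law 0 1 A ;
  additive_normal : forall i (A : set R), measurable A ->
    distribution noise_prob (additive_noise i) A = normal_law 0 s A ;
  noise_independent : mutually_independent
    (fun j : 'I_n + 'I_n =>
       match j with
       | inl i => speckle_noise i
       | inr i => additive_noise i
       end) }.

Lemma product_law_exists (R : realType) (n : nat)
    (mu : 'I_n -> probability R R) :
  exists P : probability (n.-tuple R) R,
    forall B : 'I_n -> set R, (forall i, measurable (B i)) ->
      P [set t | forall i, B i (tnth t i)] = (\prod_(i < n) mu i (B i))%E.
Proof.
elim: n mu => [|n IHn] mu.
  exists (dirac [tuple]) => B mB; rewrite big_ord0.
  rewrite (_ : [set t | _] = setT); first exact: probability_setT.
  by apply/seteqP; split=> // t _ [].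
have [P HP] := IHn (fun i => mu (lift ord0 i)).
pose c (x : R * n.-tuple R) : n.+1.-tuple R := [the n.+1.-tuple R of x.1 :: x.2].
have mc : measurable_fun setT c by exact: measurable_cons.
pose X : {mfun _ >-> _} := HB.pack c (isMeasurableFun.Build _ _ _ _ c mc).
exists (distribution (mu ord0 \x P)%E X) => B mB.
rewrite big_ord_recl -HP => [|i]; last exact: mB.
have mS : measurable [set t : n.-tuple R | forall i, B (lift ord0 i) (tnth t i)].
  rewrite (_ : [set t | _] = \bigcap_(i in [set: 'I_n])
      ((@tnth n R)^~ i @^-1` B (lift ord0 i))); last first.
    by apply/seteqP; split=> t /= H i; [move=> _; exact: H|exact: H].
  apply: fin_bigcap_measurable => // i _.
  have := @measurable_tnth _ R n i measurableT _ (mB (lift ord0 i)).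
  by rewrite setTI.
rewrite -product_measure1E//= /pushforward; congr product_measure1.
apply/seteqP; split=> -[x t] /=.
  by move=> H; split=> [|i]; [have := H ord0|have := H (lift ord0 i)];
    rewrite ?tnth0 ?tnthS.
move=> [H0 H] i; case: (unliftP ord0 i) => [j ->|->]; by rewrite ?tnthS// ?tnth0.
Qed.

Lemma independent_family_exists (R : realType) (I : finType)
    (mu : I -> probability R R) :
  exists (P : probability (#|I|.-tuple R) R) (X : I -> {RV P >-> R}),
    (forall i A, measurable A -> distribution P (X i) A = mu i A) /\
    mutually_independent X.
Proof.
have [P HP] := @product_law_exists R #|I| (fun k => mu (@enum_val I I k)).
pose x (i : I) (t : #|I|.-tuple R) : R := tnth t (enum_rank i).
have mx i : measurable_fun setT (x i) := @measurable_tnth _ R #|I| (enum_rank i).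
pose X (i : I) : {RV P >-> R} :=
  HB.pack (x i) (isMeasurableFun.Build _ _ _ _ (x i) (mx i)).
have joint (J : {set I}) (B : I -> set R) : (forall i, measurable (B i)) ->
    P (\bigcap_(i in [set` J]) (X i @^-1` B i)) = (\prod_(i in J) mu i (B i))%E.
  move=> mB; pose B' k := if @enum_val I I k \in J then B (@enum_val I I k) else setT.
  have mB' k : measurable (B' k) by rewrite /B'; case: ifP.
  rewrite (_ : \bigcap_(i in _) _ = [set t | forall k, B' k (tnth t k)]).
    rewrite HP// (reindex_onto (@enum_rank I) (@enum_val I I))/=; last first.
      by move=> k _; exact: enum_valK.
    rewrite [RHS]big_mkcond/=; apply: eq_big => [i|i _].
      by rewrite enum_rankK eqxx.
    by rewrite /B' enum_rankK; case: ifP => // _; rewrite probability_setT.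
  apply/seteqP; split=> t /= H.
    move=> k; rewrite /B'; case: ifP => // kJ.
    by have := H _ kJ; rewrite /= /x enum_valK.
  by move=> i /= iJ; have := H (enum_rank i); rewrite /B' enum_rankK iJ.
have marg i A : measurable A -> distribution P (X i) A = mu i A.
  move=> mA; have := joint [set i]%SET (fun=> A) (fun=> mA).
  rewrite big_set1 => <-; rewrite /distribution /pushforward; congr (P _).
  apply/seteqP; split=> t /= H; last by apply: H; rewrite /= inE.
  by move=> k /=; rewrite inE => /eqP ->.
exists P, X; split=> // J B mB; rewrite joint//.
by apply: eq_bigr => i _; rewrite -marg.
Qed.

(* So a statement about all noise models is not vacuous. *)
Lemma noise_model_inhabited (R : realType) (n : nat) (s : R) :
  inhabited (noise_model n s).
Proof.
have [g Hg] : exists g : R -> probability R R,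
    forall s A, measurable A -> g s A = normal_law 0 s A.
  pose idR : measurableTypeR R -> R := idfun.
  have mid : measurable_fun setT idR by exact: measurable_id.
  pose X : {mfun measurableTypeR R >-> R} :=
    HB.pack idR (isMeasurableFun.Build _ _ _ _ idR mid).
  exists (fun u : R => if u == 0 then (dirac (0 : R) : probability R R)
    else (distribution (normal_prob 0 u) X : probability R R)) => u A mA.
  by rewrite /normal_law; case: ifP.
have [P [X [HX iX]]] := independent_family_exists
  (fun j : 'I_n + 'I_n => match j with inl _ => g 1 | inr _ => g s end).
constructor; apply: (@NoiseModel _ _ _ _ _ P (fun i => X (inl i))
  (fun i => X (inr i))) => [i A mA|i A mA|]; rewrite ?HX ?Hg//.
rewrite (_ : (fun j => _) = X) //.
by apply/funext => -[].
Qed.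

(* ['I_n] is {0, ..., n - 1}: the i-th design point is [i.+1 / n]. *)
Definition observation (R : realType) (n : nat) (s : R)
    (N : noise_model n s) (f : R -> R) (w : noise_space N) : n.-tuple R :=
  [tuple f (i.+1%:R / n%:R) * speckle_noise N i w + additive_noise N i w
    | i < n].

(* The value of the estimator at the data [y] is the function [nu y] on
   [0, 1]; measurability is joint in the data and the argument. *)
Definition is_estimator (R : realType) (n : nat)
    (nu : n.-tuple R -> R -> R) : Prop :=
  measurable_fun ([set: n.-tuple R] `*` [set` `[(0 : R), 1]])
    (fun p : n.-tuple R * R => nu p.1 p.2).

Definition sqL2norm01 (R : realType) (g : R -> R) : \bar R :=
  (\int[lebesgue_measure]_(x in `[0%R, 1%R]) (g x ^+ 2)%:E)%E.

Definition risk (R : realType) (n : nat) (s : R) (N : noise_model n s)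
    (f : R -> R) (nu : n.-tuple R -> R -> R) : \bar R :=
  (\int[noise_prob N]_w sqL2norm01 (fun x => f x - nu (observation f w) x)%R)%E.

Definition minimax_risk (R : realType) (n : nat) (s : R) (N : noise_model n s)
    (F : set (R -> R)) : \bar R :=
  ereal_inf [set ereal_sup [set risk N f nu | f in F] |
              nu in [set nu : n.-tuple R -> R -> R | is_estimator nu]].

Definition bigO_const (R : realType) (C : R) (a b : nat -> \bar R) : Prop :=
  exists2 M : R, 0 < M &
    forall n : nat, M < n%:R -> (`|a n| <= C%:E * `|b n|)%E.

Definition bigTheta_const (R : realType) (C1 C2 : R) (a b : nat -> \bar R) :
    Prop :=
  bigO_const C1 a b /\ bigO_const C2 b a.

(* Main.v *)
Require Import Defs.
From HB Require Import structures.
From mathcomp Require Import all_boot all_order all_algebra.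
From mathcomp Require Import all_classical all_reals all_analysis.
From mathcomp Require Import measurable_realfun zify ring lra.
Import Order.TTheory GRing.Theory Num.Theory.
Import numFieldNormedType.Exports.
Set Implicit Arguments.
Unset Strict Implicit.
Unset Printing Implicit Defensive.
Local Open Scope ring_scope.

(** Given [f], the observations are independent centred normal variables of
    variance [f (i / n) ^+ 2 + s ^+ 2] (lemmas [observation_law] and
    [risk_law]), where [s] is the standard deviation of the additive noise. So
    the unknown enters through variances only, the squares of the observations
    are unbiased for them, and the noise of these squares has variance of order
    [S = max 1 (s ^+ 4)]. As [f >= h], estimating [f] is equivalent to
    estimating [f ^+ 2]: the problem is a regression with [n] data and noise
    variance [S], and [eta = (S / n) `^ (1 / (2 * beta + 1))] is the length scale
    at which the squared bias [eta `^ (2 * beta)] of a local average equals its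
    variance [S / (n * eta)].

    Upper bound ([upper_bound]). The estimator averages the centred squares
    over a window of about [n * eta] design points, with weights of size
    [O (1 / (n * eta))] that reproduce polynomials ([interp_weight]), clips the
    result at [h ^+ 2] and takes the square root. With [k] the number of
    derivatives in the class, [f] is near every point a polynomial of degree [k]
    up to [O (eta `^ beta)] ([taylor01]), hence [f ^+ 2] a polynomial of degree
    [2 * k] up to an error of that order ([holder_square_approx]); this bounds
    the bias. The variance is that of a
    linear combination of independent centred variables
    ([product_gauss_quadratic]). When [eta] is not small, the rate is of order 1
    and the zero estimator is good enough.

    Lower bound ([lower_bound]). Cut [0, 1] into [m] of order [1 / eta] cells and
    consider the [2 ^ m] functions equal to [h] plus, on any given set of cells,
    a bump of height of order [A * m `^ (- beta)] ([hyp_fun]); for small [A] they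
    belong to the class. Switching one bump changes about [n / m] variances by a factor
    [1 + O (A * m `^ (- beta) / sqrt S)], so the sum of the squared relative
    changes is [O (A ^+ 2)] ([flip_variance]) and the chi-square divergence
    between the two laws stays bounded. Consequently no function of the
    observations can tell the two cases apart ([two_point]), and any estimator
    errs on a fixed proportion of the cells for some choice of the bumps
    ([assouad]); each error costs a squared distance of order
    [A ^+ 2 * m `^ (- 2 * beta) / m]. *)

(** * Product laws on tuples *)

Section measure_tools.
Local Open Scope classical_set_scope.
Local Open Scope ereal_scope.

Definition box (R : realType) n (B : 'I_n -> set R) : set (n.-tuple R) :=
  [set t | forall i, B i (tnth t i)].

Lemma measurable_box (R : realType) n (B : 'I_n -> set R) :
  (forall i, measurable (B i)) -> measurable (box B).
Proof.
move=> mB; rewrite (_ : box B = \bigcap_(i in [set: 'I_n])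
    ((@tnth n R)^~ i @^-1` B i)); last first.
  by apply/seteqP; split=> t /= H i; [move=> _; exact: H|exact: H].
apply: fin_bigcap_measurable => // i _.
by have := @measurable_tnth _ R n i measurableT _ (mB i); rewrite setTI.
Qed.

Definition boxes (R : realType) n : set (set (n.-tuple R)) :=
  [set C | exists2 B : 'I_n -> set R, forall i, measurable (B i) & C = box B].

Lemma sub_sigma_boxes (R : realType) n :
  (measurable : set (set (n.-tuple R))) `<=` <<s @boxes R n >>.
Proof.
apply: smallest_sub; first exact: smallest_sigma_algebra.
case: n => [|n]; first by rewrite big_ord0.
rewrite -bigcup_mkord_ord; apply: bigcup_sub => i _ _ [B mB <-].
apply: sub_sigma_algebra; exists (fun j => if j == inord i then B else setT).
  by move=> j; case: ifP.
rewrite setTI; apply/seteqP; split => t /=.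
  by move=> tB j; case: eqP => // ->.
by move=> /(_ (inord i)); rewrite eqxx.
Qed.

(** Boxes are stable under intersection and generate the measurable sets. *)
Lemma eq_probability_tuple (R : realType) n (P Q : probability (n.-tuple R) R) :
  (forall B : 'I_n -> set R, (forall i, measurable (B i)) ->
    P (box B) = Q (box B)) ->
  forall A, measurable A -> P A = Q A.
Proof.
move=> PQ A mA.
have mG : @boxes R n `<=` (measurable : set (set (n.-tuple R))) by move=> _ [B mB ->]; exact: measurable_box.
apply: (@g_sigma_algebra_measure_unique _ _ _ _ mG (fun=> setT)) => //.
- by move=> _; exists (fun=> setT) => //; apply/seteqP; split.
- by apply/seteqP; split => // x _; exists 0%N.
- move=> _ _ [B mB ->] [C mC ->]; exists (fun i => B i `&` C i).
    by move=> i; exact: measurableI.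
  apply/seteqP; split => t /=; first by case=> tB tC i; split.
  by move=> H; split=> i; case: (H i).
- by move=> _ [B mB ->]; exact: PQ.
- by move=> _; rewrite [ltLHS]probability_setT ltry.
- exact: sub_sigma_boxes.
Qed.

Definition product_law (R : realType) n (mu : 'I_n -> probability R R)
    (P : probability (n.-tuple R) R) :=
  forall B : 'I_n -> set R, (forall i, measurable (B i)) ->
    P (box B) = \prod_(i < n) mu i (B i).

Definition tcons (R : realType) n (x : R * n.-tuple R) : n.+1.-tuple R :=
  [the n.+1.-tuple R of x.1 :: x.2].

Lemma measurable_tcons (R : realType) n : measurable_fun setT (@tcons R n).
Proof. exact: measurable_cons. Qed.

(** The first coordinate can be integrated out separately. This is the only form
    in which independence is used: every bound on a product law is proved by
    induction on the number of factors. *)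
Lemma product_lawS (R : realType) n (mu : 'I_n.+1 -> probability R R)
    (P : probability (n.+1.-tuple R) R) : product_law mu P ->
  exists2 Q : probability (n.-tuple R) R,
    product_law (fun i => mu (lift ord0 i)) Q &
    forall f : n.+1.-tuple R -> \bar R, measurable_fun [set: n.+1.-tuple R] f ->
      (forall t, 0 <= f t) ->
      \int[P]_t f t = \int[mu ord0]_x \int[Q]_t f (tcons (x, t)).
Proof.
move=> HP.
have [Q HQ] : exists Q : probability (n.-tuple R) R,
    product_law (fun i => mu (lift ord0 i)) Q by exact: product_law_exists.
exists Q => // f mf f0.
pose X : {mfun _ >-> _} := HB.pack (@tcons R n)
  (isMeasurableFun.Build _ _ _ _ _ (@measurable_tcons R n)).
pose P' := distribution (mu ord0 \x Q) X.
have PP' A : measurable A -> P A = P' A.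
  apply: (@eq_probability_tuple R n.+1 P P') => B mB.
  rewrite HP// big_ord_recl -HQ; last by move=> i; exact: mB.
  have mS := measurable_box (fun i => mB (lift ord0 i)).
  rewrite -product_measure1E//= /P' /distribution /pushforward; congr product_measure1.
  apply/seteqP; split=> -[x t] /=.
    move=> [H0 H] i; rewrite /tcons/=.
    by case: (unliftP ord0 i) => [j ->|->]; rewrite ?tnthS// ?tnth0.
  by move=> H; split=> [|i]; [have := H ord0|have := H (lift ord0 i)];
    rewrite ?tnth0 ?tnthS.
transitivity (\int[P']_t f t).
  by apply: eq_measure_integral => A mA _; exact: PP'.
rewrite /P' ge0_integral_distribution//.
rewrite fubini_tonelli1//=; apply: measurableT_comp => //; exact: measurable_tcons.
Qed.

End measure_tools.

(** * Centred normal laws *)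

Section gauss_tools.
Local Open Scope classical_set_scope.
Local Open Scope ereal_scope.
Variable R : realType.
Local Notation mu := (@lebesgue_measure R).

(** The density of [normal_prob m s] given by the Radon-Nikodym theorem agrees
    almost everywhere with [normal_pdf m s], as both have the same integral over
    every measurable set. *)
Lemma ge0_integral_normal_prob (m s : R) (f : R -> \bar R) :
  measurable_fun [set: R] f -> (forall x, 0 <= f x) ->
  \int[normal_prob m s]_x f x = \int[mu]_x (f x * (normal_pdf m s x)%:E).
Proof.
move=> mf f0.
have dom := @normal_prob_dominates R m s.
rewrite -(Radon_Nikodym_SigmaFinite.change_of_variables dom)//.
have iD := Radon_Nikodym_SigmaFinite.f_integrable dom.
have mpdf : measurable_fun [set: R] (fun x => (normal_pdf m s x)%:E).
  by apply/measurable_EFinP; exact: measurable_normal_pdf.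
apply: ae_eq_integral => //.
- by apply: emeasurable_funM => //; exact: measurable_int iD.
- exact: emeasurable_funM.
- have : ae_eq mu setT (Radon_Nikodym_SigmaFinite.f (normal_prob m s) mu)
      (fun x => (normal_pdf m s x)%:E).
    apply: integral_ae_eq => // E _ mE.
    by rewrite -(Radon_Nikodym_SigmaFinite.f_integral dom).
  by apply: filterS => x /= H /H ->.
Qed.

(** The image of Lebesgue measure under [x |-> a * x + b], scaled by [a], gives
    intervals their length, hence is Lebesgue measure. *)
Lemma ge0_integral_affine (a b : R) (f : R -> \bar R) : (0 < a)%R ->
  measurable_fun [set: R] f -> (forall x, 0 <= f x) ->
  a%:E * \int[mu]_x f (a * x + b)%R = \int[mu]_x f x.
Proof.
move=> a0 mf f0.
pose phi (x : R) : measurableTypeR R := (a * x + b)%R.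
have mphi : measurable_fun setT phi.
  by apply: measurable_funD => //; exact: measurable_funM.
pose nu0 : {measure set (measurableTypeR R) -> \bar R} := pushforward mu phi.
pose nu := nu0 mphi.
pose nu' : {measure set _ -> \bar R} := mscale (NngNum (ltW a0)) nu.
have nuE A : measurable A -> mu A = nu' A.
  move=> mA; apply: lebesgue_measure_unique => // _ [[u v]] _ <-.
  rewrite /nu' /= /mscale/= /nu /pushforward.
  rewrite (_ : _ @^-1` _ = `](u - b) / a, (v - b) / a]%classic)%R; last first.
    apply/seteqP; split=> x /=; rewrite !in_itv/= ltr_pdivrMr// ler_pdivlMr//;
      by rewrite ltrBlDr lerBrDr (mulrC x).
  rewrite !lebesgue_measure_itv/= !lte_fin ltr_pM2r ?invr_gt0// ltrD2r.
  case: ifP => _; last by rewrite mule0.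
  by rewrite -!EFinD -EFinM; congr EFin; field; rewrite gt_eqF.
transitivity (a%:E * \int[nu]_x f x).
  by congr (_ * _); rewrite ge0_integral_pushforward.
transitivity (\int[nu']_x f x); first by rewrite ge0_integral_mscale.
by apply: eq_measure_integral => A mA _; rewrite -nuE.
Qed.

(** Carries a law on [measurableTypeR R] over to [R]. *)
Definition idR : measurableTypeR R -> R := idfun.

Lemma measurable_idR : measurable_fun setT idR.
Proof. exact: measurable_id. Qed.

HB.instance Definition _ := isMeasurableFun.Build _ _ _ _ idR measurable_idR.

Lemma normal_law_probability :
  {g : R -> probability R R | forall s A, g s A = normal_law 0 s A}.
Proof.
exists (fun s => if s == 0%R then dirac (0 : R)%R : probability R R
  else distribution (normal_prob 0 s) idR) => s A.
by rewrite /normal_law; case: ifP.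
Qed.

(** N(0, s^2) as a bundled probability, including the point mass for [s = 0]. It
    is extracted from an opaque proof so that only [gaussE] describes it. *)
Definition gauss (s : R) : probability R R := sval normal_law_probability s.

Lemma gaussE s A : gauss s A = normal_law 0 s A.
Proof. exact: (svalP normal_law_probability). Qed.

Lemma gauss_density (s : R) (f : R -> \bar R) : (0 < s)%R ->
  measurable_fun [set: R] f -> (forall x, 0 <= f x) ->
  \int[gauss s]_x f x = \int[mu]_x (f x * (normal_pdf 0 s x)%:E).
Proof.
move=> s0 mf f0.
transitivity (\int[distribution (normal_prob 0 s) idR]_x f x).
  apply: eq_measure_integral => A mA _.
  by rewrite [LHS]gaussE /normal_law gt_eqF.
rewrite ge0_integral_distribution//.
exact: ge0_integral_normal_prob.
Qed.

Lemma ge0_integral_gauss_scale (a : R) (f : R -> \bar R) : (0 < a)%R ->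
  measurable_fun [set: R] f -> (forall x, 0 <= f x) ->
  \int[gauss 1]_x f (a * x)%R = \int[gauss a]_x f x.
Proof.
move=> a0 mf f0.
have mfa : measurable_fun [set: R] (fun x => f (a * x)%R).
  by apply: measurableT_comp => //; exact: measurable_funM.
rewrite (gauss_density ltr01 mfa (fun x => f0 _)) (gauss_density a0 mf f0).
have mpdf t : measurable_fun [set: R] (fun x => (normal_pdf 0 t x)%:E).
  by apply/measurable_EFinP; exact: measurable_normal_pdf.
have maff : measurable_fun [set: R] (fun x : R => (a * x + 0)%R).
  by apply: measurable_funD; [exact: measurable_funM|exact: measurable_cst].
have mF : measurable_fun [set: R] (fun x => f x * (normal_pdf 0 a x)%:E).
  exact: emeasurable_funM.
have F0 x : 0 <= f x * (normal_pdf 0 a x)%:E.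
  by rewrite mule_ge0// lee_fin normal_pdf_ge0.
rewrite -[RHS](ge0_integral_affine (a := a) 0%R)// -ge0_integralZl//=.
- apply: eq_integral => x _; rewrite addr0 muleCA -EFinM; congr (_ * _%:E).
  rewrite !normal_pdfE ?gt_eqF// /normal_peak /normal_fun.
  rewrite !subr0 expr1n mul1r -mulrnAr sqrtrM ?sqr_ge0// sqrtr_sqr gtr0_norm//.
  rewrite invfM !mulrA divff ?gt_eqF// mul1r.
  congr (_ * expR _)%R; rewrite exprMn.
  by field; rewrite gt_eqF.
- exact: (measurableT_comp mF maff).
- by rewrite lee_fin ltW.
Qed.

Lemma normal_peakE (a : R) : (0 < a)%R ->
  normal_peak a = (a * Num.sqrt (pi *+ 2))^-1%R.
Proof.
by move=> a0; rewrite /normal_peak -mulrnAr sqrtrM ?sqr_ge0// sqrtr_sqr gtr0_norm.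
Qed.

Lemma sqrt_pi2_gt0 : (0 < Num.sqrt (pi *+ 2) :> R)%R.
Proof. by rewrite sqrtr_gt0 mulrn_wgt0// pi_gt0. Qed.

(** Completing the square: the joint density of a centred Gaussian signal of
    standard deviation [c] and a centred Gaussian noise of standard deviation
    [s], observed through their sum [y], factors into the density of the sum
    and the conditional density of the noise. *)
Lemma normal_pdf_sum (c s y t : R) : (0 < c)%R -> (0 < s)%R ->
  (c^-1 * normal_pdf 0 1 (c^-1 * y + - (c^-1 * t)) * normal_pdf 0 s t =
   normal_pdf 0 (Num.sqrt (c ^+ 2 + s ^+ 2)) y *
   normal_pdf (s ^+ 2 / (c ^+ 2 + s ^+ 2) * y)
     (c * s / Num.sqrt (c ^+ 2 + s ^+ 2)) t)%R.
Proof.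
move=> c0 s0; set S := Num.sqrt _.
have cs0 : (0 < c ^+ 2 + s ^+ 2)%R by rewrite addr_gt0// exprn_gt0.
have S0 : (0 < S)%R by rewrite sqrtr_gt0.
have SE : (S ^+ 2 = c ^+ 2 + s ^+ 2)%R by rewrite sqr_sqrtr// ltW.
have u0 : (0 < c * s / S)%R by rewrite divr_gt0// mulr_gt0.
rewrite !normal_pdfE ?gt_eqF// /normal_fun !normal_peakE//.
have p0 := sqrt_pi2_gt0.
set p := Num.sqrt (pi *+ 2) in p0 *.
set e1 := expR _; set e2 := expR _; set e3 := expR _; set e4 := expR _.
have -> : (c^-1 * ((1 * p)^-1 * e1) * ((s * p)^-1 * e2) =
    (c * s * p ^+ 2)^-1 * (e1 * e2))%R by field; rewrite !gt_eqF.
have -> : ((S * p)^-1 * e3 * ((c * s / S * p)^-1 * e4) =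
    (c * s * p ^+ 2)^-1 * (e3 * e4))%R by field; rewrite !gt_eqF.
congr (_ * _)%R; rewrite -!expRD; congr expR.
rewrite exprMn exprVn exprMn SE.
by field; rewrite !gt_eqF//.
Qed.

End gauss_tools.

Section normal_sum.
Local Open Scope classical_set_scope.
Local Open Scope ereal_scope.
Variable R : realType.
Local Notation mu := (@lebesgue_measure R).

(** After the change of variable [y = c * x + t], the factorization
    [normal_pdf_sum] turns the inner integral over [t] into the total mass of a
    normal density. *)
Lemma ge0_integral_gauss_sum (c s : R) (f : R -> \bar R) :
  (0 < c)%R -> (0 < s)%R ->
  measurable_fun [set: R] f -> (forall x, 0 <= f x) ->
  \int[gauss s]_t \int[gauss 1]_x f (c * x + t)%R =
  \int[gauss (Num.sqrt (c ^+ 2 + s ^+ 2))]_y f y.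
Proof.
move=> c0 s0 mf f0; set S := Num.sqrt _.
have mpdf m t : measurable_fun [set: R] (fun x => (normal_pdf m t x)%:E).
  by apply/measurable_EFinP; exact: measurable_normal_pdf.
have pdf0 m t x : 0 <= (normal_pdf m t x : R)%:E by rewrite lee_fin normal_pdf_ge0.
have maff (a b : R) : measurable_fun [set: R] (fun x : R => (a * x + b)%R).
  by apply: measurable_funD; [exact: measurable_funM|exact: measurable_cst].
pose g (z : R * R) := f z.2 *
  (c^-1 * normal_pdf 0 1 (c^-1 * z.2 + - (c^-1 * z.1)) * normal_pdf 0 s z.1)%:E.
have g0 z : 0 <= g z.
  by rewrite /g mule_ge0// lee_fin !mulr_ge0 ?normal_pdf_ge0// invr_ge0 ltW.
have mg : measurable_fun setT g.
  apply: emeasurable_funM; first exact: measurableT_comp.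
  apply/measurable_EFinP; apply: measurable_funM; last first.
    by apply: measurableT_comp => //; exact: measurable_normal_pdf.
  apply: measurable_funM => //.
  apply: measurableT_comp => /=; first exact: measurable_normal_pdf.
  apply: measurable_funD; first exact: measurable_funM.
  by apply: measurableT_comp => //; exact: measurable_funM.
transitivity (\int[mu]_t \int[mu]_y g (t, y)).
  rewrite gauss_density//; last 2 first.
  - have : measurable_fun setT (fun z : R * R => f (c * z.2 + z.1)%R).
      apply: measurableT_comp => //.
      by apply: measurable_funD => //; exact: measurable_funM.
    move=> /(@measurable_fun_fubini_tonelli_F _ _ _ _ _ (gauss 1)).
    by apply.
  - by move=> t; exact: integral_ge0.
  apply: eq_integral => t _.
  rewrite gauss_density//; last exact: (measurableT_comp mf (maff c t)).
  have mF : measurable_fun [set: R] (fun x => f (c * x + t)%R * (normal_pdf 0 1 x)%:E).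
    by apply: emeasurable_funM => //; exact: (measurableT_comp mf (maff c t)).
  have F0 x : 0 <= f (c * x + t)%R * (normal_pdf 0 1 x)%:E by rewrite mule_ge0.
  have ci : (0 < c^-1)%R by rewrite invr_gt0.
  rewrite -(ge0_integral_affine (- (c^-1 * t)) ci)//.
  rewrite muleAC -EFinM -ge0_integralZl//=; first last.
  - by rewrite lee_fin mulr_ge0 ?normal_pdf_ge0// ltW.
  - exact: (measurableT_comp mF (maff _ _)).
  apply: eq_integral => y _; rewrite /g/=.
  rewrite mulrDr mulrN !mulrA divff ?gt_eqF// !mul1r subrK.
  by rewrite muleCA -EFinM -mulrA mulrAC mulrA.
have -> := @fubini_tonelli _ _ _ _ R mu mu g mg g0.
rewrite gauss_density//=; last by rewrite sqrtr_gt0 addr_gt0// exprn_gt0.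
apply: eq_integral => y _.
under eq_integral do rewrite /g/= normal_pdf_sum// EFinM muleA.
rewrite ge0_integralZl//=; [|exact: mpdf|by rewrite mule_ge0].
by rewrite integral_normal_pdf mule1.
Qed.

(** The law of one observation: speckle scaled by [c], plus additive noise. *)
Lemma gauss_sum (c s : R) (B : set R) :
  (0 < c)%R -> (0 <= s)%R -> measurable B ->
  (gauss 1 \x gauss s) [set z | B (c * z.1 + z.2)%R] =
  gauss (Num.sqrt (c ^+ 2 + s ^+ 2)) B.
Proof.
move=> c0 s0 mB.
have mD : measurable_fun [set: R * R] (fun z : R * R => c * z.1 + z.2)%R.
  by apply: measurable_funD => //; exact: measurable_funM.
have mA : measurable [set z : R * R | B (c * z.1 + z.2)%R].
  by have := mD measurableT _ mB; rewrite setTI.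
have m1 : measurable_fun [set: R] (fun x => (\1_B x : R)%:E).
  by apply/measurable_EFinP; exact: measurable_indic.
have i0 (x : R) : 0 <= (\1_B x : R)%:E by rewrite lee_fin.
transitivity (\int[gauss 1 \x gauss s]_z (\1_B (c * z.1 + z.2)%R : R)%:E).
  by have := integral_indic (gauss 1 \x gauss s) measurableT mA; rewrite setIT => <-.
have mI : measurable_fun [set: R * R] (fun z : R * R => (\1_B (c * z.1 + z.2)%R : R)%:E).
  exact: (measurableT_comp m1 mD).
rewrite fubini_tonelli2//=.
have mG : measurable_fun [set: R]
    (fun t => \int[gauss 1]_x (\1_B (c * x + t)%R : R)%:E).
  apply: (measurable_fun_fubini_tonelli_G (m1 := gauss 1)
    (fun z : R * R => (\1_B (c * z.1 + z.2)%R : R)%:E)) => //.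
transitivity (\int[gauss (Num.sqrt (c ^+ 2 + s ^+ 2))]_y (\1_B y : R)%:E); last first.
  by rewrite integral_indic// setIT.
have [s00|s00] := eqVneq s 0%R.
  have -> : Num.sqrt (c ^+ 2 + s ^+ 2) = c.
    by rewrite s00 expr0n addr0 sqrtr_sqr gtr0_norm.
  rewrite -[RHS](ge0_integral_gauss_scale c0 m1 i0).
  transitivity (\int[@dirac _ R (0%R : R) R]_y
      \int[gauss 1]_x (\1_B (c * x + y)%R : R)%:E).
    apply: eq_measure_integral => A mA' _.
    by rewrite [LHS]gaussE /normal_law s00 eqxx.
  rewrite integral_dirac// diracT mul1e.
  by under eq_integral do rewrite addr0.
by rewrite -[RHS]ge0_integral_gauss_sum// lt_neqAle eq_sym s00.
Qed.

End normal_sum.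

(** * The law of the observations *)

Definition obs_sd (R : realType) (n : nat) (s : R) (f : R -> R) (i : 'I_n) : R :=
  Num.sqrt (f (i.+1%:R / n%:R) ^+ 2 + s ^+ 2).

Lemma design01 (R : realType) n (i : 'I_n) : 0 <= (i.+1%:R / n%:R : R) <= 1.
Proof.
have n0 : (0 < n)%N by exact: leq_ltn_trans (ltn_ord i).
by rewrite divr_ge0//= ler_pdivrMr ?ltr0n// mul1r ler_nat.
Qed.

Lemma obs_sd_gt0 (R : realType) n (s : R) (f : R -> R) (i : 'I_n) :
  0 < f (i.+1%:R / n%:R) -> 0 < obs_sd s f i.
Proof. by move=> f0; rewrite /obs_sd sqrtr_gt0 ltr_pwDl ?sqr_ge0// exprn_gt0. Qed.

Section observation_law.
Local Open Scope classical_set_scope.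
Local Open Scope ereal_scope.
Variable R : realType.

(** [E] stands for constraints on the remaining variables and [K] for its
    probability. Both sides are finite measures in [C], so that agreement on
    rectangles extends to all measurable sets of the plane. *)
Lemma joint_law_pair d (T : measurableType d) (P : probability T R)
    (X Y : {RV P >-> R}) (E : set T) (mu nu : probability R R) (K : R) :
  measurable E -> (0 <= K)%R ->
  (forall A B, measurable A -> measurable B ->
    P (X @^-1` A `&` Y @^-1` B `&` E) = K%:E * (mu A * nu B)) ->
  forall C : set (R * R), measurable C ->
    P ([set w | C (X w, Y w)] `&` E) = K%:E * (mu \x nu) C.
Proof.
move=> mE K0 PE C mC.
pose Z (w : T) : R * R := (X w, Y w).
have mZ : measurable_fun setT Z by apply: measurable_fun_pair.
pose m0 : {measure set (R * R) -> \bar R} := pushforward (mrestr P mE) Z.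
pose m' := m0 mZ.
pose mu' : {finite_measure set R -> \bar R} := mscale (NngNum K0) mu.
have := @product_measure_unique _ _ _ _ R mu' nu m'.
move=> /(_ _ C mC) H.
transitivity (m' C) => //; rewrite -H.
  rewrite /product_measure1 ge0_integral_mscale//.
  exact: measurable_fun_xsection.
by move=> A B mA mB; rewrite [LHS](PE A B mA mB) muleA.
Qed.

Lemma bigcap_sumType (T U : Type) n (X : 'I_n + 'I_n -> T -> U) (B : 'I_n + 'I_n -> set U) :
  \bigcap_(i in [set` [set: 'I_n + 'I_n]%SET]) (X i @^-1` B i) =
  [set w | forall i, B (inl i) (X (inl i) w) /\ B (inr i) (X (inr i) w)].
Proof.
apply/seteqP; split => w /= H.
  by move=> i; split; apply: H; rewrite /= inE.
by move=> [i|i] _ /=; have [] := H i.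
Qed.

Section model.
Variables (n : nat) (s : R) (N : noise_model n s).
Let P := noise_prob N.
Let xi := @speckle_noise _ _ _ N.
Let tau := @additive_noise _ _ _ N.

(** Independence of the [n + n] noise variables only gives the probability of
    boxes, whereas an observation is a function of the pair [(xi i, tau i)]. The
    induction on [k] replaces the rectangles by arbitrary plane sets one pair at
    a time: only the pairs of index at least [k] are still tested by
    rectangles. *)
Lemma noise_pairs_law (C : 'I_n -> set (R * R)) :
  (forall i, measurable (C i)) ->
  P [set w | forall i, C i (xi i w, tau i w)] =
  \prod_(i < n) (gauss 1 \x gauss s) (C i).
Proof.
suff H k : forall C : 'I_n -> set (R * R), (forall i, measurable (C i)) ->
    (forall i : 'I_n, (k <= i)%N -> exists AB : set R * set R,
      [/\ measurable AB.1, measurable AB.2 & C i = AB.1 `*` AB.2]) ->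
    P [set w | forall i, C i (xi i w, tau i w)] =
    \prod_(i < n) (gauss 1 \x gauss s) (C i).
  by move=> mC; apply: (H n) => // i; rewrite leqNgt ltn_ord.
elim: k => [|k IH] {}C mC CR.
  have /choice[AB ABP] i := CR i (leq0n i).
  pose B (j : 'I_n + 'I_n) := match j with inl i => (AB i).1 | inr i => (AB i).2 end.
  have mB j : measurable (B j) by case: j => i; have [] := ABP i.
  have := @noise_independent _ _ _ N [set: 'I_n + 'I_n]%SET B mB.
  rewrite bigcap_sumType => HP.
  transitivity (P [set w | forall i, B (inl i) (xi i w) /\ B (inr i) (tau i w)]).
    congr (P _); apply/seteqP; split => w /= H i.
      by have := H i; have [_ _ ->] := ABP i.
    by have := H i; have [_ _ ->] := ABP i.
  rewrite [LHS]HP (eq_bigl xpredT); last by move=> i; rewrite inE.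
  rewrite big_sumType/= -big_split/=; apply: eq_bigr => i _.
  have [mA mA' ->] := ABP i; rewrite product_measure1E//; congr (_ * _).
    by rewrite [RHS]gaussE -(speckle_normal N i).
  by rewrite [RHS]gaussE -(additive_normal N i).
case: (ltnP k n) => [kn|nk]; last first.
  by apply: IH => // i ki; have := ltn_ord i; rewrite ltnNge (leq_trans nk ki).
pose i0 := Ordinal kn.
pose E := [set w | forall i, i != i0 -> C i (xi i w, tau i w)].
have mpair i : measurable_fun setT (fun w => (xi i w, tau i w)).
  by apply: measurable_fun_pair.
have mE : measurable E.
  rewrite (_ : E = \bigcap_(i in [set i | i != i0]) (fun w => (xi i w, tau i w)) @^-1` (C i)) //.
  apply: fin_bigcap_measurable => [|i _]; first exact: finite_finset.
  by have := mpair i measurableT _ (mC i); rewrite setTI.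
pose K := \prod_(i < n | i != i0) (gauss 1 \x gauss s) (C i).
have K0 : 0 <= K by apply: prode_ge0 => i _; exact: measure_ge0.
have Kfin : K \is a fin_num.
  apply: prode_fin_num => i _.
  have : (gauss 1 \x gauss s) (C i) <= 1.
    apply: le_trans (_ : (gauss 1 \x gauss s) setT <= _).
      by apply: le_measure; rewrite ?inE.
    by rewrite -setXTT [leLHS]product_measure1E// -[leRHS]mule1 lee_pmul// probability_le1.
  move=> H; rewrite ge0_fin_numE//; exact: le_lt_trans H (ltry _).
have split_i0 (D : set (R * R)) :
    [set w | forall i, (if i == i0 then D else C i) (xi i w, tau i w)] =
    [set w | D (xi i0 w, tau i0 w)] `&` E.
  apply/seteqP; split=> w /=.
    move=> H; split; first by have := H i0; rewrite eqxx.
    by move=> i ii0; have := H i; rewrite (negbTE ii0).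
  by move=> [H1 H2] i; case: eqVneq => [->|/H2].
have -> : [set w | forall i, C i (xi i w, tau i w)] =
    [set w | C i0 (xi i0 w, tau i0 w)] `&` E.
  rewrite -split_i0; apply/seteqP; split=> w /= H i; have := H i; by case: eqVneq => [->|].
rewrite (bigD1 i0)//= -/K -(fineK Kfin) muleC.
apply: joint_law_pair => //; first exact: fine_ge0.
move=> A B mA mB.
transitivity (P [set w | forall i, (if i == i0 then A `*` B else C i) (xi i w, tau i w)]).
  by rewrite split_i0; congr (P _).
rewrite (IH (fun i => if i == i0 then A `*` B else C i)); last 2 first.
- by move=> i; case: ifP => // _; exact: measurableX.
- move=> i ki; case: eqVneq => [_|ii0]; first by exists (A, B).
  apply: CR; rewrite ltn_neqAle ki andbT.
  by apply: contra ii0 => /eqP ki0; apply/eqP/val_inj.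
rewrite (bigD1 i0)//= eqxx product_measure1E// fineK// muleC; congr (_ * _).
by apply: eq_bigr => i /negbTE ->.
Qed.

Lemma observation_law (f : R -> R) : (0 <= s)%R ->
  (forall i : 'I_n, (0 < f (i.+1%:R / n%:R))%R) ->
  exists2 Q : probability (n.-tuple R) R,
    product_law (fun i => gauss (obs_sd s f i)) Q &
    forall F : n.-tuple R -> \bar R, measurable_fun [set: n.-tuple R] F ->
      (forall y, 0 <= F y) -> \int[P]_w F (observation f w) = \int[Q]_y F y.
Proof.
move=> s0 f0.
pose Y : noise_space N -> n.-tuple R := @observation R n s N f.
have mY : measurable_fun setT Y.
  apply/measurable_fun_tnthP => i.
  rewrite (_ : _ \o _ = fun w => f (i.+1%:R / n%:R) * xi i w + tau i w)%R.
    by apply: measurable_funD => //; exact: measurable_funM.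
  by apply/funext => w; rewrite /= tnth_mktuple.
pose YM : {mfun _ >-> _} := HB.pack Y (isMeasurableFun.Build _ _ _ _ _ mY).
exists (distribution P YM); last first.
  by move=> F mF F0; rewrite ge0_integral_distribution.
move=> B mB.
transitivity (P [set w | forall i,
  [set z : R * R | B i (f (i.+1%:R / n%:R) * z.1 + z.2)%R] (xi i w, tau i w)]).
  congr (P _); apply/seteqP; split=> w /= H i; have := H i;
    by rewrite /Y tnth_mktuple.
rewrite (noise_pairs_law (C := fun i =>
  [set z : R * R | B i (f (i.+1%:R / n%:R) * z.1 + z.2)%R])).
  by apply: eq_bigr => i _; rewrite gauss_sum.
move=> i.
have mD : measurable_fun [set: R * R]
    (fun z : R * R => f (i.+1%:R / n%:R) * z.1 + z.2)%R.
  by apply: measurable_funD => //; exact: measurable_funM.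
by have := mD measurableT _ (mB i); rewrite setTI.
Qed.

End model.
End observation_law.

(** * Moments of centred normal laws *)

Section gauss_moments.
Local Open Scope classical_set_scope.
Local Open Scope ereal_scope.
Variable R : realType.
Local Notation mu := (@lebesgue_measure R).

(** The integrand is [s] times the density of N(0, s^2) relative to N(0, 1).
    These exponential moments yield the polynomial ones without integration by
    parts. *)
Lemma gauss_exp_sqr (s : R) : (0 < s)%R ->
  \int[gauss 1]_x (expR ((1 - s ^- 2) / 2 * x ^+ 2))%:E = s%:E.
Proof.
move=> s0.
have mf : measurable_fun [set: R] (fun x => (expR ((1 - s ^- 2) / 2 * x ^+ 2) : R)%:E).
  apply/measurable_EFinP; apply: measurableT_comp => //.
  by apply: measurable_funM => //; exact: measurable_funX.
rewrite gauss_density//.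
transitivity (\int[mu]_x (s%:E * (normal_pdf 0 s x)%:E)).
  apply: eq_integral => x _; rewrite -!EFinM; congr EFin.
  rewrite !normal_pdfE ?gt_eqF// /normal_fun !normal_peakE//.
  have p0 := @sqrt_pi2_gt0 R.
  set p := Num.sqrt _ in p0 *; set e1 := expR _; set e2 := expR _; set e3 := expR _.
  have -> : (e1 * ((1 * p)^-1 * e2) = p^-1 * (e1 * e2))%R by field; rewrite gt_eqF.
  have -> : (s * ((s * p)^-1 * e3) = p^-1 * e3)%R by field; rewrite !gt_eqF.
  congr (_ * _)%R; rewrite -expRD; congr expR.
  by field; rewrite gt_eqF.
have mpdf : measurable_fun [set: R] (fun x => (normal_pdf 0 s x)%:E).
  by apply/measurable_EFinP; exact: measurable_normal_pdf.
rewrite ge0_integralZl//=.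
- by rewrite integral_normal_pdf mule1.
- by move=> x _; rewrite lee_fin normal_pdf_ge0.
- by rewrite lee_fin ltW.
Qed.

Let mX n : measurable_fun [set: R] (fun x : R => (x ^+ n)%:E).
Proof. by apply/measurable_EFinP; exact: measurable_funX. Qed.

Let mexp (l : R) : measurable_fun [set: R] (fun x => (expR (l * x ^+ 2) : R)%:E).
Proof.
apply/measurable_EFinP; apply: measurableT_comp => //.
by apply: measurable_funM => //; exact: measurable_funX.
Qed.

Let gauss1 (s : R) : \int[gauss s]_x (1%:E : \bar R) = 1.
Proof. by rewrite integral_cst// mul1e [LHS]probability_setT. Qed.

(** Finiteness is needed to do arithmetic with the second moment; it follows from
    [1 + z <= expR z] with an exponential moment ([s = 2]). *)
Lemma gauss1_sqr_lt : \int[gauss 1]_(x in [set: R]) (x ^+ 2)%:E < +oo.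
Proof.
have s2 : (0 < 2 :> R)%R by [].
have := gauss_exp_sqr s2.
set l := ((1 - _) / 2)%R => E.
have l0 : (0 < l)%R by rewrite /l; lra.
have I0 : 0 <= \int[gauss 1]_(x in [set: R]) (x ^+ 2)%:E.
  by apply: integral_ge0 => x _; rewrite lee_fin sqr_ge0.
suff : l%:E * \int[gauss 1]_(x in [set: R]) (x ^+ 2)%:E < +oo.
  move: I0; case: (integral _ _ _) => [r _ _|_|//]; first exact: ltry.
  by rewrite gt0_muley.
rewrite -ge0_integralZl//=.
- apply: le_lt_trans (ltry 2%R); rewrite -E.
  apply: ge0_le_integral => //.
  + by move=> x _; rewrite -EFinM lee_fin mulr_ge0// ?sqr_ge0// ltW.
  + exact: emeasurable_funM.
  + move=> x _; rewrite -EFinM lee_fin.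
    by apply: le_trans (expR_ge1Dx _); rewrite lerDr.
- by move=> x _; rewrite lee_fin sqr_ge0.
- by rewrite lee_fin ltW.
Qed.

(** Integrating [1 + l * x ^+ 2 <= expR (l * x ^+ 2)] against [gauss 1] with
    [2 * l = 1 - s ^- 2] gives [1 + l * c <= s] for the second moment [c] and
    every [s > 0]; the choice [s = sqrt c] leaves [(sqrt c - 1) ^+ 2 <= 0]. *)
Lemma gauss1_sqr : \int[gauss 1]_(x in [set: R]) (x ^+ 2)%:E = 1.
Proof.
have I0 : 0 <= \int[gauss 1]_(x in [set: R]) (x ^+ 2)%:E.
  by apply: integral_ge0 => x _; rewrite lee_fin sqr_ge0.
have := gauss1_sqr_lt.
move: I0; set I := integral _ _ _ => I0 Ioo.
have Ifin : I \is a fin_num by rewrite ge0_fin_numE.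
rewrite -(fineK Ifin); set c := fine I.
have c0 : (0 <= c)%R by exact: fine_ge0.
have X0 (x : R) : [set: R] x -> 0 <= (x ^+ 2)%:E by rewrite lee_fin sqr_ge0.
have key (s : R) : (0 < s)%R -> (1 + (1 - s ^- 2) / 2 * c <= s)%R.
  move=> s0; have := gauss_exp_sqr s0; set l := ((1 - _) / 2)%R => E.
  have E0 (x : R) : [set: R] x -> 0 <= (expR (l * x ^+ 2))%:E.
    by rewrite lee_fin expR_ge0.
  have ZE k : (0 <= k)%R -> \int[gauss 1]_(x in [set: R]) (k%:E * (x ^+ 2)%:E) = (k * c)%:E.
    by move=> k0; rewrite ge0_integralZl//= -/I -(fineK Ifin) EFinM.
  have Z0 k (x : R) : (0 <= k)%R -> [set: R] x -> 0 <= k%:E * (x ^+ 2)%:E.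
    by move=> k0 _; rewrite -EFinM lee_fin mulr_ge0// sqr_ge0.
  have mZ k : measurable_fun [set: R] (fun x : R => k%:E * (x ^+ 2)%:E).
    exact: emeasurable_funM.
  have [l0|l0] := leP 0%R l.
    rewrite -lee_fin -E EFinD -(ZE _ l0) -(gauss1 1) -ge0_integralD//; last first.
      by move=> x; exact: Z0.
    apply: ge0_le_integral => //.
    - by move=> x _; rewrite adde_ge0// Z0.
    - exact: emeasurable_funD.
    - by move=> x _; rewrite -EFinM -EFinD lee_fin expR_ge1Dx.
  have l0' : (0 <= - l)%R by rewrite oppr_ge0 ltW.
  rewrite -lerBrDr -mulNr -lee_fin EFinD -(ZE _ l0') -E -(gauss1 1) -ge0_integralD//; last first.
    by move=> x; exact: Z0.
  apply: ge0_le_integral => //.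
  - exact: emeasurable_funD.
  - move=> x _; rewrite -EFinM -EFinD lee_fin mulNr lerBrDr.
    exact: expR_ge1Dx.
have c1 : (0 < c)%R by have := key (2^-1)%R; rewrite invr_gt0 => /(_ _); lra.
have := key (Num.sqrt c); rewrite sqrtr_gt0 => /(_ c1).
rewrite sqr_sqrtr// mulrAC mulrBl mul1r mulVf ?gt_eqF//.
have := sqr_sqrtr c0; set r := Num.sqrt c => <- H.
have : ((r - 1) ^+ 2 <= 0)%R by lra.
rewrite le_eqVlt ltNge sqr_ge0 orbF sqrf_eq0 subr_eq0 => /eqP ->.
by rewrite expr1n.
Qed.

Lemma gauss1_pow4 : \int[gauss 1]_(x in [set: R]) (x ^+ 4)%:E <= 57%:E.
Proof.
have s2 : (0 < 2 :> R)%R by [].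
have := gauss_exp_sqr s2; set l := ((1 - _) / 2)%R => E.
have lE : l = (3 / 8)%R by rewrite /l; field.
apply: (@le_trans _ _ ((256 / 9 : R)%:E * 2%:E)); last by rewrite -EFinM lee_fin; lra.
rewrite -E -ge0_integralZl//=.
apply: ge0_le_integral => //=.
- by move=> x _; rewrite lee_fin exprn_even_ge0.
- exact: emeasurable_funM.
move=> x _; rewrite -EFinM lee_fin.
(* [expR (2 * z) = expR z ^+ 2 >= (1 + z) ^+ 2 >= z ^+ 2] *)
have -> : (l * x ^+ 2 = l / 2 * x ^+ 2 + l / 2 * x ^+ 2)%R by lra.
rewrite expRD; have := expR_ge1Dx (l / 2 * x ^+ 2).
have z0 : (0 <= l / 2 * x ^+ 2)%R by rewrite mulr_ge0 ?sqr_ge0// lE; lra.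
rewrite lE in z0 *; set e := expR _ => He.
have -> : (x ^+ 4 = 256 / 9 * ((3 / 8 / 2 * x ^+ 2) * (3 / 8 / 2 * x ^+ 2)))%R by field.
by rewrite ler_pM2l ?ler_pM//; lra.
Qed.

Lemma gauss_sqr (s : R) : (0 < s)%R ->
  \int[gauss s]_(x in [set: R]) (x ^+ 2)%:E = (s ^+ 2)%:E.
Proof.
move=> s0; have X0 (x : R) : 0 <= (x ^+ 2)%:E by rewrite lee_fin sqr_ge0.
rewrite -(ge0_integral_gauss_scale s0 (mX 2) X0).
under eq_integral do rewrite exprMn EFinM.
by rewrite ge0_integralZl//= ?gauss1_sqr ?mule1// lee_fin sqr_ge0.
Qed.

Lemma gauss_pow4 (s : R) : (0 < s)%R ->
  \int[gauss s]_(x in [set: R]) (x ^+ 4)%:E <= (57 * s ^+ 4)%:E.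
Proof.
move=> s0; have X0 (x : R) : 0 <= (x ^+ 4)%:E by rewrite lee_fin exprn_even_ge0.
rewrite -(ge0_integral_gauss_scale s0 (mX 4) X0).
under eq_integral do rewrite exprMn EFinM.
rewrite ge0_integralZl//= ?lee_fin ?exprn_even_ge0//.
by rewrite (mulrC 57%R) [leRHS]EFinM lee_pmul2l ?lte_fin ?exprn_gt0// gauss1_pow4.
Qed.

(** The cross term vanishes because [y ^+ 2 - s ^+ 2] is centred under [gauss s],
    and its second moment is at most the fourth moment of [y]. *)
Lemma gauss_quadratic (s b w : R) : (0 < s)%R ->
  \int[gauss s]_(y in [set: R]) ((b + w * (y ^+ 2 - s ^+ 2)) ^+ 2)%:E
    <= (b ^+ 2 + 57 * (w ^+ 2 * s ^+ 4))%:E.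
Proof.
move=> s0; have h2 := gauss_sqr s0; have h4 := gauss_pow4 s0.
have i2 : (gauss s).-integrable [set: R] (fun y : R => (y ^+ 2)%:E).
  apply/integrableP; split => //.
  by under eq_integral do rewrite /= ger0_norm ?sqr_ge0//; rewrite h2 ltry.
have i4 : (gauss s).-integrable [set: R] (fun y : R => (y ^+ 4)%:E).
  apply/integrableP; split => //.
  under eq_integral do rewrite /= ger0_norm ?exprn_even_ge0//.
  by rewrite (le_lt_trans h4) ?ltry.
set u := (b - w * s ^+ 2)%R.
under eq_integral => y _.
  have -> : ((b + w * (y ^+ 2 - s ^+ 2)) ^+ 2 =
    u ^+ 2 + ((2 * u * w) * y ^+ 2 + w ^+ 2 * y ^+ 4))%R by rewrite /u; ring.
  rewrite 2!EFinD !(EFinM _ (y ^+ _)); over.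
have iZ2 := integrableZl measurableT (2 * u * w)%R i2.
have iZ4 := integrableZl measurableT (w ^+ 2)%R i4.
have ic : (gauss s).-integrable [set: R] (fun _ : R => (u ^+ 2)%:E).
  by apply: finite_measure_integrable_cst.
rewrite integralD//=; last exact: integrableD.
rewrite integralD//= !integralZl//= h2 integral_cst//.
rewrite [X in _ * X + _]probability_setT mule1 -EFinM.
have w0 : 0 <= (w ^+ 2)%:E by rewrite lee_fin sqr_ge0.
have := lee_wpmul2l w0 h4; rewrite -EFinM => H.
apply: le_trans (leeD2l _ (leeD2l _ H)) _.
by rewrite -!EFinD lee_fin /u; nra.
Qed.

End gauss_moments.

(** * Quadratic statistics and chi-square divergence *)

Section product_gauss.
Local Open Scope classical_set_scope.
Local Open Scope ereal_scope.
Variable R : realType.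
Local Notation mu := (@lebesgue_measure R).

Lemma measurable_tcons_comp n (F : n.+1.-tuple R -> \bar R) :
  measurable_fun [set: n.+1.-tuple R] F ->
  measurable_fun [set: R * n.-tuple R] (fun z => F (tcons z)).
Proof. by move=> mF; apply: (measurableT_comp mF); exact: measurable_tcons. Qed.

Lemma measurable_quadratic n (b : R) (w s : 'I_n -> R) :
  measurable_fun [set: n.-tuple R] (fun y : n.-tuple R =>
    ((b + \sum_(i < n) w i * (tnth y i ^+ 2 - s i ^+ 2)) ^+ 2)%:E).
Proof.
apply/measurable_EFinP; apply: measurable_funX; apply: measurable_funD => //.
apply: measurable_sum => i; apply: measurable_funM => //.
apply: measurable_funB => //; apply: measurable_funX; exact: measurable_tnth.
Qed.

(** The coordinates are integrated out one at a time: the centred term of the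
    first coordinate is absorbed into the constant [b], so independence is used
    only through Fubini and no cross moments appear. *)
Lemma product_gauss_quadratic n (s w : 'I_n -> R) (b : R)
    (P : probability (n.-tuple R) R) :
  (forall i, (0 < s i)%R) -> product_law (fun i => gauss (s i)) P ->
  \int[P]_y ((b + \sum_(i < n) w i * (tnth y i ^+ 2 - s i ^+ 2)) ^+ 2)%:E <=
  (b ^+ 2 + 57 * \sum_(i < n) (w i ^+ 2 * s i ^+ 4))%:E.
Proof.
elim: n s w b P => [|n IH] s w b P s0 HP.
  under eq_integral do rewrite big_ord0 addr0.
  rewrite big_ord0 mulr0 addr0 integral_cst//.
  by rewrite [X in _ * X <= _]probability_setT mule1.
have [Q HQ EQ] := product_lawS HP.
rewrite EQ; [|exact: measurable_quadratic|by move=> t; rewrite lee_fin sqr_ge0].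
rewrite big_ord_recl; set V := (\sum_(i < n) _)%R.
have V0 : (0 <= V)%R.
  by apply: sumr_ge0 => i _; rewrite mulr_ge0 ?sqr_ge0// exprn_even_ge0.
pose c x := (b + w ord0 * (x ^+ 2 - s ord0 ^+ 2))%R.
have mc2 : measurable_fun [set: R] (fun x => (c x ^+ 2)%:E).
  apply/measurable_EFinP; apply: measurable_funX; apply: measurable_funD => //.
  apply: measurable_funM => //.
  by apply: measurable_funB; [exact: measurable_funX|exact: measurable_cst].
apply: (@le_trans _ _ (\int[gauss (s ord0)]_(x in [set: R])
    ((c x ^+ 2)%:E + (57 * V)%:E))).
  apply: ge0_le_integral => //.
  - by move=> x _; apply: integral_ge0 => t _; rewrite lee_fin sqr_ge0.
  - apply: (measurable_fun_fubini_tonelli_F (m2 := Q) (fun z : R * n.-tuple R =>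
      ((b + \sum_(i < n.+1) w i * (tnth (tcons z) i ^+ 2 - s i ^+ 2)) ^+ 2)%:E)).
    + exact: (measurable_tcons_comp (measurable_quadratic b w s)).
    + by move=> z; rewrite lee_fin sqr_ge0.
  - exact: emeasurable_funD.
  - move=> x _; rewrite -EFinD.
    have := IH (fun i => s (lift ord0 i)) (fun i => w (lift ord0 i)) (c x) Q
      (fun i => s0 _) HQ.
    apply: le_trans; rewrite le_eqVlt; apply/orP; left; apply/eqP.
    apply: eq_integral => t _; congr (_ ^+ 2)%:E.
    rewrite big_ord_recl /c addrA; congr (_ + _)%R.
    by apply: eq_bigr => i _; rewrite [tcons _]lock /= -lock tnthS.
rewrite ge0_integralD//=; last 2 first.
- by move=> x _; rewrite lee_fin sqr_ge0.
- by move=> x _; rewrite lee_fin mulr_ge0.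
rewrite integral_cst// [X in _ + _ * X]probability_setT mule1.
rewrite mulrDr addrA EFinD leeD2r//.
exact: gauss_quadratic.
Qed.

(** The integral of [phi_s ^+ 2 / phi_t], where [phi_r] is the density of
    N(0, r^2); that is, one plus the chi-square divergence. *)
Definition chi2_factor (s t : R) : R :=
  (t ^+ 2 / (s * Num.sqrt (2 * t ^+ 2 - s ^+ 2)))%R.

(** Up to the constant [chi2_factor s t], the quotient [phi_s ^+ 2 / phi_t] is
    again a normal density, provided its exponent is negative. *)
Lemma normal_pdf_chi2 (s t x : R) : (0 < s)%R -> (0 < t)%R ->
  (s ^+ 2 < 2 * t ^+ 2)%R ->
  (normal_pdf 0 s x * normal_pdf 0 s x = chi2_factor s t *
    (normal_pdf 0 t x * normal_pdf 0 (s * t / Num.sqrt (2 * t ^+ 2 - s ^+ 2)) x))%R.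
Proof.
move=> s0 t0 st; rewrite /chi2_factor; set q := Num.sqrt _.
have d0 : (0 < 2 * t ^+ 2 - s ^+ 2)%R by rewrite subr_gt0.
have q0 : (0 < q)%R by rewrite sqrtr_gt0.
have qE : (q ^+ 2 = 2 * t ^+ 2 - s ^+ 2)%R by rewrite sqr_sqrtr// ltW.
have u0 : (0 < s * t / q)%R by rewrite divr_gt0// mulr_gt0.
rewrite !normal_pdfE ?gt_eqF// /normal_fun !normal_peakE//.
have p0 := @sqrt_pi2_gt0 R.
set p := Num.sqrt (pi *+ 2) in p0 *.
set e1 := expR _; set e2 := expR _; set e3 := expR _.
have -> : ((s * p)^-1 * e1 * ((s * p)^-1 * e1) = (s * p) ^- 2 * (e1 * e1))%R.
  by field; rewrite !gt_eqF.
have -> : (t ^+ 2 / (s * q) * ((t * p)^-1 * e2 * ((s * t / q * p)^-1 * e3)) =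
   (s * p) ^- 2 * (e2 * e3))%R by field; rewrite !gt_eqF.
congr (_ * _)%R; rewrite -!expRD; congr expR; rewrite subr0.
rewrite exprMn exprVn exprMn qE.
by field; rewrite !gt_eqF.
Qed.

(** Cauchy-Schwarz for [G * phi_s = (G * sqrt phi_t) * (phi_s / sqrt phi_t)]. *)
Lemma gauss_chi2 (s t : R) (G : R -> R) : (0 < s)%R -> (0 < t)%R ->
  (s ^+ 2 < 2 * t ^+ 2)%R -> measurable_fun [set: R] G ->
  (forall x, 0 <= G x <= 1)%R ->
  (\int[gauss s]_x (G x)%:E) * (\int[gauss s]_x (G x)%:E) <=
  (chi2_factor s t)%:E * \int[gauss t]_x (G x ^+ 2)%:E.
Proof.
move=> s0 t0 st mG G01.
have G0 x : (0 <= G x)%R by have /andP[] := G01 x.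
have mG1 : measurable_fun [set: R] (fun x => (G x)%:E) by exact/measurable_EFinP.
have mG2 : measurable_fun [set: R] (fun x => (G x ^+ 2)%:E).
  by apply/measurable_EFinP; exact: measurable_funX.
have G10 x : 0 <= (G x)%:E by rewrite lee_fin.
have G20 x : 0 <= (G x ^+ 2)%:E by rewrite lee_fin sqr_ge0.
have le1 r (F : R -> R) : measurable_fun [set: R] (fun x => (F x)%:E) ->
    (forall x, 0 <= F x <= 1)%R -> \int[gauss r]_x (F x)%:E <= 1.
  move=> mF F01; apply: (@le_trans _ _ (\int[gauss r]_(x in [set: R]) 1%:E)).
    apply: ge0_le_integral => //.
      by move=> x _; rewrite lee_fin; have /andP[] := F01 x.
    by move=> x _; rewrite lee_fin; have /andP[] := F01 x.
  by rewrite integral_cst// mul1e probability_le1.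
have fin r (F : R -> R) : measurable_fun [set: R] (fun x => (F x)%:E) ->
    (forall x, 0 <= F x <= 1)%R -> \int[gauss r]_x (F x)%:E \is a fin_num.
  move=> mF F01; rewrite ge0_fin_numE.
    by rewrite (le_lt_trans (le1 _ _ mF F01))// ltry.
  by apply: integral_ge0 => x _; rewrite lee_fin; have /andP[] := F01 x.
have G201 x : (0 <= G x ^+ 2 <= 1)%R.
  by rewrite sqr_ge0/= expr_le1//; have /andP[] := G01 x.
set A := \int[gauss s]_x _; set B := \int[gauss t]_x _; set K := chi2_factor s t.
have q0 : (0 < Num.sqrt (2 * t ^+ 2 - s ^+ 2))%R by rewrite sqrtr_gt0 subr_gt0.
have K0 : (0 < K)%R by rewrite /K /chi2_factor divr_gt0 ?exprn_gt0// mulr_gt0.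
set u := (s * t / Num.sqrt (2 * t ^+ 2 - s ^+ 2))%R.
have u0 : (0 < u)%R by rewrite /u divr_gt0// mulr_gt0.
have A0 : 0 <= A by exact: integral_ge0.
have B0 : 0 <= B by exact: integral_ge0.
have mpdf m r : measurable_fun [set: R] (fun x => (normal_pdf m r x)%:E).
  by apply/measurable_EFinP; exact: measurable_normal_pdf.
(* [2 * a * b <= e * a ^+ 2 + b ^+ 2 / e] under the integral sign; the choice
   [e = K / A] at the end gives the product form *)
have key (e : R) : (0 < e)%R -> 2%:E * A <= e%:E * B + (K / e)%:E.
  move=> e0.
  rewrite /A /B !gauss_density//.
  have ZE (k : R) (F : R -> \bar R) : (0 <= k)%R -> measurable_fun [set: R] F ->
      (forall x, 0 <= F x) ->
      k%:E * \int[mu]_x F x = \int[mu]_x (k%:E * F x).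
    by move=> k0 mF F0; rewrite -ge0_integralZl.
  have pp0 r x : 0 <= (normal_pdf 0 r x : R)%:E by rewrite lee_fin normal_pdf_ge0.
  have Ke0 : (0 <= K / e)%R by rewrite ltW// divr_gt0.
  have -> : (K / e)%:E = (K / e)%:E * \int[mu]_x (normal_pdf 0 u x)%:E.
    by rewrite integral_normal_pdf mule1.
  have m1 : measurable_fun [set: R] (fun x => (G x)%:E * (normal_pdf 0 s x)%:E).
    exact: emeasurable_funM.
  have m2 : measurable_fun [set: R] (fun x => (G x ^+ 2)%:E * (normal_pdf 0 t x)%:E).
    exact: emeasurable_funM.
  have mk (k : R) (F : R -> \bar R) : measurable_fun [set: R] F ->
      measurable_fun [set: R] (fun x => k%:E * F x).
    by move=> mF; exact: measurable_funeM.
  rewrite !ZE//; [|by move=> x; rewrite mule_ge0|exact: ltW|by move=> x; rewrite mule_ge0].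
  rewrite -ge0_integralD//; first last.
  - exact: mk.
  - by move=> x _; rewrite mule_ge0.
  - exact: mk.
  - by move=> x _; rewrite !mule_ge0// lee_fin ltW.
  apply: ge0_le_integral => //.
  - by move=> x _; rewrite !mule_ge0.
  - exact: mk.
  - by apply: emeasurable_funD; exact: mk.
  move=> x _; rewrite -!EFinM -EFinD lee_fin.
  have := normal_pdf_chi2 x s0 t0 st; rewrite -/K -/u.
  have ps0 := normal_pdf_ge0 0 s x; have pt0 := normal_pdf_ge0 0 t x.
  have pu0 := normal_pdf_ge0 0 u x.
  have pt : (0 < normal_pdf 0 t x)%R.
    rewrite normal_pdfE ?gt_eqF// mulr_gt0 ?normal_peak_gt0 ?gt_eqF//.
    by rewrite /normal_fun expR_gt0.
  move: ps0 pt pu0; set ps := normal_pdf 0 s x; set pt' := normal_pdf 0 t x.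
  set pu := normal_pdf 0 u x => ps0 pt'0 pu0 E.
  rewrite -subr_ge0 -(pmulr_rge0 _ e0) -(pmulr_rge0 _ pt'0).
  have -> : (pt' * (e * (e * (G x ^+ 2 * pt') + K / e * pu - 2 * (G x * ps))) =
    (e * G x * pt' - ps) ^+ 2 + (K * (pt' * pu) - ps * ps))%R.
    by field; rewrite gt_eqF.
  by rewrite -E subrr addr0 sqr_ge0.
have Afin : A \is a fin_num by exact: fin.
have Bfin : B \is a fin_num by exact: fin.
rewrite -(fineK Afin) -(fineK Bfin) -!EFinM lee_fin.
have [->|A1] := eqVneq (fine A) 0%R.
  by rewrite mul0r mulr_ge0 ?fine_ge0// ltW.
have {}A1 : (0 < fine A)%R by rewrite lt_neqAle eq_sym A1 fine_ge0.
have := key (K / fine A)%R; rewrite divr_gt0// => /(_ isT).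
rewrite -(fineK Afin) -(fineK Bfin) -!EFinM -EFinD lee_fin /=.
set a := fine A in A1 *; set b' := fine B => H.
have : (a * (2 * a) <= a * (K / a * b' + K / (K / a)))%R by rewrite ler_pM2l.
have -> : (a * (K / a * b' + K / (K / a)) = K * b' + a * a)%R.
  by field; rewrite !gt_eqF.
lra.
Qed.

End product_gauss.

(** * Two product laws that cannot be told apart *)

Section two_point.
Local Open Scope classical_set_scope.
Local Open Scope ereal_scope.
Variable R : realType.

Lemma measurable_unit_integral d (T : measurableType d) (P : probability T R) (F : T -> R) :
  measurable_fun setT F -> (forall x, 0 <= F x <= 1)%R ->
  \int[P]_x (F x)%:E \is a fin_num /\ (0 <= fine (\int[P]_x (F x)%:E) <= 1)%R.
Proof.
move=> mF F01.
have I0 : 0 <= \int[P]_x (F x)%:E.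
  by apply: integral_ge0 => x _; rewrite lee_fin; have /andP[] := F01 x.
have I1 : \int[P]_x (F x)%:E <= 1.
  apply: (@le_trans _ _ (\int[P]_x 1%:E)).
    apply: ge0_le_integral => //.
    - by move=> x _; rewrite lee_fin; have /andP[] := F01 x.
    - exact/measurable_EFinP.
    - by move=> x _; rewrite lee_fin; have /andP[] := F01 x.
  by rewrite integral_cst// mul1e probability_le1.
have fin : \int[P]_x (F x)%:E \is a fin_num.
  by rewrite ge0_fin_numE// (le_lt_trans I1)// ltry.
by split=> //; rewrite fine_ge0//= -lee_fin fineK.
Qed.

(** The inequality [gauss_chi2] tensorizes: apply it to the first coordinate, with
    [G] replaced by its mean over the others, and bound the square of that mean
    by induction. *)
Lemma product_gauss_chi2 n (s t : 'I_n -> R) (P Q : probability (n.-tuple R) R)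
    (G : n.-tuple R -> R) :
  (forall i, (0 < s i)%R) -> (forall i, (0 < t i)%R) ->
  (forall i, (s i ^+ 2 < 2 * t i ^+ 2)%R) ->
  product_law (fun i => gauss (s i)) P -> product_law (fun i => gauss (t i)) Q ->
  measurable_fun [set: n.-tuple R] G -> (forall y, 0 <= G y <= 1)%R ->
  (\int[P]_y (G y)%:E) * (\int[P]_y (G y)%:E) <=
  (\prod_(i < n) chi2_factor (s i) (t i))%:E * \int[Q]_y (G y ^+ 2)%:E.
Proof.
elim: n s t P Q G => [|n IH] s t P Q G s0 t0 st HP HQ mG G01.
  have cst (F : 0.-tuple R -> R) (P' : probability (0.-tuple R) R) :
      \int[P']_y (F y)%:E = (F [tuple])%:E.
    transitivity (\int[P']_y (F [tuple])%:E).
      by apply: eq_integral => y _; rewrite (tuple0 y).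
    by rewrite integral_cst// [X in _ * X]probability_setT mule1.
  by rewrite !cst big_ord0 mul1e -EFinM expr2.
have [P' HP' EP] := product_lawS HP.
have [Q' HQ' EQ] := product_lawS HQ.
have mG1 : measurable_fun [set: n.+1.-tuple R] (fun y => (G y)%:E).
  exact/measurable_EFinP.
have mG2 : measurable_fun [set: n.+1.-tuple R] (fun y => (G y ^+ 2)%:E).
  by apply/measurable_EFinP; exact: measurable_funX.
have G0 y : 0 <= (G y)%:E by rewrite lee_fin; have /andP[] := G01 y.
have G20 y : 0 <= (G y ^+ 2)%:E by rewrite lee_fin sqr_ge0.
have mGt x : measurable_fun [set: n.-tuple R] (fun y => G (tcons (x, y))).
  apply: (measurableT_comp mG); apply: (measurableT_comp (@measurable_tcons R n)).
  exact: measurable_pair1.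
pose g x := fine (\int[P']_y (G (tcons (x, y)))%:E).
have gP x : \int[P']_y (G (tcons (x, y)))%:E = (g x)%:E /\ (0 <= g x <= 1)%R.
  by have [fn g01] := measurable_unit_integral P' (mGt x) (fun y => G01 (tcons (x, y)));
    rewrite /g fineK.
have mFP : measurable_fun [set: R] (fun x => \int[P']_y (G (tcons (x, y)))%:E).
  apply: (measurable_fun_fubini_tonelli_F (m2 := P') (fun z : R * n.-tuple R =>
    (G (tcons z))%:E)) => //.
  exact: (measurable_tcons_comp mG1).
have mFQ : measurable_fun [set: R] (fun x => \int[Q']_y (G (tcons (x, y)) ^+ 2)%:E).
  apply: (measurable_fun_fubini_tonelli_F (m2 := Q') (fun z : R * n.-tuple R =>
    (G (tcons z) ^+ 2)%:E)) => //.
  exact: (measurable_tcons_comp mG2).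
have mg : measurable_fun [set: R] g by exact: measurableT_comp.
set K := (\prod_(i < n.+1) _)%R.
rewrite (EP (fun y => (G y)%:E))// (EQ (fun y => (G y ^+ 2)%:E))//.
have -> : \int[gauss (s ord0)]_x \int[P']_t (G (tcons (x, t)))%:E =
    \int[gauss (s ord0)]_x (g x)%:E.
  by apply: eq_integral => x _; have [] := gP x.
have g01 x : (0 <= g x <= 1)%R by have [] := gP x.
apply: (le_trans (gauss_chi2 (s0 ord0) (t0 ord0) (st ord0) mg g01)).
rewrite /K big_ord_recl (EFinM (chi2_factor (s ord0) (t ord0))) -muleA.
have cf0 i : (0 <= chi2_factor (s i) (t i))%R.
  rewrite /chi2_factor divr_ge0 ?sqr_ge0// mulr_ge0 ?sqrtr_ge0//; exact: ltW.
apply: lee_wpmul2l; first by rewrite lee_fin.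
rewrite -ge0_integralZl//=; last 2 first.
- by move=> x _; exact: integral_ge0.
- by rewrite lee_fin prodr_ge0.
apply: ge0_le_integral => //.
- by move=> x _; rewrite lee_fin sqr_ge0.
- by apply/measurable_EFinP; exact: measurable_funX.
- exact: measurable_funeM.
move=> x _; have [E _] := gP x.
rewrite expr2 EFinM -E.
exact: (IH (fun i => s (lift ord0 i)) (fun i => t (lift ord0 i)) P' Q'
  (fun y => G (tcons (x, y)))).
Qed.

Lemma prod_onem_ge (n : nat) (x : 'I_n -> R) : (forall i, 0 <= x i <= 1)%R ->
  (1 - \sum_(i < n) x i <= \prod_(i < n) (1 - x i))%R.
Proof.
elim: n x => [|n IH] x x01; first by rewrite !big_ord0 subr0.
rewrite !big_ord_recl.
have {}IH := IH (fun i => x (lift ord0 i)) (fun i => x01 _).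
have S0 : (0 <= \sum_(i < n) x (lift ord0 i))%R.
  by apply: sumr_ge0 => i _; have /andP[] := x01 (lift ord0 i).
have /andP[x0 x1] := x01 ord0.
have : ((1 - x ord0) * (1 - \sum_(i < n) x (lift ord0 i)) <=
  (1 - x ord0) * \prod_(i < n) (1 - x (lift ord0 i)))%R by rewrite ler_wpM2l// subr_ge0.
apply: le_trans; move: S0; set S := (\sum_(i < n) _)%R => S0.
have := mulr_ge0 x0 S0; lra.
Qed.

(** With [u = (t ^+ 2 - s ^+ 2) / t ^+ 2], the square of the chi-square factor is
    [1 / (1 - u ^+ 2)]: the divergence is of second order in the relative change
    of variance. *)
Lemma chi2_factor_sqr (s t : R) : (0 < s)%R -> (0 < t)%R ->
  (s ^+ 2 < 2 * t ^+ 2)%R ->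
  ((1 - ((t ^+ 2 - s ^+ 2) / t ^+ 2) ^+ 2) * chi2_factor s t ^+ 2 = 1)%R.
Proof.
move=> s0 t0 st; have d0 : (0 < 2 * t ^+ 2 - s ^+ 2)%R by rewrite subr_gt0.
rewrite /chi2_factor; set q := Num.sqrt _.
have q0 : (0 < q)%R by rewrite sqrtr_gt0.
have qE : (q ^+ 2 = 2 * t ^+ 2 - s ^+ 2)%R by rewrite sqr_sqrtr// ltW.
have -> : ((t ^+ 2 / (s * q)) ^+ 2 = t ^+ 4 / (s ^+ 2 * q ^+ 2))%R.
  by field; rewrite !gt_eqF.
by rewrite qE; field; rewrite !gt_eqF.
Qed.

Lemma prod_chi2_factor_le2 n (s t : 'I_n -> R) :
  (forall i, (0 < s i)%R) -> (forall i, (0 < t i)%R) ->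
  (\sum_(i < n) ((t i ^+ 2 - s i ^+ 2) / t i ^+ 2) ^+ 2 <= 1 / 2)%R ->
  (forall i, (s i ^+ 2 < 2 * t i ^+ 2)%R) /\
  (\prod_(i < n) chi2_factor (s i) (t i) <= 2)%R.
Proof.
move=> s0 t0; pose x i := (((t i ^+ 2 - s i ^+ 2) / t i ^+ 2) ^+ 2)%R.
move=> Sx0; have Sx : (\sum_(i < n) x i <= 1 / 2)%R by [].
have x0 i : (0 <= x i)%R by exact: sqr_ge0.
have xle i : (x i <= 1 / 2)%R.
  apply: le_trans Sx; rewrite (bigD1 i)//= lerDl.
  by apply: sumr_ge0 => j _.
have st i : (s i ^+ 2 < 2 * t i ^+ 2)%R.
  rewrite ltNge; apply/negP => H.
  have t2 : (0 < t i ^+ 2)%R by rewrite exprn_gt0.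
  have : (1 <= (s i ^+ 2 - t i ^+ 2) / t i ^+ 2)%R by rewrite ler_pdivlMr//; lra.
  have := xle i; rewrite /x -opprB mulNr sqrrN.
  set z := ((s i ^+ 2 - t i ^+ 2) / t i ^+ 2)%R => z1 z2.
  have : (1 * 1 <= z * z)%R by rewrite ler_pM.
  by rewrite expr2 in z1; lra.
split=> //; set K := (\prod_(i < n) _)%R.
have K0 : (0 <= K)%R.
  apply: prodr_ge0 => i _; rewrite /chi2_factor divr_ge0 ?sqr_ge0// mulr_ge0 ?sqrtr_ge0//.
  exact: ltW.
have x01 i : (0 <= x i <= 1)%R by rewrite x0/= (le_trans (xle i))//; lra.
have E : ((\prod_(i < n) (1 - x i)) * K ^+ 2 = 1)%R.
  rewrite /K -prodrXl -big_split/=; apply: big1 => i _.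
  exact: chi2_factor_sqr.
have := prod_onem_ge x01; move: E; set p := (\prod_(i < n) _)%R => E Hp.
have K2 : (0 <= K ^+ 2)%R by exact: sqr_ge0.
have : (1 / 2 * K ^+ 2 <= p * K ^+ 2)%R by rewrite ler_wpM2r//; lra.
rewrite E => HK; rewrite leNgt; apply/negP => K3.
have : (2 * 2 < K * K)%R by rewrite ltr_pM.
by rewrite expr2 in HK; lra.
Qed.

(** [A] and [B] are the errors of a randomized test between the two laws, made to
    overlap by [1 <= A + B]. If [B] has mean [b] under [P] and [c] under [Q], then
    [b ^+ 2 <= 2 * c] by the chi-square bound, while [A] has mean at least
    [1 - b] under [P]; so the errors cannot both be small. *)
Lemma two_point n (s t : 'I_n -> R) (P Q : probability (n.-tuple R) R)
    (A B : n.-tuple R -> R) :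
  (forall i, (0 < s i)%R) -> (forall i, (0 < t i)%R) ->
  (\sum_(i < n) ((t i ^+ 2 - s i ^+ 2) / t i ^+ 2) ^+ 2 <= 1 / 2)%R ->
  product_law (fun i => gauss (s i)) P -> product_law (fun i => gauss (t i)) Q ->
  measurable_fun [set: n.-tuple R] A -> measurable_fun [set: n.-tuple R] B ->
  (forall y, 0 <= A y <= 1)%R -> (forall y, 0 <= B y <= 1)%R ->
  (forall y, 1 <= A y + B y)%R ->
  (1 / 8)%:E <= \int[P]_y (A y)%:E + \int[Q]_y (B y)%:E.
Proof.
move=> s0 t0 Sx HP HQ mA mB A01 B01 AB.
have [st K2] := prod_chi2_factor_le2 s0 t0 Sx.
have mA1 : measurable_fun [set: n.-tuple R] (fun y => (A y)%:E) by exact/measurable_EFinP.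
have mB1 : measurable_fun [set: n.-tuple R] (fun y => (B y)%:E) by exact/measurable_EFinP.
have [fA /andP[A0 A1]] := measurable_unit_integral P mA A01.
have [fB /andP[B0 B1]] := measurable_unit_integral P mB B01.
have [fC /andP[C0 C1]] := measurable_unit_integral Q mB B01.
have H : 1 <= \int[P]_y (A y)%:E + \int[P]_y (B y)%:E.
  rewrite -ge0_integralD//; last 2 first.
  - by move=> y _; rewrite lee_fin; have /andP[] := A01 y.
  - by move=> y _; rewrite lee_fin; have /andP[] := B01 y.
  have E1 : \int[P]_y (1%:E : \bar R) = 1.
    by rewrite integral_cst// mul1e [LHS]probability_setT.
  rewrite -[leLHS]E1; apply: ge0_le_integral => //.
    exact: emeasurable_funD.
  by move=> y _; rewrite -EFinD lee_fin.
have HB := product_gauss_chi2 s0 t0 st HP HQ mB B01.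
have HC : \int[Q]_y (B y ^+ 2)%:E <= \int[Q]_y (B y)%:E.
  apply: ge0_le_integral => //.
  - by move=> y _; rewrite lee_fin sqr_ge0.
  - by apply/measurable_EFinP; exact: measurable_funX.
  - by move=> y _; rewrite lee_fin expr2; have /andP[b0 b1] := B01 y; rewrite ler_piMr.
have K0 : (0 <= \prod_(i < n) chi2_factor (s i) (t i))%R.
  apply: prodr_ge0 => i _; rewrite /chi2_factor divr_ge0 ?sqr_ge0// mulr_ge0 ?sqrtr_ge0//.
  exact: ltW.
have K0' : 0 <= (\prod_(i < n) chi2_factor (s i) (t i))%:E by rewrite lee_fin.
have := le_trans HB (lee_wpmul2l K0' HC); move: H.
rewrite -(fineK fA) -(fineK fB) -(fineK fC) -!EFinM -!EFinD !lee_fin.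
move: A0 A1 B0 B1 C0 C1 K0 K2.
set a := fine _; set b := fine _; set c := fine _; set K := (\prod_(i < n) _)%R.
move=> a0 a1 b0 b1 c0 c1 K0 K2 ab bK.
have : (b * b <= 2 * c)%R by apply: le_trans bK _; rewrite ler_wpM2r.
nra.
Qed.

End two_point.

(** * Taylor approximation on the unit interval *)

Section taylor.
Local Open Scope classical_set_scope.
Variable R : realType.
Implicit Types (f g : R -> R) (p : {poly R}).

(** The limit that defines [has_deriv01] excludes [y = x]; here it is
    multiplied out so as to cover that case too. *)
Lemma has_deriv01_bound f f' : has_deriv01 f f' ->
  forall x e, 0 <= x <= 1 -> 0 < e -> exists2 d, 0 < d &
    forall y, 0 <= y <= 1 -> `|y - x| < d ->
      `|f y - f x - f' x * (y - x)| <= e * `|y - x|.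
Proof.
move=> Hf x e x01 e0.
have /cvgrPdist_le/(_ _ e0) := Hf x x01.
rewrite /within/= => -[d /= d0 Hd]; exists d => // y y01 yx.
have [->|yx0] := eqVneq y x; first by rewrite !subrr mulr0 subr0 normr0 mulr0.
have := Hd y; rewrite /ball/= distrC yx => /(_ isT yx0).
rewrite in_itv/= => /(_ y01) H.
have yxn : 0 < `|y - x| by rewrite normr_gt0 subr_eq0.
have yxn0 : y - x != 0 by rewrite subr_eq0.
have := ler_wpM2r (ltW yxn) H.
rewrite -normrM mulrBl divfK// distrC; exact.
Qed.

Lemma has_deriv01_is_derive f f' (x : R) : has_deriv01 f f' -> 0 < x < 1 ->
  is_derive x 1 f (f' x).
Proof.
move=> Hf /andP[x0 x1].
have x01 : 0 <= x <= 1 by rewrite !ltW.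
have cv : (fun h => h^-1 *: ((f \o shift x) (h *: (1 : R)) - f x)) @ 0^' --> f' x.
  apply/cvgrPdist_le => e e0.
  have [d d0 Hd] := has_deriv01_bound Hf x01 e0.
  have dx : 0 < Num.min d (Num.min x (1 - x)) by rewrite !lt_min d0 x0 subr_gt0.
  exists (Num.min d (Num.min x (1 - x))) => //= h.
  rewrite /ball_/= sub0r normrN !lt_min => /and3P[hd hx h1x] h0.
  have hyp : 0 <= h + x <= 1.
    by move: hx h1x; rewrite !ltr_norml => /andP[? ?] /andP[? ?]; apply/andP; split; lra.
  have := Hd (h + x) hyp; rewrite addrK => /(_ hd) H.
  have h1 : 0 < `|h| by rewrite normr_gt0.
  rewrite -(ler_pM2r h1) -normrM mulrBl [h%:A]mulr1 -[_ *: _]/(h^-1 * _).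
  by rewrite mulrAC mulVf// mul1r distrC.
by apply: DeriveDef; [exact: cvgP cv|exact: (cvg_lim _ cv)].
Qed.

Lemma has_deriv01_continuous f f' : has_deriv01 f f' ->
  {within `[0, 1], continuous f}.
Proof.
move=> Hf; apply/subspace_continuousP => x; rewrite /= in_itv/= => x01.
apply/cvgrPdist_le => e e0.
have [d d0 Hd] := has_deriv01_bound Hf x01 (ltr01 : 0 < (1 : R)).
pose c := `|f' x| + 1.
have c0 : 0 < c by rewrite /c ltr_wpDl.
have dx : 0 < Num.min d (e / c) by rewrite lt_min d0 divr_gt0.
exists (Num.min d (e / c)) => //= y; rewrite /ball_/= distrC lt_min => /andP[yd ye].
rewrite in_itv/= => y01; have := Hd y y01 yd; rewrite mul1r => H.
rewrite distrC -(subrK (f' x * (y - x)) (f y - f x)).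
apply: le_trans (ler_normD _ _) _; rewrite normrM.
apply: le_trans (lerD H (lexx _)) _.
rewrite -[X in X + _]mul1r -mulrDl addrC -/c addrC.
by move: ye; rewrite ltr_pdivlMr// => /ltW; rewrite mulrC addrC.
Qed.

(** The mean value inequality for [f - p]; the derivatives are compared only
    between [x] and [y]. *)
Lemma mean_value01 f f' p (x y C : R) : has_deriv01 f f' ->
  0 <= x <= 1 -> 0 <= y <= 1 -> 0 <= C ->
  (forall z, 0 <= z <= 1 -> `|z - x| <= `|y - x| -> `|f' z - p^`().[z]| <= C) ->
  `|(f y - p.[y]) - (f x - p.[x])| <= C * `|y - x|.
Proof.
move=> Hf x01 y01 C0 HC.
pose r z := f z - p.[z].
have main a b : 0 <= a -> a < b -> b <= 1 ->
    (forall z, a < z < b -> `|f' z - p^`().[z]| <= C) ->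
    `|r b - r a| <= C * (b - a).
  move=> a0 ab b1 Hab.
  have dr z : z \in `]a, b[%R -> is_derive z 1 r (f' z - p^`().[z]).
    rewrite in_itv/= => /andP[az zb].
    have z01 : 0 < z < 1 by rewrite (le_lt_trans a0 az) (lt_le_trans zb b1).
    have dfz := has_deriv01_is_derive Hf z01.
    exact: is_deriveB.
  have cr : {within `[a, b], continuous r}.
    move=> z; apply: (@continuousB R R^o).
      apply: (continuous_subspaceW _ (has_deriv01_continuous Hf)).
      by move=> u /=; rewrite !in_itv/= => /andP[? ?]; apply/andP; split; lra.
    by apply: continuous_subspaceT => u; exact: continuous_horner.
  have [c] := MVT ab dr cr; rewrite in_itv/= => cab ->.
  by rewrite normrM (gtr0_norm (_ : 0 < b - a)) ?subr_gt0// ler_wpM2r ?Hab// subr_ge0 ltW.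
rewrite -!/(r _).
have [xy|yx|->] := ltgtP x y; last by rewrite !subrr normr0 mulr0.
- rewrite (gtr0_norm (_ : 0 < y - x)) ?subr_gt0//.
  have /andP[x0 x1] := x01; have /andP[y0 y1] := y01.
  apply: main => // z /andP[xz zy]; apply: HC.
    by apply/andP; split; lra.
  by rewrite !gtr0_norm ?subr_gt0// lerD2r ltW.
- rewrite (distrC (r y)) (distrC y) (gtr0_norm (_ : 0 < x - y)) ?subr_gt0//.
  have /andP[x0 x1] := x01; have /andP[y0 y1] := y01.
  apply: main => // z /andP[yz zx]; apply: HC.
    by apply/andP; split; lra.
  by rewrite !ltr0_norm ?subr_lt0// lerN2 lerD2r ltW.
Qed.

Definition primitive (p : {poly R}) : {poly R} :=
  \poly_(i < (size p).+1) (if i is j.+1 then p`_j / j.+1%:R else 0).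

Lemma deriv_primitive p : deriv (primitive p) = p.
Proof.
apply/polyP => i; rewrite coef_deriv coef_poly ltnS /=.
case: ltnP => [_|/leq_sizeP ->//]; last by rewrite mul0rn.
by rewrite -[LHS]mulr_natr divfK// pnatr_eq0.
Qed.

(** By induction on [k]: [q] has derivative [p], the approximation of [f'] at [x],
    and the mean value inequality for [f - q] gains one power of [`|y - x|]. The
    Hoelder exponent [a] is that of the derivative of order [k]. *)
Lemma taylor01 k : forall f g (L a : R), 0 <= L -> 0 < a -> has_nderiv01 k f g ->
  (forall x y, 0 <= x <= 1 -> 0 <= y <= 1 -> `|g x - g y| <= L * `|x - y| `^ a) ->
  forall x, 0 <= x <= 1 -> exists p : {poly R},
    [/\ (size p <= k.+1)%N, p.[x] = f x &
      forall y, 0 <= y <= 1 -> `|f y - p.[y]| <= L * `|y - x| `^ (a + k%:R)].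
Proof.
elim: k => [|k IH] f g L a L0 a0 /= fg Hg x x01.
  exists (f x)%:P; split; [exact: size_polyC_leq1|by rewrite hornerC|].
  move=> y y01; rewrite hornerC addr0 -!fg//.
  exact: Hg.
have [f' ff' f'g] := fg.
have [p [sp px Hp]] := IH f' g L a L0 a0 f'g Hg x x01.
pose q := primitive p + (f x - (primitive p).[x])%:P.
have qx : q.[x] = f x by rewrite /q hornerD hornerC addrC subrK.
exists q; split => //.
  rewrite (leq_trans (size_polyD _ _))// geq_max (leq_trans (size_polyC_leq1 _))// andbT.
  by rewrite (leq_trans (size_poly _ _)).
move=> y y01.
have [->|yx] := eqVneq y x.
  by rewrite qx !subrr normr0 mulr_ge0// powR_ge0.
have yx0 : 0 < `|y - x| by rewrite normr_gt0 subr_eq0.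
have := @mean_value01 f f' q x y (L * `|y - x| `^ (a + k%:R)) ff' x01 y01.
have -> : `|y - x| `^ (a + k.+1%:R) = `|y - x| `^ (a + k%:R) * `|y - x|.
  rewrite -natr1 addrA (@powRD _ _ (a + k%:R) 1) ?powRr1 ?ltW//.
  by rewrite (gt_eqF yx0) implybT.
rewrite qx subrr subr0 -mulrA; apply => //.
  by rewrite mulr_ge0// powR_ge0.
move=> z z01 zy; rewrite /q derivD derivC addr0 deriv_primitive.
apply: le_trans (Hp z z01) _; rewrite ler_wpM2l//.
by rewrite ge0_ler_powR ?nnegrE// addr_ge0// ltW.
Qed.

End taylor.

(** * Weights that reproduce polynomials *)

Section weights.
Local Open Scope classical_set_scope.
Variable R : realType.

(** Lagrange polynomials at the nodes [0, ..., d]. As distinct nodes are at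
    distance at least 1, the denominators are at least 1 in absolute value and
    only the numerators need a bound. *)
Lemma lagrange_bounded d : exists ell : nat -> {poly R}, exists2 C : R, 0 < C &
  (forall a u, (a <= d)%N -> `|u| <= d.+1%:R -> `|(ell a).[u]| <= C) /\
  (forall p : {poly R}, (size p <= d.+1)%N -> forall u,
    \sum_(0 <= a < d.+1) (ell a).[u] * p.[a%:R] = p.[u]).
Proof.
pose x (i : nat) : R := i%:R.
have x_inj : injective x by move=> i j /eqP; rewrite eqr_nat => /eqP.
exists (fun a => tnth (lagrange d.+1 x) (inord a)).
exists ((d.+1%:R + d.+1%:R) ^+ d); first by rewrite exprn_gt0// addr_gt0.
split=> [a u ad ud|p sp u]; last first.
  rewrite [in RHS](lagrange_gen (ltn0Sn d) x_inj sp) horner_sum big_mkord.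
  apply: eq_bigr => i _.
  by rewrite hornerM hornerC mulrC inord_val.
rewrite lagrangeE// hornerM hornerC normrM; set k := inord a.
set p := \prod_(j < d.+1 | j != k) _.
have pk : 1 <= `|p.[x k]|.
  rewrite horner_prod normr_prod; apply: (big_ind (fun z => 1 <= z)) => //.
    by move=> y z y1 z1; rewrite -[leLHS]mul1r ler_pM.
  move=> j jk; rewrite hornerXsubC /x.
  have : (j != k :> nat) by apply: contra jk => /eqP/val_inj/eqP.
  rewrite neq_ltn => /orP[jk'|kj].
    by rewrite ger0_norm ?subr_ge0 ?ler_nat ?(ltnW jk')// -natrB ?ler1n ?subn_gt0// ltnW.
  by rewrite distrC ger0_norm ?subr_ge0 ?ler_nat ?(ltnW kj)// -natrB ?ler1n ?subn_gt0// ltnW.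
have pu : `|p.[u]| <= (d.+1%:R + d.+1%:R) ^+ d.
  rewrite horner_prod normr_prod.
  have -> : (d.+1%:R + d.+1%:R) ^+ d = \prod_(j < d.+1 | j != k) (d.+1%:R + d.+1%:R : R).
    by rewrite prodr_const cardC1 card_ord.
  apply: ler_prod => j _; rewrite normr_ge0/= hornerXsubC.
  apply: le_trans (ler_normB _ _) _; rewrite lerD// /x normr_nat ler_nat.
  exact/ltnW/ltn_ord.
rewrite normfV -[leRHS]mul1r ler_pM// ?invr_ge0//.
by rewrite invf_le1// (lt_le_trans ltr01).
Qed.

Lemma sum_window (n e m : nat) (F : nat -> R) : (e + m <= n)%N ->
  \sum_(i < n) (if (e <= i < e + m)%N then F (i - e)%N else 0) =
  \sum_(0 <= l < m) F l.
Proof.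
move=> emn.
rewrite -(big_mkord xpredT (fun i => if (e <= i < e + m)%N then F (i - e)%N else 0)).
rewrite (big_cat_nat (leq0n e) (leq_trans (leq_addr _ _) emn))/=.
rewrite [X in _ + X](big_cat_nat (leq_addr m e) emn)/=.
rewrite big_nat big1 ?add0r; last first.
  by move=> i; case: leqP => //= ie; rewrite leqNgt ie.
rewrite [X in _ + X]big_nat [X in _ + X]big1 ?addr0; last first.
  by move=> i /andP[emi _]; rewrite (ltnNge i) emi andbF.
rewrite -{1}(add0n e) (addnC e m) big_addn addnK big_nat [RHS]big_nat.
apply: eq_bigr => i /andP[_ im].
by rewrite leq_addl ltn_add2r im addnK.
Qed.

Lemma sum_blocks (d r : nat) (F : nat -> nat -> R) : (0 < r)%N ->
  \sum_(0 <= l < d * r) F (l %/ r)%N (l %% r)%N =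
  \sum_(0 <= a < d) \sum_(0 <= j < r) F a j.
Proof.
move=> r0; rewrite big_nat_mul; apply: eq_bigr => a _.
rewrite -{1}[(a * r)%N]add0n mulSn big_addn addnK big_nat [RHS]big_nat.
apply: eq_bigr => j /andP[_ jr].
by rewrite (addnC j) divnMDl// modnMDl divn_small// modn_small// addn0.
Qed.

(** First index of a window of [m] consecutive design points around [x]; the
    truncation at [n - m] keeps it inside the design when [x] is close to 1. *)
Definition window_start (n m : nat) (x : R) : nat :=
  minn (Num.truncn (n%:R * x)) (n - m).

Lemma window_startP n m x : (0 < m <= n)%N -> 0 <= x <= 1 ->
  (window_start n m x)%:R <= n%:R * x <= (window_start n m x + m)%:R.
Proof.
move=> /andP[m0 mn] /andP[x0 x1].
have nx0 : 0 <= n%:R * x by rewrite mulr_ge0.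
have nx1 : n%:R * x <= n%:R by rewrite ler_piMr.
have /andP[t1 t2] := truncn_itv nx0.
rewrite /window_start; apply/andP; split.
  by apply: le_trans t1; rewrite ler_nat geq_minl.
rewrite /minn; case: ifP => _.
  by apply/ltW/(lt_le_trans t2); rewrite ler_nat -addn1 leq_add2l.
by rewrite subnK.
Qed.

Lemma measurable_window_start n m e :
  measurable [set x : R | window_start n m x == e].
Proof.
pose F (x : R) : R := (window_start n m x)%:R.
have mF : measurable_fun [set: R] F.
  apply: nondecreasing_measurable => // x y xy.
  rewrite /F ler_nat /window_start leq_min geq_minr andbT geq_min.
  by rewrite le_truncn ?ler_wpM2l.
have := mF measurableT _ (measurable_set1 (e%:R : R)); rewrite setTI.
congr measurable; apply/seteqP; split => x /=.
  by rewrite /F => /eqP; rewrite eqr_nat.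
by rewrite /F => /eqP ->.
Qed.

Section interpolation.
Variables (d : nat) (ell : nat -> {poly R}) (C : R).
Hypothesis C0 : 0 < C.
Hypothesis ell_le : forall a u, (a <= d)%N -> `|u| <= d.+1%:R -> `|(ell a).[u]| <= C.
Hypothesis ell_interp : forall p : {poly R}, (size p <= d.+1)%N -> forall u,
  \sum_(0 <= a < d.+1) (ell a).[u] * p.[a%:R] = p.[u].
Variables (n r : nat).
Hypothesis r0 : (0 < r)%N.
Hypothesis rn : (d.+1 * r <= n)%N.

Let M := (d.+1 * r)%N.
Let n0 : (0 < n)%N. Proof. by rewrite (leq_trans _ rn)// muln_gt0. Qed.
Let Mn : (0 < M <= n)%N. Proof. by rewrite rn muln_gt0 r0. Qed.
Let nR : 0 < n%:R :> R. Proof. by rewrite ltr0n. Qed.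
Let rR : 0 < r%:R :> R. Proof. by rewrite ltr0n. Qed.

(* offset [l] in the window that starts at [e] *)
Let V (e l : nat) (x : R) : R :=
  (ell (l %/ r)%N).[(n%:R * x - (e + l %% r).+1%:R) / r%:R] / r%:R.

(** The window of [d.+1 * r] points is cut into [d.+1] blocks of [r] consecutive
    points. For each offset inside a block, the [d.+1] points with this offset
    are equally spaced by [r / n], hence carry Lagrange interpolation at [x];
    the weights average these [r] interpolations, so that each is [O (1 / r)]. *)
Definition interp_weight (i : 'I_n) (x : R) : R :=
  let e := window_start n M x in
  if (e <= i < e + M)%N then V e (i - e) x else 0.

Lemma measurable_interp_weight i : measurable_fun [set: R] (interp_weight i).
Proof.
pose E e : set R := [set x : R | window_start n M x == e].
have -> : interp_weight i = (fun x => \sum_(e < n.+1)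
    \1_(E e) x * (if (e <= i < e + M)%N then V e (i - e) x else 0)).
  apply/funext => x.
  have ex : (window_start n M x < n.+1)%N.
    by rewrite ltnS /window_start (leq_trans (geq_minr _ _))// leq_subr.
  rewrite (bigD1 (Ordinal ex))//= big1 ?addr0 => [|e ne].
    by rewrite indicE mem_set ?mul1r//= /E/=.
  rewrite indicE memNset ?mul0r// /E/= => /eqP H.
  by move/eqP: ne; apply; apply/val_inj.
apply: measurable_sum => e; apply: measurable_funM.
  by apply: measurable_indic; exact: measurable_window_start.
case: (e <= i < e + M)%N; last exact: measurable_cst.
apply: measurable_funM => //.
apply: (@measurableT_comp _ _ _ _ _ _ (horner (ell ((i - e) %/ r)%N))).
  by apply: continuous_measurable_fun; exact: continuous_horner.
by apply: measurable_funM => //; apply: measurable_funB.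
Qed.

Let offset_le (x : R) l : 0 <= x <= 1 -> (l < M)%N ->
  `|(n%:R * x - (window_start n M x + l %% r).+1%:R) / r%:R| <= d.+1%:R.
Proof.
move=> x01 lM; have /andP[e1 e2] := window_startP Mn x01.
rewrite normrM normfV (gtr0_norm rR) ler_pdivrMr//.
have lr : (l %% r).+1%:R <= r%:R :> R by rewrite ler_nat ltn_mod.
have l1 : 1 <= (l %% r).+1%:R :> R by rewrite ler1n.
have rM : r%:R <= d.+1%:R * r%:R :> R by rewrite ler_peMl// ?ler1n// ltW.
have -> : (window_start n M x + l %% r).+1%:R =
    (window_start n M x)%:R + (l %% r).+1%:R :> R by rewrite -addnS natrD.
move: e2; rewrite natrD natrM => e2; rewrite ler_norml; apply/andP; split; lra.
Qed.

Lemma interp_weight_le i x : 0 <= x <= 1 -> `|interp_weight i x| <= C / r%:R.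
Proof.
move=> x01; rewrite /interp_weight /=; set e := window_start n M x.
case: ifP => [/andP[ei ieM]|_]; last by rewrite normr0 divr_ge0// ltW.
have lM : (i - e < M)%N by rewrite ltn_subLR// addnC.
rewrite /V normrM normfV (gtr0_norm rR) ler_pM2r ?invr_gt0//.
apply: ell_le; last exact: offset_le.
by rewrite -ltnS ltn_divLR.
Qed.

Lemma interp_weight_local i x : 0 <= x <= 1 -> interp_weight i x != 0 ->
  `|i.+1%:R / n%:R - x| <= M%:R / n%:R.
Proof.
move=> x01; rewrite /interp_weight /=; set e := window_start n M x.
case: ifP => [/andP[ei ieM] _|_]; last by rewrite eqxx.
have /andP[e1 e2] := window_startP Mn x01; rewrite -/e in e1 e2.
have -> : i.+1%:R / n%:R - x = (i.+1%:R - n%:R * x) / n%:R by field; rewrite gt_eqF.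
rewrite normrM normfV (gtr0_norm nR) ler_pM2r ?invr_gt0//.
have i1 : e%:R + 1 <= i.+1%:R :> R by rewrite natr1 ler_nat ltnS.
have i2 : i.+1%:R <= e%:R + M%:R :> R by rewrite -natrD ler_nat.
rewrite natrD in e2; rewrite ler_norml; apply/andP; split; lra.
Qed.

(** [F i 0 = 0] confines the sum to the window, whose indices are then split as
    [a * r + j], with [a] the block and [j] the offset. *)
Lemma interp_weight_sum (x : R) (F : nat -> R -> R) : 0 <= x <= 1 ->
  (forall i, F i 0 = 0) ->
  \sum_(i < n) F i (interp_weight i x) =
  \sum_(0 <= a < d.+1) \sum_(0 <= j < r)
    F (window_start n M x + (a * r + j))%N
      ((ell a).[(n%:R * x - (window_start n M x + j).+1%:R) / r%:R] / r%:R).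
Proof.
move=> x01 F0; set e := window_start n M x.
have eM : (e + M <= n)%N.
  by rewrite -(subnK rn) leq_add2r /e /window_start geq_minr.
transitivity (\sum_(0 <= l < M) F (e + l)%N (V e l x)).
  rewrite -(sum_window (fun l => F (e + l)%N (V e l x)) eM).
  apply: eq_bigr => i _; rewrite /interp_weight /= -/e.
  by case: ifP => [/andP[ei _]|_]; rewrite ?F0// subnKC.
rewrite -(sum_blocks d.+1 (fun a j => F (e + (a * r + j))%N
  ((ell a).[(n%:R * x - (e + j).+1%:R) / r%:R] / r%:R)) r0).
by apply: eq_bigr => l _; rewrite -divn_eq.
Qed.

Lemma interp_weight_poly (p : {poly R}) x : (size p <= d.+1)%N -> 0 <= x <= 1 ->
  \sum_(i < n) interp_weight i x * p.[i.+1%:R / n%:R] = p.[x].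
Proof.
move=> sp x01.
rewrite (interp_weight_sum (F := fun i w => w * p.[i.+1%:R / n%:R]))//; last first.
  by move=> i; rewrite mul0r.
set e := window_start n M x.
rewrite exchange_big/=.
transitivity (\sum_(0 <= j < r) p.[x] / r%:R); last first.
  by rewrite sumr_const_nat subn0 -[LHS]mulr_natr divfK// gt_eqF.
apply: eq_bigr => j _.
(* the nodes [e + (a * r + j)] are equally spaced: rescale them to [0, ..., d] *)
pose l : {poly R} := (r%:R / n%:R) *: 'X + ((e + j).+1%:R / n%:R)%:P.
pose q : {poly R} := p \Po l.
have qE u : q.[u] = p.[(r%:R * u + (e + j).+1%:R) / n%:R].
  by rewrite /q /l horner_comp !hornerE mulrDl mulrAC.
have sq : (size q <= d.+1)%N.
  apply: leq_trans (size_comp_poly_leq _ _) _.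
  have sl : ((size l).-1 <= 1)%N.
    rewrite -subn1 leq_subLR; apply: leq_trans (size_polyD _ _) _.
    rewrite geq_max (leq_trans (size_scale_leq _ _)) ?size_polyX//.
    by rewrite (leq_trans (size_polyC_leq1 _)).
  have spp : ((size p).-1 <= d)%N by rewrite -subn1 leq_subLR.
  by rewrite ltnS (leq_trans (leq_mul spp sl))// muln1.
have := ell_interp sq ((n%:R * x - (e + j).+1%:R) / r%:R).
rewrite qE mulrCA divff ?gt_eqF// mulr1 subrK mulrAC divff ?gt_eqF// mul1r => <-.
rewrite mulr_suml; apply: eq_bigr => a _.
rewrite qE mulrAC; congr (_ * p.[_] / _).
by rewrite -natrM -natrD addnS addnCA mulnC.
Qed.

Lemma interp_weight_norm x : 0 <= x <= 1 ->
  \sum_(i < n) `|interp_weight i x| <= d.+1%:R * C.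
Proof.
move=> x01; rewrite (interp_weight_sum (F := fun i w => `|w|))//; last first.
  by move=> i; rewrite normr0.
apply: (@le_trans _ _ (\sum_(0 <= a < d.+1) \sum_(0 <= j < r) C / r%:R)); last first.
  rewrite !sumr_const_nat !subn0 -[_ *+ r]mulr_natr divfK ?gt_eqF//.
  by rewrite mulr_natl.
rewrite big_nat [leRHS]big_nat; apply: ler_sum => a /andP[_ ad].
rewrite big_nat [leRHS]big_nat; apply: ler_sum => j /andP[_ jr].
rewrite normrM normfV (gtr0_norm rR) ler_pM2r ?invr_gt0//.
apply: ell_le => //; have := @offset_le x j x01.
by rewrite modn_small//; apply; rewrite (leq_trans jr)// leq_pmull.
Qed.

End interpolation.
End weights.

(** * Measurability of the loss and the law of the risk *)

Section risk.
Local Open Scope classical_set_scope.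
Variable R : realType.
Local Notation mu := (@lebesgue_measure R).

(** For [k = 0] the Hoelder condition itself gives continuity, otherwise the
    existence of a derivative does. *)
Lemma holder_continuous (beta L : R) (f : R -> R) : 0 < beta -> 0 < L ->
  holder_class beta L f -> {within `[0, 1], continuous f}.
Proof.
move=> b0 L0 [g]; have [kb _] := smoothness_orderP b0.
move: kb; case: (smoothness_order beta) => [|k] kb /= fg Hg; last first.
  by have [f' ff' _] := fg; exact: has_deriv01_continuous ff'.
apply/subspace_continuousP => x; rewrite /= in_itv/= => x01.
apply/cvgrPdist_le => e e0.
pose d : R := (e / L) `^ beta^-1.
have d0 : 0 < d by rewrite powR_gt0// divr_gt0.
exists d => //= y; rewrite /ball_/= => yd; rewrite in_itv/= => y01.
suff : `|f x - f y| <= e by [].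
rewrite -!fg//; apply: le_trans (Hg x y x01 y01) _.
rewrite subr0 -ler_pdivlMl// mulrC.
have -> : e / L = d `^ beta.
  by rewrite /d -powRrM mulVf ?gt_eqF// powRr1// divr_ge0// ltW.
by rewrite ge0_ler_powR ?nnegrE// ltW.
Qed.

Lemma holder_measurable (beta L : R) (f : R -> R) : 0 < beta -> 0 < L ->
  holder_class beta L f -> measurable_fun `[(0 : R), 1] f.
Proof.
move=> b0 L0 Hf; apply: subspace_continuous_measurable_fun => //.
exact: holder_continuous Hf.
Qed.

Lemma estimator_section n (nu : n.-tuple R -> R -> R) y : is_estimator nu ->
  measurable_fun `[(0 : R), 1] (nu y).
Proof.
move=> mnu.
have mT01 : measurable ([set: n.-tuple R] `*` `[(0 : R), 1]) by exact: measurableX.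
have mg := (measurable_restrictT _ mT01).1 mnu.
have mgy : measurable_fun [set: R] (fun x =>
    ((fun z : n.-tuple R * R => nu z.1 z.2) \_ (setT `*` `[(0 : R), 1])) (y, x)).
  by apply: (measurableT_comp mg); exact: measurable_pair1.
apply: eq_measurable_fun (measurable_funTS mgy) => x; rewrite inE => x01.
by rewrite patchE mem_set.
Qed.

Section loss.
Variables (n : nat) (f : R -> R) (nu : n.-tuple R -> R -> R) (D : set R).
Hypothesis mf : measurable_fun `[(0 : R), 1] f.
Hypothesis mnu : is_estimator nu.
Hypothesis mD : measurable D.
Hypothesis D01 : D `<=` `[0, 1].

(** The loss extended by zero outside [D], a total measurable function, to which
   Fubini applies. *)
Let q (z : n.-tuple R * R) : \bar R :=
  ((fun z : n.-tuple R * R => ((f z.2 - nu z.1 z.2) ^+ 2)%:E) \_ (setT `*` D)) z.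

Let mq : measurable_fun setT q.
Proof.
have mTD : measurable ([set: n.-tuple R] `*` D) by exact: measurableX.
have mT01 : measurable ([set: n.-tuple R] `*` `[(0 : R), 1]) by exact: measurableX.
apply/(measurable_restrictT _ mTD).
apply/measurable_EFinP; apply: measurable_funX; apply: measurable_funB; last first.
  by apply: measurable_funS mnu => //; move=> z /= [_ /D01].
have mf' := (measurable_restrictT f (measurable_itv `[(0 : R), 1]%R)).1 mf.
have : measurable_fun ([set: n.-tuple R] `*` D) (fun z => (f \_ `[0, 1]) z.2).
  by apply/measurable_funTS; exact: (measurableT_comp mf' measurable_snd).
apply: eq_measurable_fun => -[y x]; rewrite inE /= => -[_ Dx].
by rewrite patchE mem_set//; exact: D01.
Qed.

Let qE y : (\int[mu]_(x in D) ((f x - nu y x) ^+ 2)%:E = \int[mu]_x q (y, x))%E.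
Proof.
rewrite integral_mkcond; apply: eq_integral => x _.
rewrite /q !patchE; have [Dx|Dx] := pselect (D x).
  by rewrite !mem_set.
by rewrite !memNset//= => -[].
Qed.

Let q0 z : (0 <= q z)%E.
Proof. by rewrite /q patchE; case: ifP => // _; rewrite lee_fin sqr_ge0. Qed.

Lemma measurable_loss : measurable_fun [set: n.-tuple R]
  (fun y => \int[mu]_(x in D) ((f x - nu y x) ^+ 2)%:E)%E.
Proof.
rewrite (_ : (fun y => _) = (fun y => \int[mu]_x q (y, x))%E).
  exact: (measurable_fun_fubini_tonelli_F (m2 := mu) q).
by apply/funext => y; exact: qE.
Qed.

Lemma loss_fubini (P : probability (n.-tuple R) R) :
  (\int[P]_y \int[mu]_(x in D) ((f x - nu y x) ^+ 2)%:E =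
   \int[mu]_(x in D) \int[P]_y ((f x - nu y x) ^+ 2)%:E)%E.
Proof.
transitivity (\int[P]_y \int[mu]_x q (y, x))%E.
  by apply: eq_integral => y _; exact: qE.
rewrite (fubini_tonelli (m1 := P) (m2 := mu) q)// [RHS]integral_mkcond.
apply: eq_integral => x _; rewrite patchE; have [Dx|Dx] := pselect (D x).
  by rewrite mem_set//; apply: eq_integral => y _; rewrite /q patchE mem_set.
by rewrite memNset//; apply: integral0_eq => y _; rewrite /q patchE memNset//= => -[].
Qed.

Lemma measurable_point_loss x : D x -> measurable_fun [set: n.-tuple R]
  (fun y => ((f x - nu y x) ^+ 2)%:E).
Proof.
move=> Dx; rewrite (_ : (fun y => _) = (fun y => q (y, x))).
  by apply: (measurableT_comp mq); exact: measurable_pair2.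
by apply/funext => y; rewrite /q patchE mem_set.
Qed.

Lemma measurable_mean_loss (P : probability (n.-tuple R) R) :
  measurable_fun D (fun x => \int[P]_y ((f x - nu y x) ^+ 2)%:E)%E.
Proof.
have mG : measurable_fun [set: R] (fun x => \int[P]_y q (y, x))%E.
  exact: (measurable_fun_fubini_tonelli_G (m1 := P) q).
apply: eq_measurable_fun (measurable_funTS mG) => x; rewrite inE => Dx.
by apply: eq_integral => y _; rewrite /q patchE mem_set.
Qed.

End loss.

(** Reduces the risk, an integral over an arbitrary probability space, to an
    integral against a product of normal laws. *)
Lemma risk_law (n : nat) (s : R) (N : noise_model n s) (f : R -> R)
    (nu : n.-tuple R -> R -> R) : 0 <= s ->
  (forall i : 'I_n, 0 < f (i.+1%:R / n%:R)) ->
  measurable_fun `[(0 : R), 1] f -> is_estimator nu ->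
  exists2 Q : probability (n.-tuple R) R,
    product_law (fun i => gauss (obs_sd s f i)) Q &
    risk N f nu =
      (\int[Q]_y \int[mu]_(x in `[0%R, 1%R]) ((f x - nu y x) ^+ 2)%:E)%E.
Proof.
move=> s0 f0 mf mnu; have [Q HQ EQ] := observation_law N s0 f0.
exists Q => //; rewrite -EQ//.
- exact: measurable_loss.
- by move=> y; apply: integral_ge0 => x _; rewrite lee_fin sqr_ge0.
Qed.

End risk.

(** * An estimator based on local averages of squares *)

Section upper.
Local Open Scope classical_set_scope.
Variable R : realType.
Local Notation mu := (@lebesgue_measure R).

(** Squaring a local polynomial approximation of [f] approximates the variance
    [f ^+ 2] at the same rate, at the price of doubling the degree; this avoids
    bounding the intermediate derivatives of [f]. *)
Lemma holder_square_approx (h beta L : R) (f : R -> R) (x : R) :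
  0 < beta -> 0 < L -> 0 < h -> holder_class_bounded h beta L f -> 0 <= x <= 1 ->
  exists p : {poly R}, [/\ (size p <= (smoothness_order beta).*2.+1)%N,
    p.[x] = f x ^+ 2 & forall y, 0 <= y <= 1 ->
      `|f y ^+ 2 - p.[y]| <= L * (2 + L) * `|y - x| `^ beta].
Proof.
move=> b0 L0 h0 [[g fg Hg] Hb] x01.
have [kb _] := smoothness_orderP b0; set k := smoothness_order beta in kb fg Hg *.
have a0 : 0 < beta - k%:R by rewrite subr_gt0.
have [p [sp px Hp]] := taylor01 (ltW L0) a0 fg Hg x01.
exists (p ^+ 2); split; last 1 first.
- move=> y y01; rewrite horner_exp subr_sqr normrM.
  have := Hp y y01; rewrite subrK => H.
  have /andP[fy0 fy1] := Hb y y01.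
  have yx1 : `|y - x| <= 1.
    by move: x01 y01 => /andP[? ?] /andP[? ?]; rewrite ler_norml; apply/andP; split; lra.
  have pw1 : `|y - x| `^ beta <= 1.
    have : `|y - x| `^ beta <= 1 `^ beta by apply: ge0_ler_powR; rewrite ?nnegrE// ltW.
    by rewrite powR1.
  have pw0 : 0 <= `|y - x| `^ beta by exact: powR_ge0.
  have H2 : `|f y + p.[y]| <= 2 + L.
    have -> : f y + p.[y] = 2 * f y - (f y - p.[y]) by ring.
    apply: le_trans (ler_normB _ _) _; apply: lerD.
      by rewrite ger0_norm; lra.
    by apply: le_trans H _; rewrite ler_piMr// ltW.
  rewrite mulrAC; apply: ler_pM => //.
- by rewrite (leq_trans (size_poly_exp_leq _ _))//; lia.
- by rewrite horner_exp px.
Qed.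

Section estimator.
Variables (h s : R) (d n r : nat) (ell : nat -> {poly R}).

Definition variance_estimator (y : n.-tuple R) (x : R) : R :=
  \sum_(i < n) interp_weight d ell r i x * (tnth y i ^+ 2 - s ^+ 2).

Definition amplitude_estimator (y : n.-tuple R) (x : R) : R :=
  Num.sqrt (Num.max (h ^+ 2) (variance_estimator y x)).

Lemma amplitude_estimatorP : is_estimator amplitude_estimator.
Proof.
apply: measurable_funTS; rewrite /amplitude_estimator.
apply: (@measurableT_comp _ _ _ _ _ _ (@Num.sqrt R)).
  by apply: continuous_measurable_fun; exact: sqrt_continuous.
apply: measurable_maxr => //; apply: measurable_sum => i.
apply: measurable_funM.
  by apply: (measurableT_comp (measurable_interp_weight d ell r i)).
apply: measurable_funB => //; apply: measurable_funX.
apply: (measurableT_comp (@measurable_tnth _ R n i)).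
exact: measurable_fst.
Qed.

(** With [t] the value of the estimator, [t >= h] and [u >= h], so that
    [`|t ^+ 2 - u ^+ 2| >= h * `|t - u|]; clipping at [h ^+ 2 <= u ^+ 2] only moves
    the variance estimate towards its target. *)
Lemma amplitude_error (y : n.-tuple R) (x u : R) : 0 < h -> h <= u ->
  (u - amplitude_estimator y x) ^+ 2 <=
  h ^- 2 * (variance_estimator y x - u ^+ 2) ^+ 2.
Proof.
move=> h0 hu; rewrite /amplitude_estimator; set v := variance_estimator y x.
set m := Num.max _ _; have m0 : 0 <= m by rewrite le_max sqr_ge0.
have := sqr_sqrtr m0; set t := Num.sqrt m => tE.
have t0 : 0 <= t by exact: sqrtr_ge0.
have mv : (m - u ^+ 2) ^+ 2 <= (v - u ^+ 2) ^+ 2.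
  rewrite /m; case: (leP (h ^+ 2) v) => // vh.
  have hu2 : h ^+ 2 <= u ^+ 2 by rewrite ler_sqr// nnegrE ltW// (lt_le_trans h0).
  rewrite -[leLHS]sqrrN -[leRHS]sqrrN !opprB ler_sqr ?nnegrE; lra.
rewrite mulrC ler_pdivlMr ?exprn_gt0//; apply: le_trans mv.
rewrite -tE; have -> : (t ^+ 2 - u ^+ 2) ^+ 2 = (u - t) ^+ 2 * (u + t) ^+ 2 by ring.
rewrite ler_wpM2l ?sqr_ge0// ler_sqr ?nnegrE; lra.
Qed.

End estimator.

Section block_risk.
Variables (h beta L : R).
Hypotheses (beta0 : 0 < beta) (L0 : 0 < L) (h0 : 0 < h).
Let d := (smoothness_order beta).*2.
Variables (ell : nat -> {poly R}) (C : R).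
Hypothesis C0 : 0 < C.
Hypothesis ell_le : forall a u, (a <= d)%N -> `|u| <= d.+1%:R -> `|(ell a).[u]| <= C.
Hypothesis ell_interp : forall p : {poly R}, (size p <= d.+1)%N -> forall u,
  \sum_(0 <= a < d.+1) (ell a).[u] * p.[a%:R] = p.[u].
Variables (n r : nat).
Hypothesis r0 : (0 < r)%N.
Hypothesis rn : (d.+1 * r <= n)%N.

Let W i x := @interp_weight R d ell n r i x.
Let n0 : (0 < n)%N. Proof. by rewrite (leq_trans _ rn)// muln_gt0. Qed.

(** The weights reproduce the local approximation of [f ^+ 2] exactly, so only its
    remainder over the window contributes. *)
Lemma interp_bias (f : R -> R) x : holder_class_bounded h beta L f -> 0 <= x <= 1 ->
  `|\sum_(i < n) W i x * f (i.+1%:R / n%:R) ^+ 2 - f x ^+ 2| <=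
  d.+1%:R * C * (L * (2 + L)) * ((d.+1 * r)%:R / n%:R) `^ beta.
Proof.
move=> Hf x01.
have [p [sp px Hp]] := holder_square_approx beta0 L0 h0 Hf x01.
rewrite -px -(interp_weight_poly ell_interp r0 rn sp x01) -sumrB.
apply: le_trans (ler_norm_sum _ _ _) _.
apply: (@le_trans _ _ (\sum_(i < n) `|W i x| *
    (L * (2 + L) * ((d.+1 * r)%:R / n%:R) `^ beta))); last first.
  rewrite -mulr_suml -[leRHS]mulrA; apply: ler_wpM2r.
    by rewrite !mulr_ge0 ?powR_ge0 ?ltW// addr_gt0.
  exact: (interp_weight_norm ell_le r0 rn x01).
apply: ler_sum => i _; rewrite -mulrBr normrM.
have [->|Wi] := eqVneq (W i x) 0; first by rewrite normr0 !mul0r.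
apply: ler_wpM2l => //; apply: le_trans (Hp _ (design01 R i)) _.
apply: ler_wpM2l; first by rewrite mulr_ge0 ?ltW// addr_gt0.
by rewrite ge0_ler_powR ?nnegrE ?divr_ge0// ?(ltW beta0)// (interp_weight_local r0 rn x01 Wi).
Qed.

(** One of the two factors of [W i x ^+ 2] is bounded by [C / r], the other one
    is summed with [interp_weight_norm]. *)
Lemma interp_variance (f : R -> R) (s x : R) : holder_class_bounded h beta L f ->
  0 <= x <= 1 ->
  \sum_(i < n) W i x ^+ 2 * obs_sd s f i ^+ 4 <=
  4 * (d.+1%:R * C ^+ 2) * Num.max 1 (s ^+ 4) / r%:R.
Proof.
move=> [_ Hf] x01; have rR : 0 < r%:R :> R by rewrite ltr0n.
have E4 (z : R) : z ^+ 4 = (z ^+ 2) ^+ 2 by ring.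
set S := Num.max 1 _.
have S1 : 1 <= S by rewrite le_max lexx.
have Ss : s ^+ 4 <= S by rewrite le_max lexx orbT.
have sd (i : 'I_n) : obs_sd s f i ^+ 4 <= 4 * S.
  have /andP[f0 f1] := Hf _ (design01 R i).
  rewrite E4 /obs_sd sqr_sqrtr ?addr_ge0 ?sqr_ge0//.
  set u := f _ in f0 f1 *.
  have u1 : u ^+ 2 <= 1 by rewrite expr_le1// (le_trans (ltW h0)).
  have u0 := sqr_ge0 u; have s0 := sqr_ge0 s.
  have -> : (u ^+ 2 + s ^+ 2) ^+ 2 = (u ^+ 2) ^+ 2 + 2 * (u ^+ 2 * s ^+ 2) + s ^+ 4 by ring.
  have u4 : (u ^+ 2) ^+ 2 <= 1 by rewrite expr_le1.
  have : 2 * s ^+ 2 <= 1 + s ^+ 4.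
    rewrite -subr_ge0; have -> : 1 + s ^+ 4 - 2 * s ^+ 2 = (1 - s ^+ 2) ^+ 2 by ring.
    exact: sqr_ge0.
  have : u ^+ 2 * s ^+ 2 <= s ^+ 2 by rewrite ler_piMl.
  lra.
apply: (@le_trans _ _ (\sum_(i < n) `|W i x| * (C / r%:R * (4 * S)))).
  apply: ler_sum => i _; rewrite -real_normK ?num_real// expr2 -[leLHS]mulrA.
  apply: ler_wpM2l => //; apply: ler_pM => //.
  - by rewrite E4 sqr_ge0.
  - exact: (interp_weight_le C0 ell_le r0 rn i x01).
rewrite -mulr_suml.
have : \sum_(i < n) `|W i x| <= d.+1%:R * C by exact: (interp_weight_norm ell_le r0 rn x01).
set A := \sum_(i < n) _ => HA.
have -> : 4 * (d.+1%:R * C ^+ 2) * S / r%:R = d.+1%:R * C * (C / r%:R * (4 * S)).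
  by field; rewrite gt_eqF.
rewrite ler_wpM2r// !mulr_ge0// ?invr_ge0 ?ltW//; lra.
Qed.

Lemma amplitude_estimator_risk (s : R) (N : noise_model n s) (f : R -> R) :
  0 <= s -> holder_class_bounded h beta L f ->
  (risk N f (amplitude_estimator h s d r ell) <=
   (h ^- 2 * ((d.+1%:R * C * (L * (2 + L)) * ((d.+1 * r)%:R / n%:R) `^ beta) ^+ 2
    + 57 * (4 * (d.+1%:R * C ^+ 2) * Num.max 1 (s ^+ 4) / r%:R)))%:E)%E.
Proof.
move=> s0 Hf; have [Hh Hb] := Hf.
have mf := holder_measurable beta0 L0 Hh.
have f0 (i : 'I_n) : 0 < f (i.+1%:R / n%:R).
  by have /andP[+ _] := Hb _ (design01 R i); exact: lt_le_trans.
have [Q HQ ->] := risk_law N s0 f0 mf (amplitude_estimatorP h s d r ell).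
rewrite loss_fubini//; last exact: amplitude_estimatorP.
set B := (h ^- 2 * _).
have h2 : 0 <= h ^- 2 by rewrite invr_ge0 sqr_ge0.
apply: (@le_trans _ _ (\int[mu]_(x in `[0%R, 1%R]) (B%:E))%E); last first.
  rewrite integral_cst//= lebesgue_measure_itv/= lte_fin ltr01.
  by rewrite -EFinD subr0 mule1.
apply: ge0_le_integral => //.
- by move=> x _; apply: integral_ge0 => y _; rewrite lee_fin sqr_ge0.
- exact: (measurable_mean_loss mf (amplitude_estimatorP h s d r ell)).
move=> x; rewrite /= in_itv/= => x01.
pose b := \sum_(i < n) W i x * f (i.+1%:R / n%:R) ^+ 2 - f x ^+ 2.
have sd0 (i : 'I_n) : 0 < obs_sd s f i.
  exact: obs_sd_gt0.
have mq := measurable_quadratic b (W ^~ x) (obs_sd s f).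
apply: (@le_trans _ _ (\int[Q]_y ((h ^- 2)%:E *
   ((b + \sum_(i < n) W i x * (tnth y i ^+ 2 - obs_sd s f i ^+ 2)) ^+ 2)%:E))%E).
  apply: ge0_le_integral => //.
  - by move=> y _; rewrite lee_fin sqr_ge0.
  - by apply: (measurable_point_loss mf (amplitude_estimatorP h s d r ell) (D := `[0, 1])).
  - exact: measurable_funeM.
  - move=> y _; rewrite -EFinM lee_fin.
    have /andP[fx0 _] := Hb x x01.
    apply: le_trans (amplitude_error s d r ell y x h0 fx0) _.
    rewrite le_eqVlt; apply/orP; left; apply/eqP; congr (_ * _ ^+ 2).
    rewrite /b addrAC -big_split/=; congr (_ - _).
    apply: eq_bigr => i _; rewrite -mulrDr; congr (_ * _).
    rewrite /obs_sd sqr_sqrtr ?addr_ge0 ?sqr_ge0//; ring.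
rewrite ge0_integralZl//=; last by move=> y _; rewrite lee_fin sqr_ge0.
rewrite /B EFinM lee_wpmul2l ?lee_fin//.
apply: le_trans (product_gauss_quadratic (W ^~ x) b sd0 HQ) _.
rewrite lee_fin lerD//; last first.
  by rewrite ler_pM2l//; exact: interp_variance.
rewrite -[b ^+ 2]real_normK ?num_real// ler_sqr ?nnegrE//.
  exact: interp_bias.
by rewrite !mulr_ge0 ?powR_ge0// ?ltW// addr_gt0.
Qed.

End block_risk.
End upper.

(** * The upper bound *)

Section upper_bound.
Local Open Scope classical_set_scope.
Variable R : realType.
Local Notation mu := (@lebesgue_measure R).

Lemma minimax_risk_le n (s : R) (N : noise_model n s) (F : set (R -> R))
    (nu : n.-tuple R -> R -> R) (B : \bar R) :
  is_estimator nu -> (forall f, F f -> (risk N f nu <= B)%E) ->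
  (minimax_risk N F <= B)%E.
Proof.
move=> mnu HB; apply: (@le_trans _ _ (ereal_sup [set risk N f nu | f in F])).
  by apply: ereal_inf_lbound; exists nu.
by apply: ge_ereal_sup => _ [f Ff <-]; exact: HB.
Qed.

Lemma zero_estimator_risk n (s h beta L : R) (N : noise_model n s) (f : R -> R) :
  0 < beta -> 0 < L -> 0 < h -> (0 < n)%N -> 0 <= s ->
  holder_class_bounded h beta L f -> (risk N f (fun _ _ => 0%R) <= 1)%E.
Proof.
move=> b0 L0 h0 n0 s0 [Hh Hb].
have mf := holder_measurable b0 L0 Hh.
have f0 (i : 'I_n) : 0 < f (i.+1%:R / n%:R).
  by have /andP[+ _] := Hb _ (design01 R i); exact: lt_le_trans.
have m0 : @is_estimator R n (fun _ _ => 0%R) by exact: measurable_cst.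
have [Q _ ->] := risk_law N s0 f0 mf m0.
have I1 y : (\int[mu]_(x in `[0%R, 1%R]) ((f x - (fun _ _ => 0) (y : n.-tuple R) x) ^+ 2)%:E <= 1)%E.
  apply: (@le_trans _ _ (\int[mu]_(x in `[0%R, 1%R]) (1%:E))%E); last first.
    rewrite integral_cst//= lebesgue_measure_itv/= lte_fin ltr01.
    by rewrite -EFinD subr0 mule1.
  apply: ge0_le_integral => //=.
  - by move=> x _; rewrite lee_fin sqr_ge0.
  - by apply/measurable_EFinP; apply: measurable_funX; apply: measurable_funB.
  - move=> x; rewrite in_itv/= => x01; have /andP[fx0 fx1] := Hb x x01.
    by rewrite subr0 lee_fin expr_le1// (le_trans (ltW h0)).
apply: (@le_trans _ _ (\int[Q]_(y in setT) (1%:E))%E); last first.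
  by rewrite integral_cst// mul1e probability_le1.
apply: ge0_le_integral => //.
- by move=> y _; apply: integral_ge0 => x _; rewrite lee_fin sqr_ge0.
- by move=> y _; exact: (I1 y).
Qed.

(** For [x = S / n], the number [eta] is the length scale that balances the
    squared bias [eta `^ (2 * beta)] against the variance [x / eta]. *)
Lemma rate_split (beta x : R) : 0 < beta -> 0 < x ->
  let eta := x `^ (2 * beta + 1)^-1 in
  [/\ 0 < eta, x = eta * (eta `^ beta) ^+ 2 &
    x `^ (2 * beta / (2 * beta + 1)) = (eta `^ beta) ^+ 2].
Proof.
move=> b0 x0 eta; have e0 : 0 < eta by exact: powR_gt0.
have E : (eta `^ beta) ^+ 2 = eta `^ (2 * beta).
  rewrite -[LHS]powR_mulrn; last exact: powR_ge0.
  by rewrite -powRrM (mulrC beta).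
have b1 : 2 * beta + 1 != 0 by rewrite gt_eqF// ltr_wpDl// mulr_ge0// ltW.
split => //; last by rewrite E /eta -powRrM mulrC.
rewrite E -[X in X * _]powRr1 ?ltW// -powRD ?(gt_eqF e0) ?implybT//.
by rewrite /eta -powRrM (addrC 1) mulVf// powRr1 ?ltW.
Qed.

Lemma upper_bound (beta L h : R) : 0 < beta -> 0 < L -> 0 < h ->
  exists2 C1 : R, 0 < C1 & forall n (s : R) (N : noise_model n s),
    (0 < n)%N -> 0 <= s ->
    (minimax_risk N (holder_class_bounded h beta L) <=
     (C1 * Num.min 1 ((Num.max 1 (s ^+ 4) / n%:R)
                       `^ (2 * beta / (2 * beta + 1))))%:E)%E.
Proof.
move=> b0 L0 h0; pose d := (smoothness_order beta).*2.
have [ell [C C0 [ell_le ell_interp]]] := @lagrange_bounded R d.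
pose D : R := 2 * d.+1%:R.
have D0 : 0 < D by rewrite mulr_gt0.
pose A : R := d.+1%:R * C * (L * (2 + L)).
have A0 : 0 < A by rewrite !mulr_gt0// addr_gt0.
pose B : R := h ^- 2 * ((A * D `^ beta) ^+ 2 + 57 * (4 * (d.+1%:R * C ^+ 2))).
have B0 : 0 < B.
  apply: mulr_gt0; first by rewrite invr_gt0 exprn_gt0.
  apply: addr_gt0; first by rewrite exprn_gt0// mulr_gt0// powR_gt0.
  by rewrite !mulr_gt0// exprn_gt0.
have Db : 0 < (D `^ beta) ^+ 2 by rewrite exprn_gt0// powR_gt0.
exists (B + (D `^ beta) ^+ 2); first by rewrite addr_gt0.
move=> n s N n0 s0.
set S := Num.max 1 _; have S1 : 1 <= S by rewrite le_max lexx.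
have nR : 0 < n%:R :> R by rewrite ltr0n.
have x0 : 0 < S / n%:R by rewrite divr_gt0// (lt_le_trans ltr01).
have [] := rate_split b0 x0; set eta := _ `^ _ => e0 xE ->.
set rho := (eta `^ beta) ^+ 2 in xE *.
have rho0 : 0 < rho by rewrite exprn_gt0// powR_gt0.
have [eD|eD] := leP (D * eta) 1; last first.
  (* too much noise: the zero estimator already achieves a constant risk *)
  apply: (@minimax_risk_le _ _ _ _ (fun _ _ => 0)); first exact: measurable_cst.
  move=> f Ff; apply: le_trans (zero_estimator_risk N b0 L0 h0 n0 s0 Ff) _.
  rewrite lee_fin; set m := Num.min 1 rho.
  have : 1 <= (D `^ beta) ^+ 2 * rho.
    rewrite /rho -exprMn -(@powRM R D eta beta (ltW D0) (ltW e0)) expr_ge1 ?powR_ge0//.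
    have : 1 `^ beta <= (D * eta) `^ beta.
      by apply: ge0_ler_powR; rewrite ?nnegrE ?ltW// mulr_gt0.
    by rewrite powR1.
  have D1 : 1 <= D by rewrite /D -natrM ler1n muln_gt0.
  have Db1 : 1 <= (D `^ beta) ^+ 2.
    rewrite expr_ge1 ?powR_ge0//.
    have : 1 `^ beta <= D `^ beta.
      by apply: ge0_ler_powR; rewrite ?nnegrE ?(ltW b0) ?(ltW D0).
    by rewrite powR1.
  rewrite /m; case: (leP 1 rho) => _ H; first by rewrite mulr1; lra.
  by rewrite mulrDl; have := mulr_gt0 B0 rho0; lra.
(* the block length balances the squared bias against the variance *)
pose r := (Num.truncn (n%:R * eta)).+1.
have ne0 : 0 <= n%:R * eta by rewrite mulr_ge0// ltW.
have /andP[r1 r2] := truncn_itv ne0; rewrite -/r in r2.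
have ne1 : 1 <= n%:R * eta.
  rewrite leNgt; apply/negP => ne1.
  have eta_n : eta < n%:R^-1 by rewrite -[ltRHS]mul1r ltr_pdivlMr// mulrC.
  have rho1 : rho <= 1.
    have e1 : eta <= 1 by rewrite (le_trans (ltW eta_n))// invf_le1// ler1n.
    have : eta `^ beta <= 1 `^ beta.
      by apply: ge0_ler_powR; rewrite ?nnegrE ?(ltW b0) ?(ltW e0).
    by rewrite powR1 => ?; rewrite expr_le1 ?powR_ge0.
  have : S <= n%:R * eta * rho.
    by rewrite -mulrA -xE mulrC divfK// gt_eqF.
  have : n%:R * eta * rho <= n%:R * eta by rewrite ler_piMr.
  lra.
have r3 : r%:R <= 2 * (n%:R * eta) by rewrite /r -natr1; lra.
have rn : (d.+1 * r <= n)%N.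
  rewrite -(ler_nat R) natrM.
  apply: (@le_trans _ _ (d.+1%:R * (2 * (n%:R * eta)))).
    by apply: ler_wpM2l.
  have -> : d.+1%:R * (2 * (n%:R * eta)) = n%:R * (D * eta) by rewrite /D; ring.
  by rewrite ler_piMr.
have r0 : (0 < r)%N by [].
apply: (@minimax_risk_le _ _ _ _ (amplitude_estimator h s d r ell)).
  exact: amplitude_estimatorP.
move=> f Ff; apply: le_trans
  (amplitude_estimator_risk b0 L0 h0 C0 ell_le ell_interp r0 rn N s0 Ff) _.
have rho1 : rho <= 1.
  have D1 : 1 <= D by rewrite /D -natrM ler1n muln_gt0.
  have e1 : eta <= 1.
    by apply: le_trans eD; rewrite ler_peMl// ltW.
  have : eta `^ beta <= 1 `^ beta.
      by apply: ge0_ler_powR; rewrite ?nnegrE ?(ltW b0) ?(ltW e0).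
  by rewrite powR1 => ?; rewrite expr_le1 ?powR_ge0.
rewrite lee_fin -/S (min_idPr rho1) -/A.
apply: (@le_trans _ _ (B * rho)); last first.
  by rewrite ler_wpM2r ?(ltW rho0)// lerDl ltW.
rewrite /B -[leRHS]mulrA; apply: ler_wpM2l; first by rewrite invr_ge0 sqr_ge0.
rewrite [leRHS]mulrDl; apply: lerD.
  rewrite /rho -[leRHS]exprMn ler_sqr ?nnegrE; last 2 first.
  - exact: (mulr_ge0 (ltW A0) (powR_ge0 _ _)).
  - exact: (mulr_ge0 (mulr_ge0 (ltW A0) (powR_ge0 _ _)) (powR_ge0 _ _)).
  rewrite -[leRHS]mulrA -(@powRM R D eta beta (ltW D0) (ltW e0)); apply: ler_wpM2l; first exact: ltW.
  apply: ge0_ler_powR; rewrite ?nnegrE ?divr_ge0 ?(ltW b0)//.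
    by rewrite mulr_ge0// ltW.
  rewrite ler_pdivrMr// natrM.
  apply: (@le_trans _ _ (d.+1%:R * (2 * (n%:R * eta)))); first by apply: ler_wpM2l.
  by rewrite le_eqVlt; apply/orP; left; apply/eqP; rewrite /D; ring.
rewrite -[leRHS]mulrA; apply: ler_wpM2l => //.
rewrite -[leLHS]mulrA; apply: ler_wpM2l.
  by apply: mulr_ge0 => //; apply: mulr_ge0 => //; exact: sqr_ge0.
rewrite ler_pdivrMr ?ltr0n//.
have -> : S = rho * (n%:R * eta).
  by rewrite mulrC -mulrA -xE mulrC divfK// gt_eqF.
by apply: ler_wpM2l; [exact: ltW|exact: ltW].
Qed.

End upper_bound.

(** * A compactly supported bump *)

Section bump_deriv.
Local Open Scope classical_set_scope.
Variable R : realType.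
Implicit Types (p : {poly R}) (t : R).

Lemma is_derive_quadratic (f : R -> R) (x d K : R) :
  (forall y, `|f y - f x - d * (y - x)| <= K * (y - x) ^+ 2) ->
  is_derive x 1 f d.
Proof.
move=> Hf.
have K1 : 0 < `|K| + 1 by rewrite ltr_wpDl.
have cv : (fun h => h^-1 *: ((f \o shift x) (h *: (1 : R)) - f x)) @ 0^' --> d.
  apply/cvgrPdist_le => e e0.
  exists (e / (`|K| + 1)) => /=; first by rewrite divr_gt0.
  move=> h; rewrite /ball_/= sub0r normrN => he h0.
  have h1 : 0 < `|h| by rewrite normr_gt0.
  rewrite -(ler_pM2r h1) -normrM mulrBl [h%:A]mulr1 -[_ *: _]/(h^-1 * _).
  rewrite mulrAC mulVf// mul1r distrC.
  have := Hf (h + x); rewrite addrK => H; apply: le_trans H _.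
  rewrite -real_normK ?num_real// expr2 mulrA ler_wpM2r//.
  apply: (@le_trans _ _ ((`|K| + 1) * `|h|)).
    by rewrite ler_wpM2r// (le_trans (ler_norm K))// lerDl.
  by move: he; rewrite ltr_pdivlMr// mulrC => /ltW.
by apply: DeriveDef; [exact: cvgP cv|exact: (cvg_lim _ cv)].
Qed.

(** [max v 0 ^+ 2] is differentiable at [0] by the quadratic criterion; higher
    powers follow from the product rule, as [max v 0 ^+ j.+1] equals
    [v * max v 0 ^+ j] for [j > 0]. *)
Lemma is_derive_maxX j (u : R) :
  is_derive u 1 (fun v => Num.max v 0 ^+ j.+2) (j.+2%:R * Num.max u 0 ^+ j.+1).
Proof.
elim: j u => [|j IH] u.
  apply: (@is_derive_quadratic _ _ _ 1) => v; rewrite mul1r expr1 !expr2 ler_norml.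
  have S : 0 <= (v - u) * (v - u) by rewrite -expr2 sqr_ge0.
  case: (leP v 0) => v0; case: (leP u 0) => u0; apply/andP; split; nra.
have -> : (fun v : R => Num.max v 0 ^+ j.+3) = (id : R -> R) * (fun v => Num.max v 0 ^+ j.+2).
  apply/funext => v.
  have -> : ((id : R -> R) * (fun v => Num.max v 0 ^+ j.+2)) v = v * Num.max v 0 ^+ j.+2 by [].
  rewrite [LHS]exprS.
  by case: (leP v 0) => // v0; rewrite expr0n/= !mulr0.
have mE : u * Num.max u 0 ^+ j.+1 = Num.max u 0 ^+ j.+2.
  by rewrite [RHS]exprS; case: (leP u 0) => // u0; rewrite expr0n/= !mulr0.
have H := is_deriveM (is_derive_id u 1) (IH u).
apply: is_derive_eq H _.
have -> : j.+3%:R = j.+2%:R + 1 :> R by rewrite natr1.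
rewrite -![_ *: _]/(_ * _).
move: (Num.max u 0 ^+ j.+2) (Num.max u 0 ^+ j.+1) (j.+2%:R : R) mE => A B N <-.
by rewrite /=; ring.
Qed.

Definition bump_base : {poly R} := 'X * (1 - 'X).

(** With [q = bump_base], the [i]-th derivative of [q ^+ n] is divisible by
    [q ^+ (n - i)]; this is the quotient. *)
Fixpoint bump_poly (n i : nat) : {poly R} :=
  if i is i'.+1 then
    deriv (bump_poly n i') * bump_base +
    (n - i')%:R *: (bump_poly n i' * deriv bump_base)
  else 1.

(** For [i < n], the [i]-th derivative of [max (t * (1 - t)) 0 ^+ n]: a bump on
    [0, 1] with [n - 1] derivatives. *)
Definition bump_deriv (n i : nat) (t : R) : R :=
  (bump_poly n i).[t] * Num.max bump_base.[t] 0 ^+ (n - i).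

Lemma is_derive_bump n i t : (i.+1 < n)%N -> is_derive t 1 (bump_deriv n i) (bump_deriv n i.+1 t).
Proof.
move=> lt_in; have [j E] : exists j, (n - i = j.+2)%N by exists (n - i).-2; lia.
have E' : (n - i.+1 = j.+1)%N by lia.
have H1 := is_derive_maxX j bump_base.[t].
have H2 := is_derive1_comp H1 (is_derive_poly bump_base t).
have H3 := is_derive_poly (bump_poly n i) t.
have H4 := is_deriveM H3 H2.
have -> : bump_deriv n i =
    horner (bump_poly n i) * ((fun v => Num.max v 0 ^+ j.+2) \o horner bump_base).
  by apply/funext => x; rewrite /bump_deriv E.
apply: is_derive_eq H4 _.
rewrite /bump_deriv E' /= E -![_ *: _]/(_ * _).
move: (bump_poly n i) bump_base => P Q; rewrite hornerD hornerZ !hornerM.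
have qm : Q.[t] * Num.max Q.[t] 0 ^+ j.+1 = Num.max Q.[t] 0 ^+ j.+2.
  by rewrite [RHS]exprS; case: (leP Q.[t] 0) => // _; rewrite expr0n/= !mulr0.
by rewrite -qm; ring.
Qed.

Lemma bump_baseE t : bump_base.[t] = t * (1 - t).
Proof. by rewrite /bump_base !hornerE. Qed.

Lemma bump_out n i t : (i < n)%N -> ~~ (0 < t < 1) -> bump_deriv n i t = 0.
Proof.
move=> lt_in t01; rewrite /bump_deriv bump_baseE (_ : Num.max _ 0 = 0); last first.
  apply/max_idPr; move: t01; rewrite negb_and -!leNgt => /orP[t0|t1].
    by apply: mulr_le0_ge0 => //; lra.
  by apply: mulr_ge0_le0; lra.
by rewrite expr0n subn_eq0 leqNgt lt_in mulr0.
Qed.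

Lemma bump01 n t : (0 < n)%N -> 0 <= bump_deriv n 0 t <= 1.
Proof.
move=> n0; rewrite /bump_deriv /= hornerC mul1r.
set m := Num.max _ 0; have m0 : 0 <= m by rewrite /m le_max lexx orbT.
have m1 : m <= 1.
  rewrite /m bump_baseE ge_max ler01 andbT.
  have : 0 <= (t - 1 / 2) ^+ 2 by exact: sqr_ge0.
  by nra.
by rewrite exprn_ge0//= exprn_ile1.
Qed.

Lemma bump_ge n t : 1 / 4 <= t <= 3 / 4 -> (3 / 16) ^+ n <= bump_deriv n 0 t.
Proof.
move=> /andP[t1 t2]; rewrite /bump_deriv /= hornerC mul1r subn0.
apply: lerXn2r; [by rewrite nnegrE; lra|by rewrite nnegrE le_max lexx orbT|].
rewrite le_max bump_baseE; apply/orP; left.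
have : 0 <= (t - 1 / 4) * (3 / 4 - t) by apply: mulr_ge0; lra.
by nra.
Qed.

Lemma horner_bounded01 p : exists2 B, 0 <= B & forall t, 0 <= t <= 1 -> `|p.[t]| <= B.
Proof.
exists (\sum_(i < size p) `|p`_i|); first by apply: sumr_ge0.
move=> t /andP[t0 t1]; rewrite horner_coef.
apply: le_trans (ler_norm_sum _ _ _) _; apply: ler_sum => i _.
by rewrite normrM ler_piMr// ger0_norm ?exprn_ge0// exprn_ile1.
Qed.

Lemma horner_lipschitz01 p : exists2 B, 0 <= B &
  forall s t, 0 <= s <= 1 -> 0 <= t <= 1 -> `|p.[s] - p.[t]| <= B * `|s - t|.
Proof.
have [B B0 HB] := horner_bounded01 (deriv p); exists B => //.
have main s t : 0 <= s -> s < t -> t <= 1 -> `|p.[t] - p.[s]| <= B * `|t - s|.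
  move=> s0 st t1.
  have dp x : x \in `]s, t[%R -> is_derive x 1 (horner p) (deriv p).[x].
    by move=> _; exact: is_derive_poly.
  have cp : {within `[s, t], continuous (horner p)}.
    by apply: continuous_subspaceT => u; exact: continuous_horner.
  have [c] := MVT st dp cp; rewrite in_itv/= => /andP[sc ct] ->.
  rewrite normrM ler_wpM2r// HB//; apply/andP; split; lra.
move=> s t /andP[s0 s1] /andP[t0 t1].
have [st|ts|->] := ltgtP s t; last by rewrite !subrr normr0 mulr0.
  by rewrite distrC (distrC s); exact: main.
exact: main.
Qed.

(** The derivative of order [k] is a polynomial [P] vanishing at [0] and [1], composed
    with the projection [c] onto [0, 1]; it is Lipschitz, and since [c] varies by
    at most 1, Hoelder of any exponent [a <= 1]. *)
Lemma bump_holder k : exists2 B, 0 < B & forall s t a, 0 < a <= 1 ->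
  `|bump_deriv k.+1 k s - bump_deriv k.+1 k t| <= B * `|s - t| `^ a.
Proof.
pose P := bump_poly k.+1 k * bump_base.
have [B B0 HB] := horner_lipschitz01 P.
exists (B + 1); first by rewrite ltr_wpDl.
move=> s t a /andP[a0 a1].
pose c (t : R) := Num.min (Num.max t 0) 1.
have c01 x : 0 <= c x <= 1.
  by rewrite /c le_min ge_min lexx orbT andbT le_max lexx orbT/= ler01.
have PE x : P.[x] = (bump_poly k.+1 k).[x] * (x * (1 - x)).
  by rewrite -bump_baseE -hornerM.
have bumpE x : bump_deriv k.+1 k x = P.[c x].
  rewrite /bump_deriv subSnn expr1 bump_baseE PE /c.
  case: (leP x 0) => x0.
    rewrite (min_idPl ler01) mul0r mulr0 (max_idPr _) ?mulr0//.
    by rewrite mulr_le0_ge0//; lra.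
  case: (leP x 1) => x1.
    by rewrite (max_idPl _)// mulr_ge0//; lra.
  rewrite subrr mulr0 mulr0 (max_idPr _) ?mulr0//.
  by rewrite mulr_ge0_le0//; lra.
rewrite !bumpE; apply: le_trans (HB _ _ (c01 s) (c01 t)) _.
have lip u v : u <= v -> `|c v - c u| <= `|v - u|.
  move=> uv; rewrite (ger0_norm (_ : 0 <= v - u)) ?subr_ge0// ler_norml /c.
  case: (leP u 0) => u0; case: (leP v 0) => v0; rewrite ?(min_idPl ler01);
    [|case: (leP v 1) => v1|case: (leP u 1) => u1
     |case: (leP u 1) => u1; case: (leP v 1) => v1];
    by apply/andP; split; lra.
have cst : `|c s - c t| <= `|s - t|.
  by have [st|/ltW ts] := leP s t; [rewrite distrC (distrC s)|]; exact: lip.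
have c1 : `|c s - c t| <= 1.
  by have /andP[? ?] := c01 s; have /andP[? ?] := c01 t; rewrite ler_norml; apply/andP; split; lra.
have H : `|c s - c t| <= `|c s - c t| `^ a.
  have [->|c0] := eqVneq (c s - c t) 0; first by rewrite normr0 powR_ge0.
  have c2 : 0 < `|c s - c t| by rewrite normr_gt0.
  by apply: ger1_powR; rewrite ?c2.
apply: (@le_trans _ _ (B * `|s - t| `^ a)); last first.
  by rewrite ler_wpM2r ?powR_ge0// lerDl.
apply: ler_wpM2l => //; apply: le_trans H _.
by apply: ge0_ler_powR; rewrite ?nnegrE// ltW.
Qed.

End bump_deriv.

(** * Sums of bumps in the smoothness class *)

Section hypotheses.
Local Open Scope classical_set_scope.
Variable R : realType.

Lemma is_derive_has_deriv01 (f f' : R -> R) :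
  (forall x : R, is_derive x 1 f (f' x)) -> has_deriv01 f f'.
Proof.
move=> df x x01; have dfx := df x.
have cv : (fun h => h^-1 *: ((f \o shift x) (h *: (1 : R)) - f x)) @ 0^' --> f' x.
  by case: dfx => ex <-; exact: ex.
apply/cvgrPdist_le => e e0.
have /cvgrPdist_le/(_ _ e0) := cv; rewrite /within/= => -[d /= d0 Hd].
exists d => // y /= yx yx0 _.
have := Hd (y - x); rewrite /ball_/= sub0r normrN distrC.
rewrite /ball/= in yx; move=> /(_ yx); rewrite subr_eq0 => /(_ yx0).
by rewrite [_%:A]mulr1 subrK -[_ *: _]/(_ * _) mulrC.
Qed.

(** The [i]-th derivative of the sum of the bumps selected by [w], up to the factor
    [m ^+ i] of the rescaling. *)
Definition bump_sum (k m : nat) (w : 'I_m -> bool) (i : nat) (x : R) : R :=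
  \sum_(j < m) (w j)%:R * bump_deriv k.+1 i (m%:R * x - j%:R).

Lemma is_derive_bump_sum k m (w : 'I_m -> bool) i (x : R) : (i < k)%N ->
  is_derive x 1 (bump_sum k w i) (m%:R * bump_sum k w i.+1 x).
Proof.
move=> ik.
pose l (j : nat) (y : R) := m%:R * y - j%:R.
have dl j : is_derive x 1 (l j) m%:R.
  have H1 := is_deriveZ (m%:R : R) (is_derive_id x 1).
  have H2 := is_deriveB H1 (is_derive_cst (j%:R : R) x 1).
  by apply: is_derive_eq H2 _; rewrite subr0 [_ *: _]mulr1.
have db j : is_derive x 1 (bump_deriv k.+1 i \o l j) (bump_deriv k.+1 i.+1 (l j x) * m%:R).
  by have H := @is_derive_bump R k.+1 i (l j x) ik; exact: is_derive1_comp.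
have ds := is_derive_sum (fun j : 'I_m => is_deriveZ ((w j)%:R : R) (db j)).
have -> : bump_sum k w i = \sum_(j < m) ((w j)%:R : R) \*: (bump_deriv k.+1 i \o l j).
  by apply/funext => y; rewrite fct_sumE.
apply: is_derive_eq ds _; rewrite /bump_sum mulr_sumr; apply: eq_bigr => j _.
by rewrite -[_ *: _]/(_ * _) /l; ring.
Qed.

Lemma bump_sum_only k m (w : 'I_m -> bool) i x (j : 'I_m) : (i <= k)%N ->
  0 <= m%:R * x - j%:R <= 1 ->
  bump_sum k w i x = (w j)%:R * bump_deriv k.+1 i (m%:R * x - j%:R).
Proof.
move=> ik /andP[j0 j1]; rewrite /bump_sum (bigD1 j)//= big1 ?addr0// => j' jj'.
rewrite bump_out ?mulr0//; apply/negP => /andP[H1 H2].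
have h1 : j'%:R < j.+1%:R :> R by rewrite -natr1; lra.
have h2 : j%:R < j'.+1%:R :> R by rewrite -natr1; lra.
move/negP: jj'; apply; apply/eqP/val_inj => /=.
by move: h1 h2; rewrite !ltr_nat; lia.
Qed.

Lemma bump_sum01 k m (w : 'I_m -> bool) x : 0 <= x <= 1 -> 0 <= bump_sum k w 0 x <= 1.
Proof.
move=> /andP[x0 x1].
have [[j jx]|nj] := pselect (exists j : 'I_m, 0 <= m%:R * x - j%:R <= 1).
  rewrite (bump_sum_only _ _ jx)//.
  have /andP[b0 b1] := @bump01 R k.+1 (m%:R * x - j%:R) (ltn0Sn k).
  by case: (w j); rewrite ?mul1r ?mul0r ?b0 ?b1 ?lexx ?ler01.
rewrite /bump_sum big1 ?lexx ?ler01// => j _.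
rewrite bump_out ?mulr0//; apply/negP => /andP[H1 H2].
by apply: nj; exists j; rewrite !ltW.
Qed.

(** Whatever [m], at most two bumps are non-zero at [x] or at [y]: those of the
    cells [jx] and [jy]. *)
Lemma bump_sum_holder k : exists2 B : R, 0 < B &
  forall m (w : 'I_m -> bool) x y a, 0 <= x <= 1 -> 0 <= y <= 1 -> 0 < a <= 1 ->
    `|bump_sum k w k x - bump_sum k w k y| <= B * m%:R `^ a * `|x - y| `^ a.
Proof.
have [B B0 HB] := @bump_holder R k; exists (B *+ 2); first by rewrite pmulrn_lgt0.
move=> m w x y a /andP[x0 x1] /andP[y0 y1] a01.
pose jx := Num.truncn (m%:R * x); pose jy := Num.truncn (m%:R * y).
have out z (j : nat) : 0 <= z -> j != Num.truncn (m%:R * z) ->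
    bump_deriv k.+1 k (m%:R * z - j%:R) = 0.
  move=> z0 jz; apply: bump_out => //; apply: contra jz => /andP[H1 H2].
  apply/eqP/esym/truncn_def; rewrite -natr1; apply/andP; split; lra.
pose T := B * (m%:R `^ a * `|x - y| `^ a).
have T0 : 0 <= T by rewrite /T !mulr_ge0 ?powR_ge0// ltW.
apply: (@le_trans _ _ (\sum_(j < m) (((j == jx :> nat)%:R + (j == jy :> nat)%:R) * T))).
  rewrite /bump_sum -sumrB; apply: le_trans (ler_norm_sum _ _ _) _.
  apply: ler_sum => j _; rewrite -mulrBr normrM.
  have wj : `|(w j)%:R| <= 1 :> R by rewrite normr_nat; case: (w j).
  apply: (@le_trans _ _ `|bump_deriv k.+1 k (m%:R * x - j%:R) - bump_deriv k.+1 k (m%:R * y - j%:R)|).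
    by rewrite ler_piMl.
  have Hj : `|bump_deriv k.+1 k (m%:R * x - j%:R) - bump_deriv k.+1 k (m%:R * y - j%:R)| <= T.
    apply: le_trans (HB _ _ _ a01) _; rewrite /T.
    have -> : m%:R * x - j%:R - (m%:R * y - j%:R) = m%:R * (x - y) by ring.
    by rewrite normrM normr_nat powRM.
  have [jjx|jjx] := eqVneq (j : nat) jx.
    by apply: le_trans Hj _; rewrite ler_peMl// lerDl ler0n.
  have [jjy|jjy] := eqVneq (j : nat) jy.
    by apply: le_trans Hj _; rewrite add0r mul1r.
  by rewrite !out// subrr normr0 addr0 mul0r.
rewrite -mulr_suml big_split/=.
have one (j0 : nat) : \sum_(j < m) (j == j0 :> nat)%:R <= 1 :> R.
  case: (ltnP j0 m) => [j0m|mj0].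
    rewrite (bigD1 (Ordinal j0m))//= eqxx big1 ?addr0// => j jj0.
    by case: eqP => // E; move/eqP: jj0; case; apply/val_inj.
  rewrite big1// => j _; case: eqP => // E.
  by have := ltn_ord j; rewrite E ltnNge mj0.
apply: (@le_trans _ _ (2 * T)); first by apply: ler_wpM2r => //; have := one jx; have := one jy; lra.
by rewrite /T -[B *+ 2]mulr_natl !mulrA.
Qed.

(** The height of the bumps is the largest order that the Hoelder condition allows
    for cells of length [1 / m]. *)
Definition hyp_fun (h beta A : R) (m : nat) (w : 'I_m -> bool) (x : R) : R :=
  h + A * m%:R `^ (- beta) * bump_sum (smoothness_order beta) w 0 x.

(** The derivative of order [k] has Hoelder constant at most
    [A * m `^ (- beta) * m ^+ k * (B * m `^ (beta - k)) = A * B]. *)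
Lemma hyp_fun_class (h beta L : R) : 0 < beta -> 0 < L -> h < 1 ->
  exists2 A0 : R, 0 < A0 & forall A m (w : 'I_m -> bool), 0 < A <= A0 -> (0 < m)%N ->
    holder_class_bounded h beta L (hyp_fun h beta A w).
Proof.
move=> b0 L0 h1; have [kb kmax] := smoothness_orderP b0.
set k := smoothness_order beta in kb kmax *.
have bk : beta <= k.+1%:R.
  rewrite leNgt; apply/negP => H; have := kmax k.+1%:Z H; rewrite lez_nat; lia.
have a01 : 0 < beta - k%:R <= 1 by rewrite subr_gt0 kb lerBlDr addrC natr1.
have [B B0 HB] := bump_sum_holder k.
exists (Num.min (1 - h) (L / B)); first by rewrite lt_min subr_gt0 h1 divr_gt0.
move=> A m w /andP[A0]; rewrite le_min => /andP[A1 A2] m0.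
have mR : 1 <= m%:R :> R by rewrite ler1n.
have mR0 : 0 < m%:R :> R by rewrite ltr0n.
pose F i x := (i == 0)%N%:R * h + A * m%:R `^ (- beta) * (m%:R ^+ i * bump_sum k w i x).
have FE x : hyp_fun h beta A w x = F 0%N x by rewrite /F /hyp_fun -/k mul1r expr0 mul1r.
have dF i : (i < k)%N -> has_deriv01 (F i) (F i.+1).
  move=> ik; apply: is_derive_has_deriv01 => x.
  have H1 := is_derive_bump_sum w x ik.
  have H2 := is_deriveZ (A * m%:R `^ (- beta) * m%:R ^+ i) H1.
  have H3 := is_deriveD (is_derive_cst ((i == 0)%N%:R * h : R) x 1) H2.
  have -> : F i = cst ((i == 0)%N%:R * h) +
      (A * m%:R `^ (- beta) * m%:R ^+ i) \*: (bump_sum k w i).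
    by apply/funext => y; rewrite /F [RHS]/(_ + _ * _) mulrA.
  apply: is_derive_eq H3 _; rewrite /F add0r /= mul0r add0r -[_ *: _]/(_ * _).
  by rewrite exprSr !mulrA.
have nF j i : (i + j)%N = k -> has_nderiv01 j (F i) (F k).
  elim: j i => [|j IH] i ijk /=; first by move=> x _; rewrite -ijk addn0.
  exists (F i.+1); first by apply: dF; rewrite -ijk addnS ltnS leq_addr.
  by apply: IH; rewrite addSnnS.
split; last first.
  move=> x x01; rewrite /hyp_fun -/k.
  have /andP[s0 s1] := bump_sum01 k w x01.
  have pb : m%:R `^ (- beta) <= 1.
    rewrite powRN invf_le1 ?powR_gt0//.
    have : 1 `^ beta <= m%:R `^ beta by apply: ge0_ler_powR; rewrite ?nnegrE ?(ltW b0).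
    by rewrite powR1.
  have pb0 : 0 <= m%:R `^ (- beta) by exact: powR_ge0.
  have Am : A * m%:R `^ (- beta) <= 1 - h.
    by apply: le_trans A1; rewrite ler_piMr// ltW.
  have Am0 : 0 <= A * m%:R `^ (- beta) by rewrite mulr_ge0// ltW.
  rewrite lerDl mulr_ge0//= -lerBrDl; apply: le_trans Am.
  by rewrite ler_piMr.
have -> : hyp_fun h beta A w = F 0%N by apply/funext => x; exact: FE.
exists (F k); first by apply: nF; rewrite add0n.
move=> x y x01 y01; rewrite -/k /F.
set c := A * _; set e := _ * h.
have -> : e + c * (m%:R ^+ k * bump_sum k w k x) - (e + c * (m%:R ^+ k * bump_sum k w k y)) =
   c * m%:R ^+ k * (bump_sum k w k x - bump_sum k w k y) by ring.
have c0 : 0 <= c * m%:R ^+ k by rewrite /c !mulr_ge0 ?powR_ge0 ?exprn_ge0// ltW.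
rewrite normrM (ger0_norm c0).
apply: le_trans (ler_wpM2l c0 (HB m w x y _ x01 y01 a01)) _.
rewrite [B * _ * _]mulrC; rewrite mulrCA mulrC; apply: ler_wpM2r; first exact: powR_ge0.
have -> : c * m%:R ^+ k * (B * m%:R `^ (beta - k%:R)) = A * B.
  rewrite /c -(powR_mulrn _ (ltW mR0)).
  have -> : A * m%:R `^ (- beta) * m%:R `^ k%:R * (B * m%:R `^ (beta - k%:R)) =
    A * B * (m%:R `^ (- beta) * m%:R `^ k%:R * m%:R `^ (beta - k%:R)) by ring.
  rewrite -!powRD ?(gt_eqF mR0) ?implybT//.
  have -> : - beta + k%:R + (beta - k%:R) = 0 by ring.
  by rewrite powRr0 mulr1.
by move: A2; rewrite ler_pdivlMr.
Qed.

End hypotheses.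

(** * Assouad's argument *)

Section assouad.
Local Open Scope classical_set_scope.
Variable R : realType.
Local Notation mu := (@lebesgue_measure R).

(** For [x = i.+1 / n] the condition on [x] puts [i.+1] into an open interval of
    length [n / m]. *)
Lemma design_count (n m : nat) (j : nat) : (0 < n)%N -> (j < m)%N ->
  \sum_(i < n) (if 0 < (m%:R * (i.+1%:R / n%:R) - j%:R : R) < 1 then 1 else 0)
    <= n%:R / m%:R + 1 :> R.
Proof.
move=> n0 jm; have nR : 0 < n%:R :> R by rewrite ltr0n.
have m0 : (0 < m)%N by exact: leq_ltn_trans jm.
have mR : 0 < m%:R :> R by rewrite ltr0n.
pose u : R := j%:R * n%:R / m%:R; pose v : R := j.+1%:R * n%:R / m%:R.
have u0 : 0 <= u by rewrite /u divr_ge0.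
have v0 : 0 <= v by rewrite /v divr_ge0.
have vu : v = u + n%:R / m%:R by rewrite /v /u -natr1; field; rewrite gt_eqF.
have nm0 : 0 <= n%:R / m%:R :> R by rewrite divr_ge0.
pose a := Num.truncn u; pose b := Num.truncn v.
have /andP[au ua] := truncn_itv u0; have /andP[bv vb] := truncn_itv v0.
have ab : (a <= b)%N by apply: le_truncn; rewrite vu lerDl.
have cell (i : 'I_n) : 0 < (m%:R : R) * (i.+1%:R / n%:R) - j%:R < 1 -> (a <= i < b)%N.
  have E : m%:R * (i.+1%:R / n%:R) = i.+1%:R * (m%:R / n%:R) :> R by ring.
  rewrite E ltrBlDr subr_gt0 => /andP[H1 H2].
  have q0 : 0 < m%:R / n%:R :> R by rewrite divr_gt0.
  have H3 : u < i.+1%:R.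
    have -> : u = j%:R / (m%:R / n%:R) by rewrite /u; field; rewrite !gt_eqF.
    by rewrite ltr_pdivrMr.
  have H4 : i.+1%:R < v.
    have -> : v = (1 + j%:R) / (m%:R / n%:R).
      by rewrite /v -natr1; field; rewrite !gt_eqF.
    by rewrite ltr_pdivlMr.
  apply/andP; split.
    by rewrite -ltnS -(ltr_nat R) (le_lt_trans au).
  by rewrite /b truncn_ge_nat// ltW.
apply: (@le_trans _ _ (\sum_(i < n) (if (a <= i < b)%N then 1 else 0))).
  apply: ler_sum => i _; case: ifP => [/cell -> //|_].
  by case: ifP.
have bn : (a + (b - a) <= n)%N.
  rewrite subnKC// -(ler_nat R) (le_trans bv)// /v ler_pdivrMr// mulrC.
  by rewrite ler_pM2l// ler_nat.
have := @sum_window R n a (b - a) (fun=> 1) bn; rewrite subnKC// => ->.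
rewrite sumr_const_nat subn0.
rewrite natrB// lerBlDr; have := vu; have : (b%:R : R) <= v by [].
have : u < a%:R + 1 by rewrite natr1.
lra.
Qed.

(** Truncating two losses at [g] preserves their separation. *)
Lemma min_sep (a b g : \bar R) : (0 <= a -> 0 <= b -> 0 <= g -> g <= a + b ->
  g <= mine a g + mine b g)%E.
Proof.
move=> a0 b0 g0 gab; have [ga|ag] := leP g a.
  by rewrite leeDl// le_min b0.
by have [gb|bg] := leP g b; rewrite // leeDr.
Qed.

Definition flip m (j : 'I_m) (w : {ffun 'I_m -> bool}) : {ffun 'I_m -> bool} :=
  [ffun i => if i == j then ~~ w i else w i].

Lemma flipK m (j : 'I_m) : involutive (flip j).
Proof.
by move=> w; apply/ffunP => i; rewrite !ffunE; case: eqP => // _; rewrite negbK.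
Qed.

Section cells.
Variables (h beta A : R) (m : nat).
Hypotheses (h0 : 0 < h) (h1 : h < 1) (A0 : 0 < A) (m0 : (0 < m)%N).
Let k := smoothness_order beta.
Let f (w : {ffun 'I_m -> bool}) := hyp_fun h beta A w.
Hypothesis f01 : forall w x, 0 <= x <= 1 -> h <= f w x <= 1.
Let rho : R := A * m%:R `^ (- beta).
Let rho0 : 0 < rho. Proof. by rewrite mulr_gt0// powR_gt0// ltr0n. Qed.
Let mR : 0 < m%:R :> R. Proof. by rewrite ltr0n. Qed.

Lemma flip_diff (j : 'I_m) w x :
  `|f w x - f (flip j w) x| = rho * `|bump_deriv k.+1 0 (m%:R * x - j%:R)|.
Proof.
rewrite /f /hyp_fun -/k -/rho.
have -> : h + rho * bump_sum k w 0 x - (h + rho * bump_sum k (flip j w) 0 x) =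
  rho * (bump_sum k w 0 x - bump_sum k (flip j w) 0 x) by ring.
rewrite normrM (gtr0_norm rho0); congr (_ * _).
rewrite /bump_sum (bigD1 j)//= [X in _ - X](bigD1 j)//=.
have -> : \sum_(i < m | i != j) (flip j w i)%:R * bump_deriv k.+1 0 (m%:R * x - i%:R) =
    \sum_(i < m | i != j) (w i)%:R * bump_deriv k.+1 0 (m%:R * x - i%:R).
  by apply: eq_bigr => i ij; rewrite ffunE (negbTE ij).
rewrite opprD addrACA subrr addr0 ffunE eqxx -mulrBl normrM.
by case: (w j); rewrite /= ?subr0 ?sub0r ?normrN normr1 mul1r.
Qed.

(** Only the design points inside cell [j] contribute. There the variances differ
    by [(v - u) * (v + u)] with [`|v - u| <= rho] and [v + u <= 2], and they are at
    least [h ^+ 2 + s ^+ 2], whose square dominates [h ^+ 4 * max 1 (s ^+ 4)]. *)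
Lemma flip_variance (n : nat) (s : R) (j : 'I_m) w : (0 < n)%N ->
  \sum_(i < n) ((obs_sd s (f (flip j w)) i ^+ 2 - obs_sd s (f w) i ^+ 2) /
     obs_sd s (f (flip j w)) i ^+ 2) ^+ 2 <=
  (n%:R / m%:R + 1) * (4 * rho ^+ 2 / (h ^+ 4 * Num.max 1 (s ^+ 4))).
Proof.
move=> n0; have nR : 0 < n%:R :> R by rewrite ltr0n.
set S := Num.max 1 _; have S0 : 0 < S by rewrite lt_max ltr01.
have c0 : 0 <= 4 * rho ^+ 2 / (h ^+ 4 * S).
  by rewrite divr_ge0 ?mulr_ge0 ?sqr_ge0// ?exprn_ge0 ltW.
apply: (@le_trans _ _ (\sum_(i < n)
   (if 0 < (m%:R * (i.+1%:R / n%:R) - j%:R : R) < 1 then 1 else 0) *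
   (4 * rho ^+ 2 / (h ^+ 4 * S)))); last first.
  by rewrite -mulr_suml; apply: ler_wpM2r => //; exact: design_count.
apply: ler_sum => i _; set x := i.+1%:R / n%:R.
have x01 : 0 <= x <= 1 by exact: design01.
have := flip_diff j w x; rewrite /obs_sd -/x.
have /andP[u0 u1] := f01 w x01; have /andP[v0 v1] := f01 (flip j w) x01.
move: u0 u1 v0 v1; set u := f w x; set v := f (flip j w) x => u0 u1 v0 v1 D.
clearbody u v.
have v00 : 0 <= v := le_trans (ltW h0) v0.
have s0 := sqr_ge0 s.
rewrite !sqr_sqrtr ?addr_ge0 ?sqr_ge0//.
have -> : v ^+ 2 + s ^+ 2 - (u ^+ 2 + s ^+ 2) = (v - u) * (v + u) by ring.
have [_|out] := boolP (0 < m%:R * x - j%:R < 1); last first.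
  have -> : v - u = 0.
    apply/eqP; rewrite -normr_eq0 distrC D bump_out// normr0 mulr0//.
  by rewrite mul0r mul0r expr0n mul0r.
rewrite mul1r exprMn exprVn ler_pdivrMr ?exprn_gt0 ?ltr_pwDl ?exprn_gt0 ?(lt_le_trans h0)//.
have num : ((v - u) * (v + u)) ^+ 2 <= 4 * rho ^+ 2.
  have Duv : `|v - u| <= rho.
    rewrite distrC D ler_piMr ?(ltW rho0)//.
    have /andP[b0 b1] := @bump01 R k.+1 (m%:R * x - j%:R) (ltn0Sn k).
    by rewrite ger0_norm.
  rewrite -[leLHS]real_normK ?num_real// normrM.
  have vu2 : `|v + u| <= 2.
    rewrite ger0_norm; first lra.
    by apply: addr_ge0; apply: le_trans (ltW h0) _.
  have -> : 4 * rho ^+ 2 = (rho * 2) ^+ 2 by ring.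
  have r2 : 0 <= rho * 2 by rewrite mulr_ge0// ltW.
  by rewrite ler_sqr ?nnegrE//; apply: ler_pM.
have den : h ^+ 4 * S <= (v ^+ 2 + s ^+ 2) ^+ 2.
  have hv : h ^+ 2 <= v ^+ 2 by rewrite ler_sqr ?nnegrE// ltW.
  have h2 : 0 < h ^+ 2 by rewrite exprn_gt0.
  have h21 : h ^+ 2 <= 1 by rewrite expr_le1 ?ltW.
  have -> : h ^+ 4 = (h ^+ 2) ^+ 2 by ring.
  have -> : (v ^+ 2 + s ^+ 2) ^+ 2 = (v ^+ 2) ^+ 2 + 2 * (v ^+ 2 * s ^+ 2) + (s ^+ 2) ^+ 2 by ring.
  have vs : 0 <= v ^+ 2 * s ^+ 2 by rewrite mulr_ge0 ?sqr_ge0.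
  have s4 : 0 <= (s ^+ 2) ^+ 2 by exact: sqr_ge0.
  have v4 : (h ^+ 2) ^+ 2 <= (v ^+ 2) ^+ 2 by rewrite ler_sqr ?nnegrE ?sqr_ge0.
  have h41 : (h ^+ 2) ^+ 2 <= 1 by rewrite expr_le1// ltW.
  rewrite /S; case: (leP 1 (s ^+ 4)) => _; last by rewrite mulr1; lra.
  have -> : s ^+ 4 = (s ^+ 2) ^+ 2 by ring.
  have : (h ^+ 2) ^+ 2 * (s ^+ 2) ^+ 2 <= (s ^+ 2) ^+ 2 by rewrite ler_piMl.
  have := sqr_ge0 (v ^+ 2); lra.
have hS : 0 < h ^+ 4 * S by rewrite mulr_gt0// exprn_gt0.
rewrite mulrAC ler_pdivlMr//.
by apply: ler_pM => //; [exact: sqr_ge0|exact: ltW].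
Qed.

(** The middle half of the [j]-th interval of the partition, on which the bump is
    bounded below ([bump_ge]). *)
Definition cell (j : nat) : set R := `[(j%:R + 1 / 4) / m%:R, (j%:R + 3 / 4) / m%:R].

Lemma cell_mid j x : cell j x -> 1 / 4 <= m%:R * x - j%:R <= 3 / 4.
Proof.
rewrite /cell/= in_itv/= ler_pdivrMr// ler_pdivlMr// => /andP[? ?].
by apply/andP; split; lra.
Qed.

Lemma cell01 j : (j < m)%N -> cell j `<=` `[0, 1].
Proof.
move=> jm x /cell_mid /andP[H1 H2]; rewrite /= in_itv/=.
have j0 : 0 <= j%:R :> R by [].
have j1 : j.+1%:R <= m%:R :> R by rewrite ler_nat.
rewrite -natr1 in j1; apply/andP; split.
  by rewrite -(pmulr_rge0 _ mR); lra.
by rewrite -(ler_pM2l mR) mulr1; lra.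
Qed.

Lemma trivIset_cell (s : set 'I_m) : trivIset s (fun j : 'I_m => cell j).
Proof.
apply/trivIsetP => i j _ _ ij; apply/seteqP; split => // x [/cell_mid/andP[a b] /cell_mid/andP[c d]].
have h1' : i%:R < j.+1%:R :> R by rewrite -natr1; lra.
have h2' : j%:R < i.+1%:R :> R by rewrite -natr1; lra.
move/negP: ij; apply; apply/eqP/val_inj => /=.
by move: h1' h2'; rewrite !ltr_nat; lia.
Qed.

Lemma lebesgue_cell j : mu (cell j) = ((2 * m%:R)^-1)%:E.
Proof.
rewrite /cell lebesgue_measure_itv/= lte_fin ltr_pM2r ?invr_gt0// ltrD2l.
have -> : 1 / 4 < 3 / 4 :> R by lra.
rewrite -EFinB; congr (_%:E).
by field; rewrite gt_eqF.
Qed.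

Let kappa : R := (3 / 16) ^+ k.+1.
(** Half the squared height bound, times the length [1 / (2 * m)] of a cell. *)
Definition cell_gap : R := (rho * kappa) ^+ 2 / (4 * m%:R).

Lemma cell_gap_gt0 : 0 < cell_gap.
Proof.
apply: divr_gt0; last by rewrite mulr_gt0.
by rewrite exprn_gt0// mulr_gt0// exprn_gt0.
Qed.

Definition cell_loss (n : nat) (nu : n.-tuple R -> R -> R) w (j : 'I_m) (y : n.-tuple R) :=
  (\int[mu]_(x in cell j) ((f w x - nu y x) ^+ 2)%:E)%E.

(** [(a - c) ^+ 2 + (b - c) ^+ 2 >= (a - b) ^+ 2 / 2]: no value [c] is close to the
    functions with and without the bump. *)
Lemma cell_loss_sep n (nu : n.-tuple R -> R -> R) w (j : 'I_m) y :
  (forall w, measurable_fun `[(0 : R), 1] (f w)) -> is_estimator nu ->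
  (cell_gap%:E <= cell_loss nu w j y + cell_loss nu (flip j w) j y)%E.
Proof.
move=> mf mnu; rewrite /cell_loss.
have mc : measurable (cell j) by exact: measurable_itv.
have mq w' : measurable_fun (cell j) (fun x => ((f w' x - nu y x) ^+ 2)%:E).
  have mnuy : measurable_fun `[(0 : R), 1] (nu y).
    exact: estimator_section.
  apply/measurable_EFinP; apply: measurable_funX; apply: measurable_funB.
    by apply: measurable_funS (mf w') => //; exact: cell01.
  by apply: measurable_funS mnuy => //; exact: cell01.
have sq0 w' x : (0 <= ((f w' x - nu y x) ^+ 2)%:E)%E by rewrite lee_fin sqr_ge0.
rewrite -ge0_integralD//; [|exact: mq..].
apply: (@le_trans _ _ (\int[mu]_(x in cell j) ((rho * kappa) ^+ 2 / 2)%:E)%E).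
  rewrite integral_cst// [X in (_ * X)%E](lebesgue_cell j) -EFinM lee_fin /cell_gap le_eqVlt.
  by apply/orP; left; apply/eqP; field; rewrite gt_eqF.
apply: ge0_le_integral => //.
- by move=> x _; rewrite lee_fin divr_ge0// sqr_ge0.
- by apply: emeasurable_funD; exact: mq.
move=> x jx; rewrite -EFinD lee_fin.
have D := flip_diff j w x.
have b0 := bump_ge k.+1 (cell_mid jx).
have kap0 : 0 <= kappa by rewrite exprn_ge0.
have H : (rho * kappa) ^+ 2 <= (f w x - f (flip j w) x) ^+ 2.
  have r0 := ltW rho0.
  rewrite -[leRHS]real_normK ?num_real// D ler_sqr.
  - by apply: ler_wpM2l => //; rewrite ger0_norm// (le_trans kap0).
  - by rewrite nnegrE; exact: mulr_ge0.
  - by rewrite nnegrE; apply: mulr_ge0.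
move: H; set a := f w x; set b := f (flip j w) x; set c := nu y x => H.
have := sqr_ge0 (a + b - 2 * c).
have -> : (a + b - 2 * c) ^+ 2 = 2 * ((a - c) ^+ 2 + (b - c) ^+ 2) - (a - b) ^+ 2 by ring.
lra.
Qed.


Section assouad_bound.
Variables (n : nat) (s : R) (N : noise_model n s) (nu : n.-tuple R -> R -> R).
Hypotheses (n0 : (0 < n)%N) (s0 : 0 <= s) (mnu : is_estimator nu).
Hypothesis mf : forall w, measurable_fun `[(0 : R), 1] (f w).
Hypothesis close :
  (n%:R / m%:R + 1) * (4 * rho ^+ 2 / (h ^+ 4 * Num.max 1 (s ^+ 4))) <= 1 / 2.

(** The loss on a cell, truncated and rescaled to [0, 1]; for [w] and [flip j w]
   these are the overlapping errors to which [two_point] applies. *)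
Let test w j y : R := fine (mine (cell_loss nu w j y) cell_gap%:E) / cell_gap.

Let cell_loss0 w j y : (0 <= cell_loss nu w j y)%E.
Proof. by apply: integral_ge0 => x _; rewrite lee_fin sqr_ge0. Qed.

Let testE w j y : (mine (cell_loss nu w j y) cell_gap%:E = (cell_gap * test w j y)%:E)%E.
Proof.
rewrite /test mulrCA divff ?gt_eqF ?cell_gap_gt0// mulr1 fineK//.
rewrite ge0_fin_numE.
  by apply: le_lt_trans (ltry cell_gap); rewrite ge_min lexx orbT.
by rewrite le_min cell_loss0 lee_fin ltW// cell_gap_gt0.
Qed.

Let test01 w j y : 0 <= test w j y <= 1.
Proof.
have g0 := cell_gap_gt0.
rewrite -(pmulr_rge0 _ g0) -lee_fin -testE le_min cell_loss0 lee_fin (ltW g0)/=.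
by rewrite -(ler_pM2l g0) mulr1 -lee_fin -testE ge_min lexx orbT.
Qed.

Let test_le w j y : ((cell_gap * test w j y)%:E <= cell_loss nu w j y)%E.
Proof. by rewrite -testE ge_min lexx. Qed.

Let test_sep w j y : 1 <= test w j y + test (flip j w) j y.
Proof.
have g0 := cell_gap_gt0.
rewrite -(ler_pM2l g0) mulr1 mulrDr -lee_fin EFinD -!testE.
apply: min_sep; rewrite ?lee_fin ?(ltW g0)//; exact: cell_loss_sep.
Qed.

Let measurable_test w j : measurable_fun [set: n.-tuple R] (test w j).
Proof.
apply: measurable_funM; last exact: measurable_cst.
have mc : measurable_fun [set: n.-tuple R] (cell_loss nu w j).
  by apply: measurable_loss => //; [exact: measurable_itv|exact: cell01].
apply: measurableT_comp => //.
exact: measurable_mine.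
Qed.

Let test_sum w y : ((cell_gap * \sum_(j < m) test w j y)%:E <=
  \int[mu]_(x in `[0%R, 1%R]) ((f w x - nu y x) ^+ 2)%:E)%E.
Proof.
rewrite mulr_sumr -sumEFin.
apply: (@le_trans _ _ (\sum_(j < m) cell_loss nu w j y)%E).
  by apply: lee_sum => j _; exact: test_le.
have mq : measurable_fun `[(0 : R), 1] (fun x => ((f w x - nu y x) ^+ 2)%:E).
  apply/measurable_EFinP; apply: measurable_funX; apply: measurable_funB => //.
  exact: estimator_section.
have c01 : \big[setU/set0]_(j < m) cell j `<=` `[(0 : R), 1].
  elim/big_ind: _ => [|D E HD HE|j _]; first exact: sub0set.
    by rewrite subUset; split.
  exact: cell01.
have mU : measurable (\big[setU/set0]_(j < m) cell j).
  by apply: bigsetU_measurable => j _; exact: measurable_itv.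
rewrite /cell_loss -ge0_integral_bigsetU//=.
- apply: ge0_subset_integral => //.
  by move=> x _; rewrite lee_fin sqr_ge0.
- by move=> j; exact: measurable_itv.
- exact: index_enum_uniq.
- exact: trivIset_cell.
- exact: measurable_funS mq.
- by move=> x _; rewrite lee_fin sqr_ge0.
Qed.

(** Averaged over all [w], the risk is at least the sum over the cells of the
    average error on each cell; pairing [w] with [flip j w] bounds the latter from
    below. Some [w] does at least as badly as the average. *)
Lemma assouad : exists w, ((cell_gap * (m%:R / 16))%:E <= risk N (f w) nu)%E.
Proof.
have g0 := cell_gap_gt0.
have fpos w (i : 'I_n) : 0 < f w (i.+1%:R / n%:R).
  by have /andP[u0 _] := f01 w (design01 R i); exact: lt_le_trans u0.
have /choice[Q HQ] : forall w : {ffun 'I_m -> bool}, exists Q : probability (n.-tuple R) R,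
    product_law (fun i => gauss (obs_sd s (f w) i)) Q /\
    risk N (f w) nu =
      (\int[Q]_y \int[mu]_(x in `[0%R, 1%R]) ((f w x - nu y x) ^+ 2)%:E)%E.
  by move=> w; have [Q H1 H2] := risk_law N s0 (fpos w) (mf w) mnu; exists Q.
have sd0 : forall w (i : 'I_n), 0 < obs_sd s (f w) i.
  by move=> w i; exact: obs_sd_gt0.
pose e w j := fine (\int[Q w]_y (test w j y)%:E).
have eE w j : (\int[Q w]_y (test w j y)%:E)%E = (e w j)%:E.
  by have [fn _] := measurable_unit_integral (Q w) (measurable_test w j) (test01 w j); rewrite /e fineK.
have pair w j : 1 / 8 <= e w j + e (flip j w) j.
  have [HP _] := HQ w; have [HQ' _] := HQ (flip j w).
  rewrite -lee_fin EFinD -!eE.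
  apply: two_point HP HQ' _ _ _ _ _ => //.
  exact: le_trans (flip_variance s j w n0) close.
have low w : ((cell_gap * \sum_(j < m) e w j)%:E <= risk N (f w) nu)%E.
  have [_ ->] := HQ w.
  have -> : ((cell_gap * \sum_(j < m) e w j)%:E =
      \int[Q w]_y (cell_gap * \sum_(j < m) test w j y)%:E)%E.
    under [RHS]eq_integral do rewrite EFinM -sumEFin.
    rewrite ge0_integralZl//; last 3 first.
    - by apply: emeasurable_sum => j; apply/measurable_EFinP; exact: measurable_test.
    - by move=> y _; apply: sume_ge0 => j _; rewrite lee_fin; have /andP[] := test01 w j y.
    - by rewrite lee_fin ltW.
    rewrite ge0_integral_sum//; last 2 first.
    - by move=> j; apply/measurable_EFinP; exact: measurable_test.
    - by move=> j y _; rewrite lee_fin; have /andP[] := test01 w j y.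
    by rewrite EFinM -sumEFin; under [in RHS]eq_bigr do rewrite eE.
  apply: ge0_le_integral => //.
  - move=> y _; rewrite lee_fin mulr_ge0 ?(ltW g0)//; apply: sumr_ge0 => j _.
    by have /andP[] := test01 w j y.
  - apply/measurable_EFinP; apply: measurable_funM => //.
    by apply: measurable_sum => j; exact: measurable_test.
  - exact: measurable_loss.
apply/not_existsP => H.
have lt w : \sum_(j < m) e w j < m%:R / 16.
  rewrite -(ltr_pM2l g0) -lte_fin; apply: le_lt_trans (low w) _.
  by rewrite ltNge; exact/negP/H.
have tot : #|{ffun 'I_m -> bool}|%:R * (m%:R / 16) <= \sum_w \sum_(j < m) e w j.
  rewrite exchange_big/=.
  apply: (@le_trans _ _ (\sum_(j < m) #|{ffun 'I_m -> bool}|%:R / 16)).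
    by rewrite sumr_const card_ord -mulr_natr; lra.
  apply: ler_sum => j _.
  have E : \sum_w e w j = \sum_w e (flip j w) j.
    by rewrite (reindex_inj (inv_inj (flipK j))).
  have : \sum_(w : {ffun 'I_m -> bool}) (1 / 8 : R) <= \sum_w (e w j + e (flip j w) j).
    by apply: ler_sum => w _; exact: pair.
  rewrite big_split/= -E sumr_const -mulr_natr; lra.
have : \sum_w \sum_(j < m) e w j < \sum_(w : {ffun 'I_m -> bool}) (m%:R / 16).
  by apply: ltr_sum => [|w _ //]; apply/hasP; exists [ffun=> true]; rewrite ?mem_index_enum.
rewrite sumr_const -mulr_natl; lra.
Qed.

End assouad_bound.
End cells.
End assouad.

(** * The lower bound *)

Section lower_bound.
Local Open Scope classical_set_scope.
Variable R : realType.

Lemma minimax_risk_ge n (s : R) (N : noise_model n s) (F : set (R -> R)) (B : \bar R) :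
  (forall nu, is_estimator nu -> exists2 f, F f & (B <= risk N f nu)%E) ->
  (B <= minimax_risk N F)%E.
Proof.
move=> HB; apply: le_ereal_inf_tmp => _ [nu /= mnu <-].
have [f Ff Bf] := HB nu mnu; apply: le_trans Bf _.
by apply: ereal_sup_ubound; exists f.
Qed.

(** [m] is of order [1 / eta], where [eta] is the length scale of [rate_split],
    unless [eta > 1], in which case [m = 1] and the rate is 1. *)
Lemma lower_bound (beta L h : R) : 0 < beta -> 0 < L -> 0 < h -> h < 1 ->
  exists2 C2 : R, 0 < C2 & forall n (s : R) (N : noise_model n s),
    (0 < n)%N -> 0 <= s ->
    ((Num.min 1 ((Num.max 1 (s ^+ 4) / n%:R) `^ (2 * beta / (2 * beta + 1))))%:E <=
     C2%:E * minimax_risk N (holder_class_bounded h beta L))%E.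
Proof.
move=> b0 L0 h0 h1; have [A0 A00 HA0] := hyp_fun_class b0 L0 h1.
have h20 : 0 < h ^+ 2 by rewrite exprn_gt0.
(* the factor 5 makes [12 * (A / h ^+ 2) ^+ 2 <= 1 / 2] in [close] below *)
pose A := Num.min A0 (h ^+ 2 / 5).
have A_gt0 : 0 < A by rewrite lt_min A00 divr_gt0.
have AA0 : 0 < A <= A0 by rewrite A_gt0 ge_min lexx.
have Ah : A <= h ^+ 2 / 5 by rewrite ge_min lexx orbT.
pose kappa : R := (3 / 16) ^+ (smoothness_order beta).+1.
have kap0 : 0 < kappa by rewrite exprn_gt0// divr_gt0.
pose D : R := 2 `^ beta; have D0 : 0 < D by rewrite powR_gt0.
pose c : R := (A * kappa) ^+ 2 / (64 * D ^+ 2).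
have c0 : 0 < c by rewrite divr_gt0 ?exprn_gt0 ?mulr_gt0 ?exprn_gt0.
exists c^-1; first by rewrite invr_gt0.
move=> n s N n0 s0.
set S := Num.max 1 _; have S1 : 1 <= S by rewrite le_max lexx.
have S0 : 0 < S by exact: lt_le_trans S1.
have nR : 0 < n%:R :> R by rewrite ltr0n.
have n1 : 1 <= n%:R :> R by rewrite ler1n.
have x0 : 0 < S / n%:R by rewrite divr_gt0.
have [] := rate_split b0 x0; set eta := _ `^ _ => e0 xE ->.
set rho := (eta `^ beta) ^+ 2 in xE *.
have E0 : 0 < eta `^ beta by exact: powR_gt0.
have rho0 : 0 < rho by rewrite exprn_gt0.
have ei0 : 0 <= eta^-1 by rewrite invr_ge0 ltW.
pose m := (Num.truncn eta^-1).+1; have m0 : (0 < m)%N by [].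
have mR : 0 < m%:R :> R by rewrite ltr0n.
have /andP[m1 m2] := truncn_itv ei0; rewrite -/m in m2.
have {m1} m3 : m%:R <= eta^-1 + 1 by rewrite /m -natr1; lra.
pose Y : R := m%:R `^ beta; have Y0 : 0 < Y by exact: powR_gt0.
have qY : m%:R `^ (- beta) = Y^-1 by rewrite powRN.
have powE (a b : R) : 0 < a -> a <= b -> a `^ beta <= b `^ beta.
  move=> a0 ab; apply: ge0_ler_powR; rewrite ?nnegrE ?(ltW b0) ?(ltW a0)//.
  exact: le_trans (ltW a0) ab.
have em1 : 1 <= eta * m%:R.
  by rewrite -ler_pdivrMl// mulr1 ltW.
have EY1 : 1 <= eta `^ beta * Y.
  by have := powE _ _ ltr01 em1; rewrite powR1 powRM// ltW.
have EY2 : Num.min 1 (eta `^ beta) * Y <= D.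
  have [e1|e1] := leP eta 1.
    have em2 : eta * m%:R <= 2.
      have : eta * m%:R <= eta * (eta^-1 + 1) by rewrite ler_pM2l.
      rewrite mulrDr mulfV ?gt_eqF// mulr1; lra.
    apply: (@le_trans _ _ (eta `^ beta * Y)).
      by rewrite ler_wpM2r ?(ltW Y0)// ge_min lexx orbT.
    by rewrite -powRM ?(ltW e0)//; apply: powE; rewrite // mulr_gt0.
  apply: (@le_trans _ _ Y); first by rewrite ler_piMl ?(ltW Y0)// ge_min lexx.
  apply: powE => //; apply: le_trans m3 _.
  have : eta^-1 <= 1 by rewrite invf_le1// ltW.
  lra.
have m2n : m%:R <= 2 * n%:R :> R.
  suff en : eta^-1 <= n%:R.
    apply: le_trans m3 _; have := lerD en n1; have -> : 2 * n%:R = n%:R + n%:R :> R by ring.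
    by [].
  have [e1|e1] := leP eta 1; last first.
    by apply: le_trans n1; rewrite invf_le1// ltW.
  have rho1 : rho <= 1.
    have : eta `^ beta <= 1 `^ beta by exact: powE.
    by rewrite powR1 => ?; rewrite expr_le1 ?powR_ge0.
  rewrite -[leLHS]mul1r ler_pdivrMr//.
  apply: le_trans S1 _.
  have -> : S = n%:R * (eta * rho) by rewrite -xE mulrC divfK// gt_eqF.
  by rewrite ler_wpM2l// ler_piMr// ltW.
have close : (n%:R / m%:R + 1) *
    (4 * (A * m%:R `^ (- beta)) ^+ 2 / (h ^+ 4 * S)) <= 1 / 2.
  have H1 : n%:R / m%:R + 1 <= 3 * (n%:R / m%:R) :> R.
    have H : 1 <= 2 * (n%:R / m%:R) :> R by rewrite mulrA ler_pdivlMr// mul1r.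
    move: H; lra.
  have SE : S = n%:R * (eta * rho) by rewrite -xE mulrC divfK// gt_eqF.
  have h40 : 0 < h ^+ 4 by rewrite exprn_gt0.
  apply: (@le_trans _ _ (3 * (n%:R / m%:R) *
    (4 * (A * m%:R `^ (- beta)) ^+ 2 / (h ^+ 4 * S)))).
    apply: ler_wpM2r => //; apply: divr_ge0; first exact: mulr_ge0 (sqr_ge0 _).
    exact: mulr_ge0 (ltW h40) (ltW S0).
  rewrite qY SE.
  have -> : 3 * (n%:R / m%:R) * (4 * (A / Y) ^+ 2 / (h ^+ 4 * (n%:R * (eta * rho)))) =
     12 * (A / h ^+ 2) ^+ 2 / ((eta * m%:R) * (eta `^ beta * Y) ^+ 2).
    by rewrite /rho; field; rewrite !gt_eqF.
  have q1 : 1 <= (eta `^ beta * Y) ^+ 2 by rewrite expr_ge1// mulr_ge0// ltW.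
  have P1 : 1 <= eta * m%:R * (eta `^ beta * Y) ^+ 2.
    exact: mulr_ege1 em1 q1.
  rewrite ler_pdivrMr ?(lt_le_trans ltr01)//.
  have Ah' : (A / h ^+ 2) ^+ 2 <= (1 / 5) ^+ 2.
    rewrite ler_sqr ?nnegrE ?divr_ge0 ?(ltW h20) ?(ltW A_gt0)//.
    by rewrite ler_pdivrMr// mul1r mulrC.
  move: Ah' P1; set a := (A / h ^+ 2) ^+ 2; set p := _ * _ ^+ 2.
  have -> : (1 / 5) ^+ 2 = 1 / 25 :> R by field.
  lra.
have class (w : 'I_m -> bool) : holder_class_bounded h beta L (hyp_fun h beta A w).
  exact: (HA0 A m w).
have low : (((A * Y^-1 * kappa) ^+ 2 / 64)%:E <=
    minimax_risk N (holder_class_bounded h beta L))%E.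
  apply: minimax_risk_ge => nu mnu.
  have f01 (w : {ffun 'I_m -> bool}) x : 0 <= x <= 1 -> h <= hyp_fun h beta A w x <= 1.
    by have [_] := class w; exact.
  have mf (w : {ffun 'I_m -> bool}) : measurable_fun `[(0 : R), 1] (hyp_fun h beta A w).
    by have [Hh _] := class w; exact: holder_measurable Hh.
  have [w Hw] := assouad h0 h1 A_gt0 m0 f01 N n0 s0 mnu mf close.
  exists (hyp_fun h beta A w); first exact: class.
  apply: le_trans Hw; rewrite lee_fin /cell_gap qY -/kappa le_eqVlt.
  by apply/orP; left; apply/eqP; field; rewrite !gt_eqF.
have rate : Num.min 1 rho <= (D / Y) ^+ 2.
  have M1 : Num.min 1 (eta `^ beta) <= D / Y by rewrite ler_pdivlMr.
  have M0 : 0 <= Num.min 1 (eta `^ beta) by rewrite le_min ler01 ltW.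
  apply: (@le_trans _ _ ((Num.min 1 (eta `^ beta)) ^+ 2)); last first.
    by rewrite ler_sqr ?nnegrE// divr_ge0// ltW.
  rewrite /rho; case: (leP 1 (eta `^ beta)) => _; first by rewrite expr1n ge_min lexx.
  by rewrite ge_min lexx orbT.
apply: (@le_trans _ _ (c^-1%:E * ((A * Y^-1 * kappa) ^+ 2 / 64)%:E)%E); last first.
  by apply: lee_wpmul2l => //; rewrite lee_fin invr_ge0 ltW.
rewrite -EFinM lee_fin; apply: le_trans rate _.
rewrite le_eqVlt; apply/orP; left; apply/eqP; rewrite /c.
by field; rewrite !gt_eqF.
Qed.

End lower_bound.

Theorem theorem2p1 (R : realType) (beta L h : R)
    (beta_gt0 : 0 < beta) (L_gt0 : 0 < L) (h_gt0 : 0 < h) (h_lt1 : h < 1) :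
  exists C1 C2 : R, [/\ 0 < C1, 0 < C2 &
    forall (sigma : nat -> R), (forall n : nat, (0 < n)%N -> 0 <= sigma n) ->
    forall (N : forall n : nat, noise_model n (sigma n)),
    bigTheta_const C1 C2
      (fun n : nat => minimax_risk (N n) (holder_class_bounded h beta L))
      (fun n : nat =>
         (Num.min 1 ((Num.max 1 (sigma n ^+ 4) / n%:R)
                       `^ (2 * beta / (2 * beta + 1))))%:E)].
Proof.
have [C1 C10 H1] := upper_bound beta_gt0 L_gt0 h_gt0.
have [C2 C20 H2] := lower_bound beta_gt0 L_gt0 h_gt0 h_lt1.
exists C1, C2; split=> // sigma sigma0 N.
have rate0 n : (0 <= (Num.min 1 ((Num.max 1 (sigma n ^+ 4) / n%:R)
    `^ (2 * beta / (2 * beta + 1))))%:E)%E.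
  by rewrite lee_fin le_min ler01 powR_ge0.
have risk0 n : (0 <= minimax_risk (N n) (holder_class_bounded h beta L))%E.
  apply: le_ereal_inf_tmp => _ [nu /= mnu <-].
  have [f Ff] : exists f, holder_class_bounded h beta L f.
    have [A0 A00 HA] := hyp_fun_class beta_gt0 L_gt0 h_lt1.
    by exists (hyp_fun h beta A0 (fun _ : 'I_1 => true)); apply: HA; rewrite // A00 lexx.
  apply: (@le_trans _ _ (risk (N n) f nu)).
    apply: integral_ge0 => w _; apply: integral_ge0 => x _.
    by rewrite lee_fin sqr_ge0.
  by apply: ereal_sup_ubound; exists f.
split; exists 1 => // n; rewrite ltr1n => n1; have n0 : (0 < n)%N by exact: ltnW.
  by rewrite !gee0_abs//; apply: H1 => //; exact: sigma0.
by rewrite !gee0_abs//; apply: H2 => //; exact: sigma0.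
Qed.
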